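(* Let $\Omega\subseteq\mathbb{R}^2$ be open, let $x_1,\ldots,x_N\in\Omega$ be distinct points and let $y_1,\ldots,y_N\in\mathbb{R}$. Let $\lambda\in[0,\infty]$. Then there exists a minimizer in $L^1_{\mathrm{loc}}(\Omega)$ of the functional $\mathcal{F}^{1,1}_\lambda:L^1_{\mathrm{loc}}(\Omega)\to[0,\infty]$, $$\mathcal{F}^{1,1}_\lambda(f):=|\mathrm{D}^2_1f|(\Omega)+\lambda\sum_{i=1}^N|f(x_i)-y_i|,$$ with the convention $\infty\cdot0=0$ (so that for $\lambda=\infty$ the functional equals $|\mathrm{D}^2_1f|(\Omega)$ if $f(x_i)=y_i$ for all $i$, and $\infty$ otherwise).
   Context: Schatten norms: for $M\in\mathbb{R}^{2\times2}$ and $p\in[1,\infty]$, $|M|_p$ is the $\ell^p$ norm of the vector of singular values of $M$. Hessian--Schatten variation with $p=1$: for $\Omega\subseteq\mathbb{R}^2$ open, $f\in L^1_{\mathrm{loc}}(\Omega)$ and $A\subseteq\Omega$ open, $$|\mathrm{D}^2_1f|(A):=\sup\Big\{\int_A\sum_{i,j=1}^2 f\,\partial_i\partial_jF_{i,j}\,d\mathscr{L}^2:\ F\in C_c^\infty(A)^{2\times2},\ \sup_{x}|F(x)|_{\infty}\le1\Big\}.$$ Convention on point values: in dimension $2$, any $f\in L^1_{\mathrm{loc}}(\Omega)$ with $|\mathrm{D}^2_1f|(\Omega)<\infty$ has a continuous representative, and $f(x_i)$ denotes the value of this representative; if $|\mathrm{D}^2_1f|(\Omega)=\infty$ then $\mathcal{F}^{1,1}_\lambda(f)=\infty$.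 *)

(* Defs.v *)
From HB Require Import structures.
From mathcomp Require Import all_boot all_order all_algebra.
From mathcomp Require Import all_classical all_reals all_analysis.
Set Implicit Arguments.
Unset Strict Implicit.
Unset Printing Implicit Defensive.
Import Order.TTheory GRing.Theory Num.Theory.
Import numFieldNormedType.Exports.
Local Open Scope classical_set_scope.
Local Open Scope ring_scope.

Definition lebesgue2 (R : realType) :
    {measure
      set (measurableTypeR R * measurableTypeR R)%type -> \bar R} :=
  (@lebesgue_measure R \x @lebesgue_measure R)%E.

(* Functions are everywhere defined on the plane, only their values on [D]
   matter, and they are not quotiented by equality almost everywhere. *)
Definition L1loc (R : realType) (D : set (R * R)) (f : R * R -> R) : Prop :=
  measurable_fun D f /\
  forall K : set (R * R), compact K -> K `<=` D ->
    (lebesgue2 R).-integrable K (EFin \o f).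

Definition basis_vector (R : realType) (i : 'I_2) : R * R :=
  if i == ord0 then (1, 0) else (0, 1).

Definition partial (R : realType) (i : 'I_2) (f : R * R -> R) : R * R -> R :=
  fun z => 'D_(basis_vector R i) f z.

Definition iter_partial (R : realType) (s : seq 'I_2) (f : R * R -> R) :
    R * R -> R :=
  foldr (@partial R) f s.

Definition smooth (R : realType) (f : R * R -> R) : Prop :=
  forall s : seq 'I_2,
    continuous (iter_partial s f) /\
    forall (i : 'I_2) (z : R * R),
      derivable (iter_partial s f) z (basis_vector R i).

Definition support_of (R : realType) (f : R * R -> R) : set (R * R) :=
  closure [set z | f z != 0].

Definition test_function (R : realType) (A : set (R * R)) (f : R * R -> R) :
    Prop :=
  [/\ smooth f, compact (support_of f) & support_of f `<=` A].

Definition singular_values (R : realType) (n : nat) (M : 'M[R]_n) : set R :=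
  [set Num.sqrt a | a in [set a | eigenvalue (M^T *m M) a]].

(* Singular values are nonnegative, so the l^oo norm of their vector is the
   largest of them; multiplicities play no role. *)
Definition schatten_oo (R : realType) (n : nat) (M : 'M[R]_n) : R :=
  sup (singular_values M).

Definition admissible_field (R : realType) (A : set (R * R))
    (F : R * R -> 'M[R]_2) : Prop :=
  (forall i j : 'I_2, test_function A (fun z => F z i j)) /\
  (forall z : R * R, schatten_oo (F z) <= 1).

Definition hessian_pairing (R : realType) (f : R * R -> R) (A : set (R * R))
    (F : R * R -> 'M[R]_2) : \bar R :=
  (\int[lebesgue2 R]_(z in A)
    (\sum_(i < 2) \sum_(j < 2)
       f z * partial i (partial j (fun w => F w i j)) z)%:E)%E.

Definition hessian_schatten1 (R : realType) (f : R * R -> R)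
    (A : set (R * R)) : \bar R :=
  ereal_sup [set hessian_pairing f A F | F in admissible_field A].

Definition continuous_representative (R : realType) (D : set (R * R))
    (f g : R * R -> R) : Prop :=
  {within D, continuous g} /\
  {ae lebesgue2 R, forall z, D z -> f z = g z}.

(* For open [D] the value at a point of [D] does not depend on the chosen
   representative; [f] itself is a dummy default, used only when there is
   none. *)
Definition point_value (R : realType) (D : set (R * R)) (f : R * R -> R)
    (z : R * R) : R :=
  xget f [set g | continuous_representative D f g] z.

(* In [\bar R] the product of +oo and 0 is 0. When the first summand is +oo
   so is the sum (as lambda >= 0), whatever the point values are. *)
Definition hs_functional (R : realType) (D : set (R * R)) (n : nat)
    (x : 'I_n -> R * R) (y : 'I_n -> R) (lambda : \bar R)
    (f : R * R -> R) : \bar R :=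
  (hessian_schatten1 f D +
   lambda * (\sum_(i < n) `|point_value D f (x i) - y i|)%:E)%E.

(* Main.v *)
(* The field R(x) = 2 x x^T / |x|^2 - I has operator norm 1 and vanishing second
   divergence away from 0. Excising the origin at scale s gives a smooth field
   whose second divergence k_s is an approximate identity of mass Kc > 0, and the
   difference of two excised fields is an admissible test field of divergence
   k_s - k_s'. So f * k_s is within |D^2 f| of f * k_s': this gives the
   continuous representative and, since f * k_r is C^2, an affine function close
   to f near each point, with an error controlled by |D^2 f|. Locally affine
   functions are free, so minimising sequences can be made locally bounded, and
   the parallelogram identity for a weighted L^2 norm extracts one converging
   almost everywhere.
   For lambda <= Kc the functional is lower semicontinuous: adding lambda / Kc
   times the ring fields around the points x_i to a test field that is cut off
   there keeps it admissible and reproduces the data term, whose point values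
   cancel. A cone of height a has variation at most Kc |a|, so for lambda > Kc
   a minimiser for Kc, corrected by cones so as to interpolate the data, is a
   minimiser. *)

Require Import Defs.
From HB Require Import structures.
From mathcomp Require Import all_boot all_order all_algebra.
From mathcomp Require Import all_classical all_reals all_analysis.
From mathcomp Require Import measurable_realfun ring lra.
Import Order.TTheory GRing.Theory Num.Theory.
Import numFieldNormedType.Exports.
Local Open Scope classical_set_scope.
Local Open Scope ring_scope.
Set Implicit Arguments.
Unset Strict Implicit.
Unset Printing Implicit Defensive.

(** * Smooth functions on the plane *)

(** Point evaluation is not weakly continuous: cones of height [a] and shrinking radius tend to 0
    almost everywhere, while each keeps variation [Kc] times |a| and its value at the apex. So for
    [lambda] above [Kc] the functional is in general not lower semicontinuous, and the direct method
    is run only up to this threshold. The reflection is the right field because the Hessian of a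
    radial function is diagonal in the radial and tangential directions. For a convex decreasing
    profile the two eigenvalues have opposite signs, and the reflection, with eigenvalues 1 and -1
    in that frame, attains the trace norm. One field thus yields the upper bound for cones and the
    lower bound in the semicontinuity argument, and the two constants agree. Its first divergence is
    2x/|x|^2, whose flux through every circle is 4 pi; this is the value of [Kc], of which only
    positivity is proved. Nothing is assumed of the open set, so all estimates are local, and an
    equivalence relation on its points stands in for connected components. *)

Section slices.
Variable R : realType.
Implicit Types (f g : R * R -> R) (z v : R * R).

(** Directional derivatives are moved to one real variable, where the chain rule and the mean value
    theorem apply. *)
Lemma is_derive_sliceP f z v d :
  is_derive z v f d <-> is_derive (0 : R) 1 (fun h : R => f (h *: v + z)) d.
Proof.
have E : 'D_v f z = 'D_1 (fun h : R => f (h *: v + z)) 0.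
  rewrite /derive; set g1 := (fun h : R => h^-1 *: _); set g2 := (fun h : R => h^-1 *: _).
  suff -> : g1 = g2 by []; apply/funext => h.
  by rewrite /g1 /g2/= addr0 scale0r add0r [_%:A]mulr1.
split=> -[df dE]; split.
- by apply/(derivable1P _ _ _).1.
- by rewrite -E.
- by apply/(derivable1P _ _ _).2.
- by rewrite E.
Qed.

Lemma is_derive_comp1 f (g : R -> R) z v a b :
  is_derive z v f a -> is_derive (f z) 1 g b ->
  is_derive z v (fun w => g (f w)) (a * b).
Proof.
move=> /is_derive_sliceP fa gb; apply/is_derive_sliceP.
have -> : (fun h : R => g (f (h *: v + z))) = g \o (fun h => f (h *: v + z)).
  by [].
rewrite [a * b]mulrC.
have := @is_derive1_comp R g (fun h => f (h *: v + z)) 0 b a.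
rewrite /= scale0r add0r => H.
exact: H gb fa.
Qed.

Lemma is_derive_line f z v (t : R) d :
  is_derive (t *: v + z) v f d -> is_derive t 1 (fun s : R => f (s *: v + z)) d.
Proof.
move=> /is_derive_sliceP H.
have := @is_derive1_comp R (fun h : R => f (h *: v + (t *: v + z))) (fun s => s - t) t d 1.
rewrite /= subrr mulr1; set g := (_ \o _); have -> : g = (fun s : R => f (s *: v + z)).
  by apply/funext => s; rewrite /g/= addrA -scalerDl subrK.
apply=> //; exact: is_derive_shift.
Qed.

Lemma is_derive_fst z i :
  is_derive z (basis_vector R i) (fun w => w.1) (i == ord0)%:R.
Proof.
apply/is_derive_sliceP => /=.
rewrite /basis_vector; case: eqP => _ /=.
  have -> : (fun h : R => h *: 1 + z.1) = (fun h : R => h + z.1).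
    by apply/funext => h; rewrite [_ *: _]mulr1.
  exact: is_derive_shift.
have -> : (fun h : R => h *: (0:R) + z.1) = cst z.1.
  by apply/funext => h; rewrite scaler0 add0r.
exact: is_derive_cst.
Qed.

Lemma is_derive_snd z i :
  is_derive z (basis_vector R i) (fun w => w.2) (i != ord0)%:R.
Proof.
apply/is_derive_sliceP => /=.
rewrite /basis_vector; case: eqP => _ /=.
  have -> : (fun h : R => h *: (0:R) + z.2) = cst z.2.
    by apply/funext => h; rewrite scaler0 add0r.
  exact: is_derive_cst.
have -> : (fun h : R => h *: 1 + z.2) = (fun h : R => h + z.2).
  by apply/funext => h; rewrite [_ *: _]mulr1.
exact: is_derive_shift.
Qed.

End slices.

(** * The flat functions built from exp(-1/x) *)

Section flat.
Variable R : realType.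

(** The factor [x ^- n] is there to make the family closed under differentiation: the derivative of
    each member is a combination of two others, and no formula for higher derivatives is ever
    needed. *)
Definition flat (n : nat) (x : R) : R :=
  if 0 < x then x ^- n * expR (- x^-1) else 0.

Lemma flat_gt0 n x : 0 < x -> 0 < flat n x.
Proof. by move=> x0; rewrite /flat x0 mulr_gt0 ?expR_gt0// invr_gt0 exprn_gt0. Qed.

Lemma flat_le0 n x : x <= 0 -> flat n x = 0.
Proof. by move=> x0; rewrite /flat ltNge x0. Qed.

Lemma flat_ge0 n x : 0 <= flat n x.
Proof.
by case: (ltP 0 x) => x0; [exact/ltW/flat_gt0|rewrite flat_le0].
Qed.

Lemma flatS n x : flat n.+1 x = x^-1 * flat n x.
Proof.
rewrite /flat; case: ifP => _; last by rewrite mulr0.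
by rewrite exprS invfM mulrA.
Qed.

(** One term of the exponential series at [x^-1] already beats [x ^- n.+1]. *)
Lemma flat_bound n x : flat n x <= n.+1`!%:R * `|x|.
Proof.
case: (ltP 0 x) => x0; last by rewrite flat_le0// mulr_ge0.
rewrite gtr0_norm// /flat x0 expRN.
have y0 : 0 <= x^-1 by rewrite invr_ge0 ltW.
have fp : 0 < n.+1`!%:R :> R by rewrite ltr0n fact_gt0.
have : x^-1 ^+ n.+1 / n.+1`!%:R <= expR x^-1.
  by apply: le_trans (expR_ge1Dxn n y0); rewrite lerDr.
rewrite ler_pdivrMr// => H.
rewrite ler_pdivrMr ?expR_gt0//.
have xp : 0 < x ^+ n by rewrite exprn_gt0.
rewrite -(@ler_pM2l _ (x^-1)) ?invr_gt0//.
have -> : x^-1 * x ^- n = x^-1 ^+ n.+1 by rewrite exprS exprVn.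
apply: (le_trans H); rewrite mulrC [X in _ <= X]mulrA [x^-1 * _]mulrCA.
by rewrite mulVf ?gt_eqF// mulr1.
Qed.

Lemma is_derive_flat n (x : R) :
  is_derive x 1 (flat n) (flat n.+2 x - n%:R * flat n.+1 x).
Proof.
case: (ltgtP x 0) => [x0|x0|->].
- rewrite !flat_le0 ?ltW// mulr0 subrr.
  apply: (@near_eq_is_derive _ _ _ (cst 0)).
  near=> y; rewrite /cst flat_le0//; near: y.
  by apply: filterS (lt_nbhsl x0) => y /ltW.
- have nE : \forall y \near x, y ^- n * expR (- y^-1) = flat n y.
    by near=> y; rewrite /flat ifT//; near: y; exact: lt_nbhsr.
  apply: (near_eq_is_derive nE) => {nE}.
  have xn0 : x != 0 by rewrite gt_eqF.
  have dV : is_derive x 1 (fun y : R => y^-1) (- x ^- 2).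
    have := @is_deriveV R id x 1 1.
    rewrite [_ *: _]mulr1; apply => //; exact: is_derive_id.
  have dE : is_derive x 1 (fun y => expR (- y^-1)) (x ^- 2 * expR (- x^-1)).
    have := @is_derive1_comp R expR (fun y => - y^-1) x _ _ (is_derive_expR _) (is_deriveN dV).
    by rewrite opprK mulrC.
  have dX : is_derive x 1 (fun y => y ^- n) (- n%:R * x ^- n.+1).
    have -> : (fun y : R => y ^- n) = (fun y => y^-1) ^+ n.
      by apply/funext => y; rewrite exprfctE exprVn.
    have := @is_deriveX _ _ _ n _ _ _ dV.
    move/is_derive_eq; apply.
    rewrite /GRing.scale/=; case: n => [|n]; first by rewrite !mul0r oppr0 mul0r.
    by rewrite -!exprVn !exprS/=; ring.
  have := is_deriveM dX dE; move/is_derive_eq; apply.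
  rewrite /flat x0 /GRing.scale/= -!exprVn !exprS; ring.
- rewrite !flat_le0// mulr0 subrr.
  have H : (fun h : R => h^-1 *: (flat n (h *: 1 + 0) - flat n 0)) @ 0^' --> (0:R).
    apply/cvgr0Pnorm_le => e e0.
    have fp : 0 < n.+2`!%:R :> R by rewrite ltr0n fact_gt0.
    exists (e / n.+2`!%:R) => /=; first by rewrite divr_gt0.
    move=> h /=; rewrite sub0r normrN => he hn0.
    (* The difference quotient of [flat n] at 0 is [flat n.+1 h], which is of order [h]. *)
    rewrite [h *: 1]mulr1 addr0 [flat n 0]flat_le0// subr0 [_ *: _]mulrC.
    rewrite mulrC -flatS ger0_norm ?flat_ge0//.
    apply: (le_trans (flat_bound _ _)).
    by rewrite mulrC -ler_pdivlMr// ltW.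
  split; first by apply/cvg_ex; exists 0.
  by apply/cvg_lim.
Unshelve. all: by end_near. Qed.

Lemma flat_continuous n : continuous (flat n).
Proof.
move=> x; apply: differentiable_continuous; apply/derivable1_diffP.
by have [] := is_derive_flat n x.
Qed.

End flat.

(* Unification unfolds [partial] and [smooth] down to limits and diverges, so
   both are replaced by sealed copies. *)
Fact pder_subproof (R : realType) :
  {p : 'I_2 -> (R * R -> R) -> R * R -> R | forall i f, p i f = partial i f}.
Proof. by exists (@partial R). Qed.

Definition pder (R : realType) := sval (pder_subproof R).

Lemma pderE (R : realType) i (f : R * R -> R) : pder i f = partial i f.
Proof. exact: (svalP (pder_subproof R)). Qed.

Fact Cinf_subproof (R : realType) :
  {S : (R * R -> R) -> Prop | forall f, S f <-> smooth f}.
Proof. by exists (@smooth R). Qed.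

Definition Cinf (R : realType) := sval (Cinf_subproof R).

Lemma CinfP (R : realType) (f : R * R -> R) : Cinf f <-> smooth f.
Proof. exact: (svalP (Cinf_subproof R)). Qed.

(** * Closure properties of smooth functions *)

Section smooth_closure.
Variable R : realType.
Implicit Types (f g : R * R -> R) (z : R * R).

Definition C1 f := continuous f /\
  forall (i : 'I_2) z, derivable f z (basis_vector R i).

Lemma C1_is_derive f i z : C1 f ->
  is_derive z (basis_vector R i) f (pder i f z).
Proof. by rewrite pderE; case=> _ df; apply: derivableP. Qed.

Lemma iter_partial_rcons s i f :
  iter_partial (rcons s i) f = iter_partial s (pder i f).
Proof. by rewrite pderE /iter_partial -cats1 foldr_cat. Qed.

Lemma smooth_C1 f : Cinf f -> C1 f.
Proof. by move=> /CinfP /(_ [::]). Qed.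

Lemma smooth_continuous f : Cinf f -> continuous f.
Proof. by move=> /smooth_C1[]. Qed.

Lemma smooth_partial i f : Cinf f -> Cinf (pder i f).
Proof. by move=> /CinfP sf; apply/CinfP => s; rewrite -iter_partial_rcons; exact: sf. Qed.

(** Coinduction: smoothness is the largest class of C^1 functions stable under partial derivatives,
    so it suffices to exhibit one such class. *)
Lemma smooth_coind (S : (R * R -> R) -> Prop) :
  (forall f, S f -> C1 f /\ forall i, S (pder i f)) ->
  forall f, S f -> Cinf f.
Proof.
move=> HS f Sf; apply/CinfP => s; elim/last_ind: s f Sf => [|s i IH] f Sf; first exact: (HS f Sf).1.
by rewrite iter_partial_rcons; apply: IH; exact: (HS f Sf).2.
Qed.

Lemma pder_eq f i d : (forall z, is_derive z (basis_vector R i) f (d z)) ->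
  pder i f = d.
Proof. by move=> H; apply/funext => z; rewrite pderE; apply: derive_val. Qed.

Lemma near_zero_partial f i z : (\forall w \near z, f w = 0) -> pder i f z = 0.
Proof.
move=> H; rewrite pderE /partial.
rewrite (@near_eq_derive _ _ _ f (cst 0)) ?derive_cst//.
Qed.

(** A syntactic class whose derivatives are again terms; smooth functions are leaves, so each
    constructor becomes a closure property. *)
Inductive smooth_term : (R * R -> R) -> Prop :=
| st_smooth f : Cinf f -> smooth_term f
| st_cst c : smooth_term (fun _ => c)
| st_fst : smooth_term (fun z => z.1)
| st_snd : smooth_term (fun z => z.2)
| st_add f g : smooth_term f -> smooth_term g -> smooth_term (fun z => f z + g z)
| st_mul f g : smooth_term f -> smooth_term g -> smooth_term (fun z => f z * g z)
| st_inv f : (forall z, f z != 0) -> smooth_term f -> smooth_term (fun z => (f z)^-1)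
| st_flat n f : smooth_term f -> smooth_term (fun z => flat n (f z)).

Lemma C1_derives f (d : 'I_2 -> R * R -> R) : continuous f ->
  (forall i z, is_derive z (basis_vector R i) f (d i z)) ->
  C1 f /\ forall i, pder i f = d i.
Proof.
move=> cf df; split; first by split=> // i z; have [] := df i z.
by move=> i; apply: pder_eq.
Qed.

Lemma is_derive_add f g z v a b : is_derive z v f a -> is_derive z v g b ->
  is_derive z v (fun w => f w + g w) (a + b).
Proof. exact: is_deriveD. Qed.

Lemma is_derive_mul f g z v a b : is_derive z v f a -> is_derive z v g b ->
  is_derive z v (fun w => f w * g w) (a * g z + f z * b).
Proof.
move=> fa gb; have := is_deriveM fa gb; move/is_derive_eq; apply.
by rewrite /GRing.scale/= addrC; congr (_ + _); rewrite mulrC.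
Qed.

Lemma is_derive_inv f z v a : f z != 0 -> is_derive z v f a ->
  is_derive z v (fun w => (f w)^-1) (- (f z)^-1 * (f z)^-1 * a).
Proof.
move=> fz [df da]; split; first exact: derivableV.
by rewrite (deriveV fz df) da /GRing.scale/= expr2 invfM !mulNr.
Qed.

Lemma smooth_termP f : smooth_term f -> C1 f /\ forall i, smooth_term (pder i f).
Proof.
elim=> {f}.
- move=> f sf; split; first exact: smooth_C1.
  by move=> i; apply: st_smooth; exact: smooth_partial.
- move=> c; have [] := @C1_derives (fun=> c) (fun _ _ => 0).
  + by move=> z; exact: cvg_cst.
  by move=> ? E; split=> // i; rewrite E; exact: st_cst.
- have [] := @C1_derives (fun z => z.1) (fun i _ => (i == ord0)%:R).
  + by move=> z; exact: cvg_fst.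
  + by move=> i z; exact: is_derive_fst.
  by move=> ? E; split=> // i; rewrite E; exact: st_cst.
- have [] := @C1_derives (fun z => z.2) (fun i _ => (i != ord0)%:R).
  + by move=> z; exact: cvg_snd.
  + by move=> i z; exact: is_derive_snd.
  by move=> ? E; split=> // i; rewrite E; exact: st_cst.
- move=> f g _ [cf If] _ [cg Ig].
  have [] := @C1_derives (fun z => f z + g z) (fun i z => pder i f z + pder i g z).
  + by move=> z; apply: cvgD; [exact: cf.1|exact: cg.1].
  + by move=> i z; apply: is_derive_add; exact: C1_is_derive.
  by move=> ? E; split=> // i; rewrite E; exact: st_add.
- move=> f g Sf [cf If] Sg [cg Ig].
  have [] := @C1_derives (fun z => f z * g z)
     (fun i z => pder i f z * g z + f z * pder i g z).
  + by move=> z; apply: cvgM; [exact: cf.1|exact: cg.1].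
  + by move=> i z; apply: is_derive_mul; exact: C1_is_derive.
  move=> ? E; split=> // i; rewrite E.
  by apply: (@st_add (fun z => _ z * _ z) (fun z => _ z * _ z)); exact: st_mul.
- move=> f f0 Sf [cf If].
  have [] := @C1_derives (fun z => (f z)^-1)
     (fun i z => - (f z)^-1 * (f z)^-1 * pder i f z).
  + by move=> z; apply: cvgV => //; exact: cf.1.
  + by move=> i z; apply: is_derive_inv => //; exact: C1_is_derive.
  move=> ? E; split=> // i; rewrite E.
  have -> : (fun z => - (f z)^-1 * (f z)^-1 * pder i f z) =
     (fun z => (-1) * (f z)^-1 * (f z)^-1 * pder i f z).
    by apply/funext => z; rewrite mulN1r.
  apply: (@st_mul (fun z => _ * _ * _)); last exact: If.
  apply: (@st_mul (fun z => _ * _)); last exact: st_inv.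
  by apply: (@st_mul (fun z => -1)); [exact: st_cst|exact: st_inv].
- move=> n f Sf [cf If].
  have [] := @C1_derives (fun z => flat n (f z))
     (fun i z => pder i f z * (flat n.+2 (f z) - n%:R * flat n.+1 (f z))).
  + by move=> z; apply: (@continuous_comp _ _ _ f (flat n)); [exact: cf.1|exact: flat_continuous].
  + by move=> i z; apply: is_derive_comp1; [exact: C1_is_derive|exact: is_derive_flat].
  move=> ? E; split=> // i; rewrite E.
  apply: st_mul; first exact: If.
  have -> : (fun z => flat n.+2 (f z) - n%:R * flat n.+1 (f z)) =
     (fun z => flat n.+2 (f z) + (- n%:R) * flat n.+1 (f z)).
    by apply/funext => z; rewrite mulNr.
  apply: st_add; first exact: st_flat.
  by apply: (@st_mul (fun=> _)); [exact: st_cst|exact: st_flat].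
Qed.

Lemma smooth_term_smooth f : smooth_term f -> Cinf f.
Proof. exact: smooth_coind smooth_termP _. Qed.

Lemma smooth_cst c : Cinf (fun _ : R * R => c).
Proof. exact/smooth_term_smooth/st_cst. Qed.
Lemma smooth_fst : Cinf (fun z : R * R => z.1).
Proof. exact/smooth_term_smooth/st_fst. Qed.
Lemma smooth_snd : Cinf (fun z : R * R => z.2).
Proof. exact/smooth_term_smooth/st_snd. Qed.
Lemma smooth_add f g : Cinf f -> Cinf g -> Cinf (fun z => f z + g z).
Proof. by move=> sf sg; apply/smooth_term_smooth/st_add; exact: st_smooth. Qed.
Lemma smooth_mul f g : Cinf f -> Cinf g -> Cinf (fun z => f z * g z).
Proof. by move=> sf sg; apply/smooth_term_smooth/st_mul; exact: st_smooth. Qed.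
Lemma smooth_inv f : (forall z, f z != 0) -> Cinf f -> Cinf (fun z => (f z)^-1).
Proof. by move=> f0 sf; apply/smooth_term_smooth/st_inv => //; exact: st_smooth. Qed.
Lemma smooth_flat n f : Cinf f -> Cinf (fun z => flat n (f z)).
Proof. by move=> sf; apply/smooth_term_smooth/st_flat => //; exact: st_smooth. Qed.
Lemma smooth_scale c f : Cinf f -> Cinf (fun z => c * f z).
Proof. by move=> sf; exact: (smooth_mul (smooth_cst c) sf). Qed.
Lemma smooth_opp f : Cinf f -> Cinf (fun z => - f z).
Proof.
move=> /(smooth_scale (-1)); congr Cinf.
by apply/funext => z; rewrite mulN1r.
Qed.
Lemma smooth_sub f g : Cinf f -> Cinf g -> Cinf (fun z => f z - g z).
Proof. by move=> sf /smooth_opp; exact: smooth_add. Qed.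

Lemma partial_add i f g : Cinf f -> Cinf g ->
  pder i (fun z => f z + g z) = fun z => pder i f z + pder i g z.
Proof.
by move=> /smooth_C1 sf /smooth_C1 sg; apply: pder_eq => z;
   apply: is_derive_add; exact: C1_is_derive.
Qed.

Lemma partial_mul i f g : Cinf f -> Cinf g ->
  pder i (fun z => f z * g z) = fun z => pder i f z * g z + f z * pder i g z.
Proof.
by move=> /smooth_C1 sf /smooth_C1 sg; apply: pder_eq => z;
   apply: is_derive_mul; exact: C1_is_derive.
Qed.

Lemma partial_cst i c : pder i (fun _ : R * R => c) = fun=> 0.
Proof. by apply: pder_eq => z; apply: is_derive_cst. Qed.

Lemma partial_scale i c f : Cinf f ->
  pder i (fun z => c * f z) = fun z => c * pder i f z.
Proof.
move=> sf; rewrite (partial_mul i (smooth_cst c) sf).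
by apply/funext => z; rewrite partial_cst mul0r add0r.
Qed.

Lemma partial_fst i : pder i (fun z : R * R => z.1) = fun=> (i == ord0)%:R.
Proof. by apply: pder_eq => z; exact: is_derive_fst. Qed.

Lemma partial_snd i : pder i (fun z : R * R => z.2) = fun=> (i != ord0)%:R.
Proof. by apply: pder_eq => z; exact: is_derive_snd. Qed.

Lemma is_derive_affine (a : R) (b : R * R) f z v d :
  is_derive (a *: z + b) v f d -> is_derive z v (fun w => f (a *: w + b)) (a * d).
Proof.
move=> /is_derive_sliceP H; apply/is_derive_sliceP.
have := @is_derive1_comp R (fun h => f (h *: v + (a *: z + b))) (fun h => a * h) 0 d a.
rewrite mulr0 => /(_ H).
have E : is_derive (0:R) 1 (fun h : R => a * h) a.
  have := @is_deriveZ _ _ _ id a (0 : R) (1 : R) 1 (is_derive_id _ _).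
  by rewrite [_ *: _]mulr1.
move=> /(_ E); rewrite mulrC; congr is_derive.
apply/funext => h /=; congr f.
by rewrite scalerDr scalerA addrA.
Qed.

Lemma smooth_affine (a : R) (b : R * R) f : Cinf f ->
  Cinf (fun z => f (a *: z + b)).
Proof.
move=> sf.
(* The constant [c] absorbs the powers of [a] that successive derivatives produce. *)
pose S g := exists c h, Cinf h /\ g = fun z => c * h (a *: z + b).
apply: (@smooth_coind S); last first.
  by exists 1, f; split=> //; apply/funext => z; rewrite mul1r.
move=> _ [c [h [sh ->]]].
have [] := @C1_derives (fun z => c * h (a *: z + b))
  (fun i z => (c * a) * pder i h (a *: z + b)).
- move=> z; apply: cvgM; first exact: cvg_cst.
  apply: (@continuous_comp _ _ _ (fun z => a *: z + b) h); last exact: smooth_continuous.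
  by apply: cvgD; [apply: cvgZr; exact: cvg_id|exact: cvg_cst].
- move=> i z.
  have := @is_deriveZ _ _ _ _ c _ _ _ (is_derive_affine (C1_is_derive i (a *: z + b) (smooth_C1 sh))).
  by rewrite [_ *: _]mulrA.
move=> ? E; split=> // i; rewrite E.
by exists (c * a), (pder i h); split; [exact: smooth_partial|].
Qed.

Lemma partial_affine i (a : R) (b : R * R) f : Cinf f ->
  pder i (fun z => f (a *: z + b)) = fun z => a * pder i f (a *: z + b).
Proof.
by move=> /smooth_C1 sf; apply: pder_eq => z; apply: is_derive_affine; exact: C1_is_derive.
Qed.

End smooth_closure.

(** * Test fields *)

Section two.
Variable R : realType.

Definition o1 : 'I_2 := lift ord0 ord0.

Lemma I2P (P : 'I_2 -> Prop) : P ord0 -> P o1 -> forall i, P i.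
Proof.
move=> P0 P1 [[|[|//]] Hi].
- by rewrite (_ : Ordinal Hi = ord0)//; apply/val_inj.
- by rewrite (_ : Ordinal Hi = o1)//; apply/val_inj.
Qed.

Lemma sum2 (V : nmodType) (F : 'I_2 -> V) : \sum_(i < 2) F i = F ord0 + F o1.
Proof. by rewrite big_ord_recl big_ord1. Qed.

(** Operator norm at most [t], polarised as 2 u.Mv <= t (|u|^2 + |v|^2). It is linear in [M] and [t]
    and mentions no eigenvalue or square root, so sums and multiples are handled by linear
    arithmetic. *)
Definition opb (t : R) (M : 'M[R]_2) := forall u1 u2 v1 v2 : R,
  2 * (u1 * (M ord0 ord0 * v1 + M ord0 o1 * v2) +
       u2 * (M o1 ord0 * v1 + M o1 o1 * v2)) <=
  t * (u1 ^+ 2 + u2 ^+ 2 + v1 ^+ 2 + v2 ^+ 2).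

Lemma opbD s t M N : opb s M -> opb t N -> opb (s + t) (M + N).
Proof.
move=> HM HN u1 u2 v1 v2; rewrite !mxE.
have := HM u1 u2 v1 v2; have := HN u1 u2 v1 v2; lra.
Qed.

Lemma opbZ c t M : 0 <= c -> opb t M -> opb (c * t) (c *: M).
Proof.
move=> c0 HM u1 u2 v1 v2; rewrite !mxE.
have := ler_wpM2l c0 (HM u1 u2 v1 v2); lra.
Qed.

Lemma opbN t M : opb t M -> opb t (- M).
Proof.
move=> HM u1 u2 v1 v2; rewrite !mxE.
have := HM (- u1) (- u2) v1 v2; rewrite !sqrrN; lra.
Qed.

Lemma opbB s t M N : opb s M -> opb t N -> opb (s + t) (M - N).
Proof. by move=> HM HN; apply: opbD => //; exact: opbN. Qed.

Lemma opb_norm c t M : opb t M -> opb (`|c| * t) (c *: M).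
Proof.
move=> HM; case: (leP 0 c) => c0.
  by rewrite ger0_norm//; exact: opbZ.
rewrite ltr0_norm//; have := @opbZ (- c) t _ _ (opbN HM).
by rewrite scalerN scaleNr opprK; apply; rewrite oppr_ge0 ltW.
Qed.

Lemma opb0 : opb 0 0.
Proof. by move=> u1 u2 v1 v2; rewrite !mxE; lra. Qed.

Lemma opb_le s t M : s <= t -> opb s M -> opb t M.
Proof.
move=> st HM u1 u2 v1 v2; apply: (le_trans (HM _ _ _ _)).
by apply: ler_wpM2r => //; rewrite !addr_ge0 ?sqr_ge0.
Qed.

Lemma opb_entry t M i j : opb t M -> `|M i j| <= t.
Proof.
move=> HM; rewrite ler_norml; apply/andP; split.
- elim/I2P: i; elim/I2P: j.
  + by have := HM (-1) 0 1 0; lra.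
  + by have := HM (-1) 0 0 1; lra.
  + by have := HM 0 (-1) 1 0; lra.
  + by have := HM 0 (-1) 0 1; lra.
- elim/I2P: i; elim/I2P: j.
  + by have := HM 1 0 1 0; lra.
  + by have := HM 1 0 0 1; lra.
  + by have := HM 0 1 1 0; lra.
  + by have := HM 0 1 0 1; lra.
Qed.

Lemma prod_bound (m c u v : R) : `|c| <= m -> 2 * (u * (c * v)) <= m * (u ^+ 2 + v ^+ 2).
Proof.
move=> cm; have m0 : 0 <= m := le_trans (normr_ge0 _) cm.
move: cm; rewrite ler_norml => /andP[c1 c2].
have h1 : 0 <= (m - c) * (u + v) ^+ 2 by rewrite mulr_ge0 ?sqr_ge0 ?subr_ge0.
have h2 : 0 <= (m + c) * (u - v) ^+ 2 by rewrite mulr_ge0 ?sqr_ge0//; lra.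
have h3 : 0 <= (m - c) * (u - v) ^+ 2 by rewrite mulr_ge0 ?sqr_ge0 ?subr_ge0.
nra.
Qed.

Lemma opb_entries m (M : 'M[R]_2) : (forall i j, `|M i j| <= m) -> opb (2 * m) M.
Proof.
move=> HM u1 u2 v1 v2.
have := prod_bound u1 v1 (HM ord0 ord0); have := prod_bound u1 v2 (HM ord0 o1).
have := prod_bound u2 v1 (HM o1 ord0); have := prod_bound u2 v2 (HM o1 o1).
lra.
Qed.

Lemma gramE (M : 'M[R]_2) i j :
  (M^T *m M) i j = M ord0 i * M ord0 j + M o1 i * M o1 j.
Proof. by rewrite mxE sum2 !mxE. Qed.

Lemma row2P (v w : 'rV[R]_2) : v 0 ord0 = w 0 ord0 -> v 0 o1 = w 0 o1 -> v = w.
Proof. by move=> e0 e1; apply/rowP; elim/I2P. Qed.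

Lemma schatten_le1 (M : 'M[R]_2) : schatten_oo M <= 1 <-> opb 1 M.
Proof.
pose a := M ord0 ord0; pose b := M ord0 o1; pose c := M o1 ord0; pose d := M o1 o1.
pose A := a ^+ 2 + c ^+ 2; pose B := a * b + c * d; pose D := b ^+ 2 + d ^+ 2.
have eigP l : eigenvalue (M^T *m M) l -> exists v1 v2,
    [/\ 0 < v1 ^+ 2 + v2 ^+ 2 &
    l * (v1 ^+ 2 + v2 ^+ 2) = (a * v1 + b * v2) ^+ 2 + (c * v1 + d * v2) ^+ 2].
  move=> /eigenvalueP[v vE v0]; exists (v 0 ord0), (v 0 o1); split.
    rewrite lt_neqAle addr_ge0 ?sqr_ge0// andbT eq_sym.
    apply: contra v0; rewrite paddr_eq0 ?sqr_ge0// !sqrf_eq0 => /andP[/eqP e0 /eqP e1].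
    by apply/eqP/row2P; rewrite mxE.
  have e0 : (v *m (M^T *m M)) 0 ord0 = l * v 0 ord0 by rewrite vE mxE.
  have e1 : (v *m (M^T *m M)) 0 o1 = l * v 0 o1 by rewrite vE mxE.
  move: e0 e1; rewrite !mxE !sum2 !gramE -/a -/b -/c -/d => e0 e1.
  rewrite mulrDr !expr2 !mulrA -e0 -e1; ring.
have sb l : singular_values M l -> exists2 m, 0 <= l <= Num.sqrt m & eigenvalue (M^T *m M) m.
  by move=> [m me <-]; exists m => //; rewrite sqrtr_ge0 lexx.
split; last first.
  (* For an empty set [sup] takes its default value 0, so no eigenvalue has to be produced in this
     direction. *)
  move=> HM; have [[l0 Hl0]|N0] := pselect (exists l, singular_values M l); last first.
    rewrite /schatten_oo sup_out// => -[[l Hl] _]; apply: N0; by exists l.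
  apply: ge_sup; first by exists l0.
  move=> _ [m /eigP[v1 [v2 [v0 E]]] <-].
  suff : m <= 1 by move=> m1; rewrite -sqrtr1; exact: ler_wsqrtr.
  have := HM (a * v1 + b * v2) (c * v1 + d * v2) v1 v2.
  rewrite -/a -/b -/c -/d => H.
  by rewrite -(ler_pM2r v0) E; lra.
move=> HS.
(* [l] below is the larger root of the characteristic polynomial of the Gram matrix, and [disc] its
   discriminant. *)
pose disc := (A - D) ^+ 2 + 4 * B ^+ 2.
have disc0 : 0 <= disc by rewrite /disc; have := sqr_ge0 (A - D); have := sqr_ge0 B; lra.
pose s := Num.sqrt disc; have s0 : 0 <= s := sqrtr_ge0 _.
have s2 : s ^+ 2 = disc by rewrite sqr_sqrtr.
pose l := (A + D + s) / 2.
have sAD : `|A - D| <= s.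
  by rewrite -(@ler_pXn2r _ 2)// ?nnegrE// real_normK ?num_real// s2 lerDl; have := sqr_ge0 B; lra.
have lA : A <= l by move: sAD; rewrite ler_norml /l => /andP[]; lra.
have lD : D <= l by move: sAD; rewrite ler_norml /l => /andP[]; lra.
have lE : (l - A) * (l - D) = B ^+ 2.
  have -> : (l - A) * (l - D) = (s ^+ 2 - (A - D) ^+ 2) / 4 by rewrite /l; field.
  by rewrite s2 /disc; field.
have eigl : eigenvalue (M^T *m M) l.
  apply/eigenvalueP.
  (* The vector (B, l - A) is an eigenvector unless it vanishes, in which case the first basis
     vector is one. *)
  have [[B0 lA0]|nz] := pselect (B = 0 /\ l = A).
    exists (\row_j (j == ord0)%:R); last first.
      by apply/eqP => /rowP /(_ ord0); rewrite !mxE eqxx; apply/eqP/oner_neq0.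
    apply: row2P; rewrite !mxE sum2 !gramE !mxE/= -/a -/b -/c -/d.
      by rewrite lA0 /A; ring.
    by have := B0; rewrite /B; lra.
  exists (\row_j (if j == ord0 then B else l - A)); last first.
    apply/eqP => /rowP E; apply: nz; have := E ord0; have := E o1.
    by rewrite !mxE/= => e1 e0; split=> //; lra.
  apply: row2P; rewrite !mxE sum2 !gramE !mxE/= -/a -/b -/c -/d.
    by rewrite /A /B; ring.
  by have : (l - A) * (l - D) = B ^+ 2 := lE; rewrite /A /B /D; lra.
(* [sup] bounds its set only if the set is bounded; eigenvalues are at most the trace [A + D] by
   Cauchy-Schwarz. *)
have hsup : has_sup (singular_values M).
  split; first by exists (Num.sqrt l), l.
  exists (Num.sqrt (A + D)) => _ [m /eigP[v1 [v2 [v0 E]]] <-]; apply: ler_wsqrtr.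
  rewrite -(ler_pM2r v0) E /A /D.
  have := sqr_ge0 (a * v2 - b * v1); have := sqr_ge0 (c * v2 - d * v1); lra.
have l1 : l <= 1.
  have : Num.sqrt l <= 1.
    apply: le_trans HS; apply: sup_upper_bound => //; by exists l.
  by rewrite -[X in _ <= X]sqrtr1 ler_psqrt// ?nnegrE// (le_trans _ lA)// addr_ge0 ?sqr_ge0.
move=> u1 u2 v1 v2; rewrite -/a -/b -/c -/d mul1r.
(* [l] minus the Gram matrix is positive semidefinite, having determinant 0 and nonnegative
   diagonal; hence |Mv|^2 <= |v|^2, and completing the square in [u] finishes. *)
have Q : 0 <= (l - A) * v1 ^+ 2 - 2 * B * v1 * v2 + (l - D) * v2 ^+ 2.
  have [p0|p0] := ltP 0 (l - A).
    rewrite -(pmulr_rge0 _ p0).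
    have -> : (l - A) * ((l - A) * v1 ^+ 2 - 2 * B * v1 * v2 + (l - D) * v2 ^+ 2) =
      ((l - A) * v1 - B * v2) ^+ 2 by rewrite mulrDr [X in _ + X]mulrA lE; ring.
    exact: sqr_ge0.
  have p00 : l - A = 0 by apply/eqP; rewrite eq_le p0 subr_ge0.
  have B0 : B = 0 by move: lE; rewrite p00 mul0r => /esym/eqP; rewrite sqrf_eq0 => /eqP.
  by rewrite p00 B0 mul0r mulr0 !mul0r subr0 add0r; apply: mulr_ge0; rewrite ?sqr_ge0 ?subr_ge0.
have h1 : 0 <= (1 - l) * (v1 ^+ 2 + v2 ^+ 2).
  by apply: mulr_ge0; rewrite ?subr_ge0// addr_ge0 ?sqr_ge0.
have := sqr_ge0 (u1 - (a * v1 + b * v2)); have := sqr_ge0 (u2 - (c * v1 + d * v2)).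
move: Q h1; rewrite /A /B /D; lra.
Qed.

End two.

(** * Supports, second divergence, symmetry of mixed partials *)

Section support.
Variable R : realType.
Implicit Types (A B : set (R * R)) (f g : R * R -> R).

(** Any compact set off which [f] vanishes serves as witness, which makes sums and products
    immediate; [test_functionP] compares this with the closure of the nonzero set. *)
Definition supported A f :=
  exists K, [/\ compact K, K `<=` A & forall z, ~ K z -> f z = 0].

Lemma compact_closed2 (K : set (R * R)) : compact K -> closed K.
Proof. by apply: compact_closed; exact: norm_hausdorff. Qed.

Lemma supportedS A B f : A `<=` B -> supported A f -> supported B f.
Proof. by move=> AB [K [cK KA Kf]]; exists K; split=> //; exact: subset_trans AB. Qed.

Lemma supported_out A f z : supported A f -> ~ A z -> f z = 0.
Proof. by move=> [K [_ KA Kf]] nA; apply: Kf => /KA. Qed.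

Lemma supported_add A f g : supported A f -> supported A g ->
  supported A (fun z => f z + g z).
Proof.
move=> [K [cK KA Kf]] [L [cL LA Lg]]; exists (K `|` L); split.
- exact: compactU.
- by move=> z [/KA|/LA].
- by move=> z /not_orP[nK nL]; rewrite Kf// Lg// addr0.
Qed.

Lemma supported_mull A f g : supported A f -> supported A (fun z => f z * g z).
Proof. by move=> [K [cK KA Kf]]; exists K; split=> // z nK; rewrite Kf// mul0r. Qed.

Lemma supported_mulr A f g : supported A g -> supported A (fun z => f z * g z).
Proof. by move=> [K [cK KA Kf]]; exists K; split=> // z nK; rewrite Kf// mulr0. Qed.

Lemma supported_cst0 A : supported A (fun=> 0).
Proof. by exists set0; split=> //; exact: compact0. Qed.

Lemma closed_near (K : set (R * R)) z : closed K -> ~ K z -> \forall w \near z, ~ K w.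
Proof. by move=> /closed_openC oK nK; exact: open_nbhs_nbhs. Qed.

Lemma partial_off K f i z : closed K -> (forall w, ~ K w -> f w = 0) -> ~ K z ->
  pder i f z = 0.
Proof.
move=> cK Kf nK; apply: near_zero_partial.
by apply: filterS (closed_near cK nK) => w /Kf.
Qed.

Lemma supported_partial A f i : supported A f -> supported A (pder i f).
Proof.
move=> [K [cK KA Kf]]; exists K; split=> // z; apply: partial_off => //.
exact: compact_closed2.
Qed.

Lemma test_functionP A f : test_function A f <-> Cinf f /\ supported A f.
Proof.
split=> [[/CinfP sf cf fA]|[sf [K [cK KA Kf]]]].
  split=> //; exists (support_of f); split=> // z nz.
  by apply/eqP; apply: contrapT => /negP fz; apply: nz; exact: subset_closure.
have sK : support_of f `<=` K.
  rewrite /support_of; apply: subset_trans (_ : closure K `<=` K); last first.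
    by have /closure_id <- := compact_closed2 cK.
  apply: closure_subset => z /=; apply: contraPP => nK.
  by rewrite Kf// eqxx.
split; [exact/CinfP| |exact: subset_trans KA].
by apply: subclosed_compact cK _ => //; exact: closed_closure.
Qed.

Definition field A (F : R * R -> 'M[R]_2) :=
  forall i j, Cinf (fun z => F z i j) /\ supported A (fun z => F z i j).

Definition div2 (F : R * R -> 'M[R]_2) (z : R * R) : R :=
  \sum_(i < 2) \sum_(j < 2) pder i (pder j (fun w => F w i j)) z.

Lemma admissibleP A F :
  admissible_field A F <-> field A F /\ forall z, opb 1 (F z).
Proof.
split=> [[t n]|[t n]]; split.
- by move=> i j; apply/test_functionP.
- by move=> z; apply/schatten_le1.
- by move=> i j; apply/test_functionP.
- by move=> z; apply/schatten_le1.
Qed.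

Lemma fieldS A B F : A `<=` B -> field A F -> field B F.
Proof. by move=> AB HF i j; split; [exact: (HF i j).1|exact: supportedS (HF i j).2]. Qed.

Lemma fieldD A F G : field A F -> field A G -> field A (fun z => F z + G z).
Proof.
move=> HF HG i j; have [sF cF] := HF i j; have [sG cG] := HG i j.
have -> : (fun z => (F z + G z) i j) = (fun z => F z i j + G z i j).
  by apply/funext => z; rewrite mxE.
by split; [exact: smooth_add|exact: supported_add].
Qed.

Lemma fieldM A (e : R * R -> R) F : Cinf e -> field A F -> field A (fun z => e z *: F z).
Proof.
move=> se HF i j; have [sF cF] := HF i j.
have -> : (fun z => (e z *: F z) i j) = (fun z => e z * F z i j).
  by apply/funext => z; rewrite mxE.
by split; [exact: smooth_mul|exact: supported_mulr].
Qed.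

Lemma fieldZ A (c : R) F : field A F -> field A (fun z => c *: F z).
Proof. by apply: fieldM; exact: smooth_cst. Qed.

Lemma fieldN A F : field A F -> field A (fun z => - F z).
Proof.
by move=> /(fieldZ (-1)); congr field; apply/funext => z; rewrite scaleN1r.
Qed.

Lemma fieldB A F G : field A F -> field A G -> field A (fun z => F z - G z).
Proof. by move=> HF /fieldN; exact: fieldD. Qed.

Lemma field0 A : field A (fun=> 0).
Proof.
move=> i j.
have -> : (fun z : R * R => (0 : 'M[R]_2) i j) = fun=> 0.
  by apply/funext => z; rewrite mxE.
by split; [exact: smooth_cst|exact: supported_cst0].
Qed.

Definition smoothF (F : R * R -> 'M[R]_2) := forall i j, Cinf (fun z => F z i j).

Lemma div2D F G : smoothF F -> smoothF G ->
  div2 (fun z => F z + G z) = fun z => div2 F z + div2 G z.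
Proof.
move=> HF HG; apply/funext => z; rewrite /div2 -big_split/=.
apply: eq_bigr => i _; rewrite -big_split/=; apply: eq_bigr => j _.
have -> : (fun z => (F z + G z) i j) = (fun z => F z i j + G z i j).
  by apply/funext => w; rewrite mxE.
rewrite (partial_add j (HF i j) (HG i j)).
by rewrite (partial_add i (smooth_partial j (HF i j)) (smooth_partial j (HG i j))).
Qed.

Lemma div2Z c F : smoothF F -> div2 (fun z => c *: F z) = fun z => c * div2 F z.
Proof.
move=> HF; apply/funext => z; rewrite /div2 mulr_sumr.
apply: eq_bigr => i _; rewrite mulr_sumr; apply: eq_bigr => j _.
have -> : (fun z => (c *: F z) i j) = (fun z => c * F z i j).
  by apply/funext => w; rewrite mxE.
rewrite (partial_scale j c (HF i j)).
by rewrite (partial_scale i c (smooth_partial j (HF i j))).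
Qed.

Lemma field_smoothF A F : field A F -> smoothF F.
Proof. by move=> HF i j; exact: (HF i j).1. Qed.

Lemma smooth_sum2 (F : 'I_2 -> R * R -> R) : (forall i, Cinf (F i)) ->
  Cinf (fun z => \sum_(i < 2) F i z).
Proof.
move=> HF; have -> : (fun z => \sum_(i < 2) F i z) = fun z => F ord0 z + F o1 z.
  by apply/funext => z; rewrite sum2.
exact: smooth_add.
Qed.

Lemma smooth_div2 F : smoothF F -> Cinf (div2 F).
Proof.
move=> HF; apply: (@smooth_sum2 (fun i z => _)) => i.
by apply: (@smooth_sum2 (fun j z => _)) => j; exact/smooth_partial/smooth_partial.
Qed.

Lemma continuous_div2 A F : field A F -> continuous (div2 F).
Proof. by move=> HF; exact/smooth_continuous/smooth_div2/field_smoothF/HF. Qed.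

Lemma supported_div2 A F : field A F -> supported A (div2 F).
Proof.
move=> HF; have -> : div2 F = fun z =>
   (pder ord0 (pder ord0 (fun w => F w ord0 ord0)) z +
    pder ord0 (pder o1 (fun w => F w ord0 o1)) z) +
   (pder o1 (pder ord0 (fun w => F w o1 ord0)) z +
    pder o1 (pder o1 (fun w => F w o1 o1)) z).
  by apply/funext => z; rewrite /div2 !sum2.
by do 2?[apply: supported_add]; apply: supported_partial; apply: supported_partial;
   exact: (HF _ _).2.
Qed.

Lemma MVT_on_line f v z (d : R * R -> R) (h : R) :
  (forall t : R, `|t| <= `|h| -> is_derive (t *: v + z) v f (d (t *: v + z))) ->
  exists2 c : R, `|c| <= `|h| & f (h *: v + z) - f z = h * d (c *: v + z).
Proof.
move=> df.
have dg (t : R) : `|t| <= `|h| ->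
    is_derive t 1 (fun s : R => f (s *: v + z)) (d (t *: v + z)).
  by move=> /df; exact: is_derive_line.
have cg (a b : R) : {in `[a, b], forall t, `|t| <= `|h|} ->
    {within `[a, b], continuous (fun s : R => f (s *: v + z))}.
  by move=> ab; apply: derivable_within_continuous => t /ab /dg [].
have [h0|h0] := leP 0 h.
  have ab : {in `[0, h], forall t, `|t| <= `|h|}.
    by move=> t; rewrite in_itv/= => /andP[c0 ch]; rewrite !ger0_norm.
  have [c ch] := @MVT_segment R (fun s : R => f (s *: v + z)) (fun t => d (t *: v + z)) 0 h h0
    (fun t th => dg t (ab t (subset_itv_oo_cc th))) (cg _ _ ab).
  by rewrite scale0r add0r subr0 => E; exists c; [exact: ab|rewrite E mulrC].
have ab : {in `[h, 0], forall t, `|t| <= `|h|}.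
  by move=> t; rewrite in_itv/= => /andP[c0 ch]; rewrite !ler0_norm// ?lerN2// ltW.
have [c ch] := @MVT_segment R (fun s : R => f (s *: v + z)) (fun t => d (t *: v + z)) h 0 (ltW h0)
    (fun t th => dg t (ab t (subset_itv_oo_cc th))) (cg _ _ ab).
by rewrite scale0r add0r sub0r => E; exists c; [exact: ab|rewrite -opprB E; ring].
Qed.

Lemma MVT_line f v z (d : R * R -> R) (h : R) :
  (forall w, is_derive w v f (d w)) ->
  exists2 c : R, `|c| <= `|h| & f (h *: v + z) - f z = h * d (c *: v + z).
Proof. by move=> df; exact: (@MVT_on_line f v z d h (fun t _ => df _)). Qed.

Lemma basis_norm i : `|basis_vector R i| <= 1.
Proof.
rewrite /basis_vector; case: eqP => _; rewrite prod_normE/= normr0 normr1;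
  by rewrite ge_max ?lexx ?ler01.
Qed.

(** Schwarz: the second difference over a square of side [h] equals, in either order, [h ^+ 2] times
    a mixed partial at a point within 2h; continuity of both mixed partials then compares them at
    [z]. *)
Lemma partialC f i j : Cinf f -> pder i (pder j f) = pder j (pder i f).
Proof.
move=> sf; apply/funext => z.
suff H (a b : 'I_2) (h : R) : exists2 w, `|w - z| <= 2 * `|h| &
    f (h *: basis_vector R a + (h *: basis_vector R b + z)) - f (h *: basis_vector R a + z) -
    (f (h *: basis_vector R b + z) - f z) = h ^+ 2 * pder a (pder b f) w.
  apply/eqP; rewrite -subr_eq0 -normr_le0; apply/ler_addgt0Pr => e e0; rewrite add0r.
  have cij : continuous (pder i (pder j f)).
    by apply: smooth_continuous; do 2!apply: smooth_partial.
  have cji : continuous (pder j (pder i f)).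
    by apply: smooth_continuous; do 2!apply: smooth_partial.
  have e2 : 0 < e / 2 by rewrite divr_gt0.
  have /cvgrPdist_le/(_ _ e2)/nbhs_normP[r1 /= r10 Hr1] := cij z.
  have /cvgrPdist_le/(_ _ e2)/nbhs_normP[r2 /= r20 Hr2] := cji z.
  pose h := Num.min r1 r2 / 3.
  have h0 : 0 < h by rewrite divr_gt0// lt_min r10.
  have hr1 : 2 * h < r1.
    have : Num.min r1 r2 <= r1 by rewrite ge_min lexx.
    by rewrite /h; lra.
  have hr2 : 2 * h < r2.
    have : Num.min r1 r2 <= r2 by rewrite ge_min lexx orbT.
    by rewrite /h; lra.
  have [w1 w1z E1] := H i j h; have [w2 w2z E2] := H j i h.
  rewrite (gtr0_norm h0) in w1z w2z.
  have E : pder i (pder j f) w1 = pder j (pder i f) w2.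
    have hn : h ^+ 2 != 0 by rewrite expf_neq0// gt_eqF.
    apply: (mulfI hn); rewrite -E1 -E2.
    rewrite [h *: basis_vector R j + (_ + _)]addrCA.
    by move: (f _) (f _) (f _) (f _) => q1 q2 q3 q4; ring.
  have := Hr1 w1; rewrite /= distrC => /(_ (le_lt_trans w1z hr1)).
  have := Hr2 w2; rewrite /= distrC => /(_ (le_lt_trans w2z hr2)).
  rewrite -E => A1 A2.
  move: A1 A2; move: (pder i _ z) (pder j _ z) (pder i _ w1) => q1 q2 q3 A1 A2.
  have -> : q1 - q2 = (q1 - q3) - (q2 - q3) by ring.
  by apply: (le_trans (ler_normB _ _)); lra.
pose u := basis_vector R a; pose v := basis_vector R b; rewrite -/u -/v.
have sa := smooth_partial a sf.
have dphi w : is_derive w v (fun w => f (h *: u + w) - f w)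
    (pder b f (h *: u + w) - pder b f w).
  apply: (@is_derive_add _ (fun w => f (h *: u + w)) (fun w => - f w)).
    have := @is_derive_affine _ 1 (h *: u) f w v (pder b f (h *: u + w)).
    rewrite mul1r scale1r addrC => H.
    have -> : (fun w => f (h *: u + w)) = (fun w => f (1 *: w + h *: u)).
      by apply/funext => y; rewrite scale1r addrC.
    by apply: H; exact: C1_is_derive (smooth_C1 sf).
  by apply: is_deriveN; exact: C1_is_derive (smooth_C1 sf).
have [c1 c1h E1] := MVT_line z h dphi.
have [c2 c2h E2] := @MVT_line (pder b f) u (c1 *: v + z) (pder a (pder b f)) h
  (fun w => C1_is_derive a w (smooth_C1 (smooth_partial b sf))).
exists (c2 *: u + (c1 *: v + z)).
  rewrite addrA addrK; apply: (le_trans (ler_normD _ _)).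
  rewrite !normrZ mulr_natl mulr2n; apply: lerD.
    by apply: (le_trans _ c2h); rewrite ler_piMr// basis_norm.
  by apply: (le_trans _ c1h); rewrite ler_piMr// basis_norm.
rewrite expr2 -mulrA -E2 -E1.
by move: (f _) (f _) (f _) (f _) => q1 q2 q3 q4; ring.
Qed.
End support.

(** * Integration on the plane *)

Section plane.
Variable R : realType.
Local Notation plane := (measurableTypeR R * measurableTypeR R)%type.
Local Notation mu := (lebesgue2 R).
Implicit Types (A B D K : set plane) (f g psi : R * R -> R) (z w : R * R).

Lemma ball2P z r w : ball z r w <-> `|z - w| < r.
Proof. by rewrite ball_prod_normE. Qed.

Lemma ball2X z r : ball z r = ball z.1 r `*` ball z.2 r :> set (R * R).
Proof. by []. Qed.

Lemma ball2_measurable z r : measurable (ball z r : set plane).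
Proof. by rewrite ball2X; apply: measurableX; rewrite ball_itv; exact: measurable_itv. Qed.

Lemma ball2_mu z r : 0 <= r -> mu (ball z r) = ((r *+ 2) ^+ 2)%:E.
Proof.
move=> r0; rewrite ball2X.
have := @product_measure1E _ _ (measurableTypeR R) (measurableTypeR R) R
  (@lebesgue_measure R) (@lebesgue_measure R) (ball z.1 r) (ball z.2 r).
move=> H; apply: (etrans (H _ _)); [by rewrite ball_itv; exact: measurable_itv..|].
apply: (etrans (f_equal2 mule (lebesgue_measure_ball z.1 r0) (lebesgue_measure_ball z.2 r0))).
by rewrite -EFinM expr2.
Qed.

(** A countable base of the plane. In the sup norm balls are products of intervals, so the base
    links the topology with the product sigma-algebra; it also turns local almost-everywhere
    statements into global ones. Codes that decode to nothing give the empty set. *)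
Definition qbox (k : nat) : set (R * R) :=
  if unpickle k is Some abr then
    let: (a, b, r) := abr : rat * rat * rat in ball ((ratr a, ratr b) : R * R) (ratr r)
  else set0.

Lemma qbox_measurable k : measurable (qbox k : set plane).
Proof. by rewrite /qbox; case: unpickle => [[[a b] r]|]//; exact: ball2_measurable. Qed.

Lemma qbox_fin k : (mu (qbox k) < +oo)%E.
Proof.
rewrite /qbox; case: unpickle => [[[a b] r]|]; last by rewrite measure0.
have [r0|r0] := leP 0 (ratr r : R); first by rewrite ball2_mu// ltry.
rewrite (_ : ball _ _ = set0) ?measure0//.
by rewrite ball2X (ball0 _ _).2 ?set0X// ltW.
Qed.

Lemma qbox_basis (A : set (R * R)) z : open A -> A z ->
  exists k, qbox k z /\ qbox k `<=` A.
Proof.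
move=> oA Az; have /nbhs_ballP[r /= r0 rA] : nbhs z A by exact: open_nbhs_nbhs.
have [q q1] : exists q : rat, ratr q \in `](r / 3), (r / 2)[.
  by apply: rat_in_itvoo; lra.
have /rat_in_itvoo[a a1] : z.1 - r / 3 < z.1 + r / 3 by lra.
have /rat_in_itvoo[b b1] : z.2 - r / 3 < z.2 + r / 3 by lra.
move: q1 a1 b1; rewrite !in_itv/= => /andP[q1 q2] /andP[a1 a2] /andP[b1 b2].
exists (pickle (a, b, q)); rewrite /qbox pickleK; split.
  by rewrite ball2X; split; rewrite -ball_normE/= ltr_norml; apply/andP; split; lra.
move=> w; rewrite ball2X => -[]; rewrite -!ball_normE/= => w1 w2; apply: rA.
rewrite ball2X; split; rewrite -ball_normE/=.
  by move: w1; rewrite !ltr_norml => /andP[]; lra.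
by move: w2; rewrite !ltr_norml => /andP[]; lra.
Qed.

Lemma open_plane_measurable A : open (A : set (R * R)) -> measurable A.
Proof.
move=> oA; have -> : A = \bigcup_k (if `[< qbox k `<=` A >] then qbox k else set0).
  apply/seteqP; split=> z.
    move=> /(qbox_basis oA)[k [kz kA]]; exists k => //.
    by case: asboolP.
  by move=> [k _]; case: asboolP => // kA /kA.
apply: bigcupT_measurable => k; case: asboolP => // _; exact: qbox_measurable.
Qed.

Lemma closed_plane_measurable A : closed (A : set (R * R)) -> measurable A.
Proof.
by move=> cA; rewrite -[A]setCK; apply: measurableC; apply: open_plane_measurable;
   exact: closed_openC.
Qed.

Lemma compact_plane_measurable K : compact (K : set (R * R)) -> measurable K.
Proof. by move=> /compact_closed2; exact: closed_plane_measurable. Qed.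

Lemma compact_box K : compact (K : set (R * R)) ->
  exists2 M, 0 < M & K `<=` ball ((0, 0) : R * R) M.
Proof.
move=> /compact_bounded[M [_ HM]]; exists (`|M| + 2); first by rewrite ltr_wpDl.
move=> z Kz; apply/ball2P.
rewrite (_ : (0, 0) = 0 :> R * R)// sub0r normrN.
apply: (@le_lt_trans _ _ (`|M| + 1)); last by rewrite ltrD2l; lra.
by apply: HM => //; rewrite (le_lt_trans (ler_norm _))// ltrDl.
Qed.

Lemma compact_mu_fin K : compact (K : set (R * R)) -> (mu K < +oo)%E.
Proof.
move=> cK; have [M M0 KM] := compact_box cK.
apply: (@le_lt_trans _ _ (mu (ball ((0, 0) : R * R) M))).
  apply: le_measure => //; rewrite inE; first exact: compact_plane_measurable.
  exact: ball2_measurable.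
by rewrite ball2_mu ?ltry// ltW.
Qed.

Lemma continuous_within_measurable D f : open (D : set (R * R)) ->
  {within D, continuous f} -> measurable_fun D f.
Proof.
move=> oD cf mD; apply: (measurability _ (RGenOpens.measurableE R)) => //.
move=> _ [_ [a [b ->] <-]]; apply: open_plane_measurable.
have := cf; rewrite continuous_open_subspace// => {}cf.
rewrite openE => z [Dz fz] /=.
apply: filterI; first exact: open_nbhs_nbhs.
have /cf : z \in D by rewrite inE.
apply; apply: open_nbhs_nbhs; split=> //; exact: interval_open.
Qed.

Lemma continuous_plane_measurable D f : continuous f -> measurable D -> measurable_fun D f.
Proof.
move=> cf mD; apply: measurable_funTS; apply: continuous_within_measurable.
  exact: openT.
exact: continuous_subspaceT.
Qed.

Lemma ae_mono (P Q : plane -> Prop) : (forall z, P z -> Q z) ->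
  {ae mu, forall z, P z} -> {ae mu, forall z, Q z}.
Proof. exact: (@filterS _ _ (ae_filter_ringOfSetsType mu)). Qed.

Definition L f psi : R := \int[mu]_z (f z * psi z).

Definition intg f psi := mu.-integrable setT (fun z => (f z * psi z)%:E).

Lemma integrable_supp K g : measurable K -> (forall z, ~ K z -> g z = 0) ->
  mu.-integrable K (EFin \o g) -> mu.-integrable setT (EFin \o g).
Proof.
move=> mK g0 iK; have := (integrable_mkcond (mu := mu) (EFin \o g) mK).1 iK.
congr (integrable _ _ _); apply/funext => z; rewrite patchE.
by case: ifPn => // /negP zK; rewrite /= g0// => Kz; apply: zK; rewrite inE.
Qed.

Lemma continuous_bounded_on K psi : continuous psi -> compact (K : set (R * R)) ->
  exists2 m, 0 < m & forall z, K z -> `|psi z| <= m.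
Proof.
move=> cpsi cK.
have /compact_bounded[M [_ HM]] := continuous_compact (continuous_subspaceT cpsi) cK.
exists (`|M| + 1); first by rewrite ltr_wpDl.
by move=> z Kz; apply: HM; [rewrite (le_lt_trans (ler_norm _))// ltrDl|exists z].
Qed.

Lemma L1loc_intg D f psi : L1loc D f -> continuous psi -> supported D psi ->
  intg f psi.
Proof.
move=> [mf lf] cpsi [K [cK KD Kpsi]].
have mK := compact_plane_measurable cK.
apply: (@integrable_supp K (fun z => f z * psi z)) => //.
  by move=> z /Kpsi ->; rewrite mulr0.
have [m m0 Hm] := continuous_bounded_on cpsi cK.
have := @integrableMl _ _ _ mu K mK (EFin \o f) psi (lf _ cK KD).
apply; first exact: continuous_plane_measurable.
exists m; split; first exact: num_real.
by move=> x mx z Kz; apply: (le_trans (Hm _ Kz)); exact: ltW.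
Qed.

Lemma intg_div2 D f F : L1loc D f -> field D F -> intg f (div2 F).
Proof.
by move=> lf HF; exact: (L1loc_intg lf (continuous_div2 HF) (supported_div2 HF)).
Qed.

Lemma eq_L f g psi phi : (forall z, f z * psi z = g z * phi z) -> L f psi = L g phi.
Proof. by move=> H; apply: eq_Rintegral => z _. Qed.

Lemma L_addr f psi phi : intg f psi -> intg f phi ->
  L f (fun z => psi z + phi z) = L f psi + L f phi.
Proof.
move=> i1 i2; rewrite /L -RintegralD//.
by apply: eq_Rintegral => z _; rewrite mulrDr.
Qed.

Lemma L_subr f psi phi : intg f psi -> intg f phi ->
  L f (fun z => psi z - phi z) = L f psi - L f phi.
Proof.
move=> i1 i2; rewrite /L -RintegralB//.
by apply: eq_Rintegral => z _; rewrite mulrBr.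
Qed.

Lemma L_scaler f c psi : intg f psi -> L f (fun z => c * psi z) = c * L f psi.
Proof.
move=> i1; rewrite /L -RintegralZl//.
by apply: eq_Rintegral => z _; rewrite mulrCA.
Qed.

Lemma L_addl f g psi : intg f psi -> intg g psi ->
  L (fun z => f z + g z) psi = L f psi + L g psi.
Proof.
move=> i1 i2; rewrite /L -RintegralD//.
by apply: eq_Rintegral => z _; rewrite mulrDl.
Qed.

Lemma L_subl f g psi : intg f psi -> intg g psi ->
  L (fun z => f z - g z) psi = L f psi - L g psi.
Proof.
move=> i1 i2; rewrite /L -RintegralB//.
by apply: eq_Rintegral => z _; rewrite mulrBl.
Qed.

Lemma L_scalel f c psi : intg f psi -> L (fun z => c * f z) psi = c * L f psi.
Proof.
move=> i1; rewrite /L -RintegralZl//.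
by apply: eq_Rintegral => z _; rewrite mulrA.
Qed.

Lemma Rintegral_supp K g : measurable K -> (forall z, ~ K z -> g z = 0) ->
  \int[mu]_z g z = \int[mu]_(z in K) g z.
Proof.
move=> mK g0; rewrite [RHS]Rintegral_mkcond; apply: eq_Rintegral => z _.
rewrite patchE; case: ifPn => // /negP zK; apply: g0 => Kz; apply: zK.
by rewrite inE.
Qed.

Lemma L_bound K f psi m : measurable K -> mu.-integrable K (EFin \o f) ->
  intg f psi -> (forall z, ~ K z -> psi z = 0) -> (forall z, K z -> `|psi z| <= m) ->
  `|L f psi| <= m * \int[mu]_(z in K) `|f z|.
Proof.
move=> mK fK ip psi0 psim.
have ipK : mu.-integrable K (EFin \o (fun z => f z * psi z)) by exact: integrableS ip.
rewrite /L (@Rintegral_supp K (fun z => f z * psi z)) => //; last first.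
  by move=> z /psi0 ->; rewrite mulr0.
apply: (le_trans (le_normr_Rintegral mK ipK)).
have fn : mu.-integrable K (EFin \o (fun z => `|f z|)) by exact: integrable_norm.
rewrite -RintegralZl//.
apply: le_Rintegral => //.
- exact: (@integrable_norm _ _ _ mu K (fun z => f z * psi z)).
- by move: (integrableZl mK m fn).
- by move=> z Kz; rewrite normrM mulrC ler_wpM2r// psim.
Qed.

Lemma hessian_pairingE D f F : open (D : set (R * R)) -> L1loc D f -> field D F ->
  hessian_pairing f D F = (L f (div2 F))%:E.
Proof.
move=> oD lf HF.
have iF := intg_div2 lf HF.
have mD := open_plane_measurable oD.
rewrite /L /Rintegral fineK; last exact: integrable_fin_num.
rewrite /hessian_pairing [LHS]integral_mkcond; apply: eq_integral => z _.
have E : \sum_(i < 2) \sum_(j < 2) f z * partial i (partial j (fun w => F w i j)) z =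
    f z * div2 F z.
  rewrite /div2 mulr_sumr; apply: eq_bigr => i _; rewrite mulr_sumr.
  by apply: eq_bigr => j _; rewrite !pderE.
rewrite patchE E; case: ifPn => // /negP zD.
by rewrite (supported_out (supported_div2 HF)) ?mulr0// => Dz; apply: zD; rewrite inE.
Qed.

(** The variation on [D] is at most [c], unfolded into real inequalities; [hessian_leP] relates it
    to the extended-real supremum. *)
Definition Vle D f c := forall F, field D F -> (forall z, opb 1 (F z)) ->
  L f (div2 F) <= c.

Lemma L_zero f : L f (fun=> 0) = 0.
Proof. by rewrite /L; under eq_Rintegral do rewrite mulr0; rewrite /Rintegral integral0. Qed.

Lemma Vle_zero D : Vle D (fun=> 0) 0.
Proof.
move=> F _ _; rewrite (@eq_L _ (fun=> 0) (div2 F) (fun=> 0)) ?L_zero// => z.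
by rewrite mul0r mulr0.
Qed.

Lemma hessian_leP D f c : open (D : set (R * R)) -> L1loc D f ->
  (hessian_schatten1 f D <= c%:E)%E <-> Vle D f c.
Proof.
move=> oD lf; split.
  move=> H F HF F1; rewrite -lee_fin -(hessian_pairingE oD lf HF).
  by apply: le_trans H; apply: ereal_sup_ubound; exists F => //; apply/admissibleP.
move=> H; apply: ge_ereal_sup => _ [F /admissibleP[HF F1] <-].
by rewrite (hessian_pairingE oD lf HF) lee_fin; exact: H.
Qed.

Lemma Vle_ge0 D f c : Vle D f c -> 0 <= c.
Proof.
move=> /(_ (fun=> 0) (@field0 R D) (fun=> opb_le ler01 (@opb0 R))).
have -> : L f (div2 (fun=> 0)) = 0.
  rewrite /L.
  have -> : (fun z => f z * div2 (fun=> 0) z) = fun=> 0.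
    apply/funext => z; rewrite /div2 !sum2.
    have -> i j : (fun w : R * R => (0 : 'M[R]_2) i j) = fun=> 0.
      by apply/funext => w; rewrite mxE.
    by rewrite !partial_cst !addr0 mulr0.
  by rewrite Rintegral_cst// mul0r.
by [].
Qed.

Lemma Vle_opb D f c t F : 0 <= t -> Vle D f c -> field D F -> (forall z, opb t (F z)) ->
  L1loc D f -> L f (div2 F) <= t * c.
Proof.
move=> t0 Vf HF Ft lf.
have iF := intg_div2 lf HF.
apply/ler_addgt0Pr => e e0.
have c0 := Vle_ge0 Vf.
(* Slightly more than [t], so that one may divide when [t = 0]; the excess costs at most [e]. *)
pose s := t + e / (c + 1).
have s0 : 0 < s by rewrite ltr_wpDl// divr_gt0// ltr_wpDl.
have := Vf (fun z => s^-1 *: F z) (fieldZ _ HF).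
rewrite div2Z; last exact: field_smoothF HF.
rewrite L_scaler//.
have H1 z : opb 1 (s^-1 *: F z).
  apply: (@opb_le _ (s^-1 * t)).
    by rewrite mulrC ler_pdivrMr// mul1r /s lerDl divr_ge0 ?ltW// ltr_wpDl.
  by apply: opbZ => //; rewrite invr_ge0 ltW.
move=> /(_ H1); rewrite mulrC ler_pdivrMr// => H.
apply: (le_trans H); rewrite /s mulrDr mulrC lerD2l mulrCA ler_piMr ?ltW//.
by rewrite ltr_pdivrMr ?mul1r ?ltrDl// ltr_wpDl.
Qed.

Lemma L1loc_continuous D f : open (D : set (R * R)) -> {within D, continuous f} ->
  L1loc D f.
Proof.
move=> oD cf; split; first exact: continuous_within_measurable.
move=> K cK KD; apply: measurable_bounded_integrable.
- exact: compact_plane_measurable.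
- exact: compact_mu_fin.
- apply: measurable_funS (continuous_within_measurable oD cf) => //.
  exact: open_plane_measurable.
- have /compact_bounded[M [_ HM]] := continuous_compact (continuous_subspaceW KD cf) cK.
  by exists M; split; rewrite ?num_real// => x Mx z Kz; apply: HM => //; exists z.
Qed.

End plane.

(** * Integration by parts and convolution *)

Section calculus.
Variable R : realType.
Local Notation plane := (measurableTypeR R * measurableTypeR R)%type.
Local Notation mu := (lebesgue2 R).
Implicit Types (D U K : set plane) (f g u psi : R * R -> R) (z w p q : R * R)
  (M C e m r s rho : R).

Lemma norm_gt_near (V : normedModType R) (v : V) M : M < `|v| -> \forall y \near v, M < `|y|.
Proof.
by move=> Mv; apply: (@cvgr_gt _ _ _ _ (fun y : V => `|y|) `|v| (@norm_continuous _ _ v)).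
Qed.

Lemma pair_continuousl (y : R) : continuous (fun x : R => (x, y)).
Proof. by move=> x; exact: (cvg_pair cvg_id (cvg_cst _)). Qed.

Lemma pair_continuousr (x : R) : continuous (fun y : R => (x, y)).
Proof. by move=> y; exact: (cvg_pair (cvg_cst _) cvg_id). Qed.

Lemma integrable_cst_fin K (c : R) : measurable K -> (mu K < +oo)%E ->
  mu.-integrable K (EFin \o (fun=> c)).
Proof.
move=> mK Kfin; apply: measurable_bounded_integrable => //.
by exists `|c|; split; [exact: num_real|move=> x cx z _; exact: ltW].
Qed.

Lemma intg_cst1 psi : continuous psi -> supported setT psi -> intg (cst 1) psi.
Proof.
apply: L1loc_intg; apply: L1loc_continuous; first exact: openT.
by apply: continuous_subspaceT => z; exact: cvg_cst.
Qed.

Lemma integrable_cc psi : continuous psi -> supported setT psi ->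
  mu.-integrable setT (EFin \o psi).
Proof.
move=> c s; have := intg_cst1 c s; rewrite /intg.
by congr (integrable _ _ _); apply/funext => z; rewrite /cst mul1r.
Qed.

Lemma L1E psi : L (cst 1) psi = \int[mu]_z psi z.
Proof. by apply: eq_Rintegral => z _; rewrite mul1r. Qed.

Lemma FTC_zero (F f : R -> R) M : 0 < M -> continuous f ->
  (forall x : R, is_derive x 1 F (f x)) -> (forall x, M <= `|x| -> F x = 0) ->
  (\int[@lebesgue_measure R]_x (f x)%:E = 0)%E.
Proof.
move=> M0 cf dF F0.
have f0 x : M < `|x| -> f x = 0.
  move=> Mx; have nz : \forall y \near x, cst (0:R) y = F y.
    by apply: filterS (norm_gt_near Mx) => y /ltW /F0 ->.
  have [_ <-] := dF x.
  by rewrite -(near_eq_derive _ nz) derive_cst.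
have cF : continuous F.
  move=> x; apply: differentiable_continuous; apply/derivable1_diffP.
  by have [] := dF x.
have -> : (\int[@lebesgue_measure R]_x (f x)%:E =
    \int[@lebesgue_measure R]_(x in `[(- M)%R, M]) (f x)%:E)%E.
  rewrite [RHS]integral_mkcond; apply: eq_integral => x _.
  rewrite patchE; case: ifPn => // /negP xM; rewrite f0// ltNge.
  by apply/negP => xM'; apply: xM; rewrite inE/= in_itv/= -ler_norml.
have -> := @continuous_FTC2 R f F (- M) M.
- by rewrite !F0 ?subee// ?normrN ger0_norm// ltW.
- by rewrite gtrN.
- exact: continuous_subspaceT.
- split.
  + by move=> x _; have [] := dF x.
  + apply: cvg_at_right_filter; exact: cF.
  + apply: cvg_at_left_filter; exact: cF.
- by move=> x _; rewrite derive1E; have [_ ->] := dF x.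
Qed.

(** Fubini, integrating first in direction [i], where the fundamental theorem gives 0 by compact
    support. *)
Lemma int_derive0 i g dg : (forall z, is_derive z (basis_vector R i) g (dg z)) ->
  continuous dg -> supported setT g -> \int[mu]_z dg z = 0.
Proof.
move=> dgP cdg sg.
have dgE : pder i g = dg by exact: pder_eq.
have sdg : supported setT dg by rewrite -dgE; exact: supported_partial.
have idg := integrable_cc cdg sdg.
have [K [cK _ K0]] := sg; have [M M0 KM] := compact_box cK.
have g0 z : M <= `|z| -> g z = 0.
  move=> Mz; apply: K0 => /KM /ball2P; rewrite (_ : (0, 0) = 0 :> R * R)//.
  by rewrite sub0r normrN ltNge Mz.
rewrite /Rintegral; suff -> : (\int[mu]_z (dg z)%:E = 0)%E by [].
move: dgP; elim/I2P: i {dgE} => dgP.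
  have E := integral21_prod_meas1 idg.
  apply: (etrans (esym E)); apply: integral0_eq => y _.
  apply: (@FTC_zero (fun x => g (x, y)) (fun x => dg (x, y)) M) => //.
  - by move=> x; apply: (@continuous_comp _ _ _ (fun x => (x, y)) dg);
      [exact: pair_continuousl|exact: cdg].
  - move=> x; have := @is_derive_line R g (0, y) (basis_vector R ord0) x (dg (x, y)).
    have E1 s : s *: basis_vector R ord0 + (0, y) = (s, y).
      by rewrite /basis_vector/=; congr (_, _) => /=; rewrite ?scaler0 ?add0r ?addr0// [_ *: _]mulr1.
    rewrite E1 => /(_ (dgP _)).
    by congr is_derive; apply/funext => s; rewrite E1.
  - by move=> x Mx; apply: g0; rewrite prod_normE/= le_max Mx.
have E := integral12_prod_meas1 idg.
apply: (etrans (esym E)); apply: integral0_eq => x _.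
apply: (@FTC_zero (fun y => g (x, y)) (fun y => dg (x, y)) M) => //.
- by move=> y; apply: (@continuous_comp _ _ _ (fun y => (x, y)) dg);
    [exact: pair_continuousr|exact: cdg].
- move=> y; have := @is_derive_line R g (x, 0) (basis_vector R o1) y (dg (x, y)).
  have E1 s : s *: basis_vector R o1 + (x, 0) = (x, s).
    by rewrite /basis_vector/=; congr (_, _) => /=; rewrite ?scaler0 ?add0r ?addr0// [_ *: _]mulr1.
  rewrite E1 => /(_ (dgP _)).
  by congr is_derive; apply/funext => s; rewrite E1.
- by move=> y My; apply: g0; rewrite prod_normE/= le_max My orbT.
Qed.

(** [u] may be arbitrary off [U]: near such a point the product is identically 0. *)
Lemma continuous_mul_supp U u psi : open (U : set (R * R)) ->
  (forall z, U z -> {for z, continuous u}) -> continuous psi -> supported U psi ->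
  continuous (fun z => u z * psi z).
Proof.
move=> oU cu cpsi [K [cK KU K0]] z.
have [Uz|nUz] := pselect (U z); first by apply: cvgM; [exact: cu|exact: cpsi].
have nz : \forall w \near z, cst (0:R) w = u w * psi w.
  have := closed_near (compact_closed2 cK) (fun Kz => nUz (KU _ Kz)).
  by apply: filterS => w /K0 ->; rewrite mulr0.
rewrite /continuous_at (_ : u z * psi z = 0); last by rewrite -(nbhs_singleton nz).
by apply: cvg_trans (near_eq_cvg nz) (cvg_cst _).
Qed.

Lemma ibp U i u du psi : open (U : set (R * R)) ->
  (forall z, U z -> {for z, continuous u}) ->
  (forall z, U z -> {for z, continuous du}) ->
  (forall z, U z -> is_derive z (basis_vector R i) u (du z)) ->
  Cinf psi -> supported U psi ->
  L u (pder i psi) = - L du psi.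
Proof.
move=> oU cu cdu duP spsi supp.
have c1 := continuous_mul_supp oU cu (smooth_continuous (smooth_partial i spsi))
  (supported_partial i supp).
have c2 := continuous_mul_supp oU cdu (smooth_continuous spsi) supp.
have s1 : supported setT (fun z => u z * pder i psi z).
  by apply: (@supportedS R U) => //; exact/supported_mulr/supported_partial.
have s2 : supported setT (fun z => du z * psi z).
  by apply: (@supportedS R U) => //; exact/supported_mulr.
have H : \int[mu]_z (du z * psi z + u z * pder i psi z) = 0.
  apply: (@int_derive0 i (fun z => u z * psi z)); last first.
  - by apply: (@supportedS R U) => //; exact/supported_mulr.
  - by move=> z; apply: cvgD; [exact: c2|exact: c1].
  move=> z; have [Uz|nUz] := pselect (U z).
    by apply: is_derive_mul; [exact: duP|exact: C1_is_derive (smooth_C1 spsi)].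
  have [K [cK KU K0]] := supp.
  have nK := fun Kz => nUz (KU _ Kz).
  rewrite K0// (partial_off i (compact_closed2 cK) K0)// !mulr0 addr0.
  have nz : \forall w \near z, cst (0:R) w = u w * psi w.
    by apply: filterS (closed_near (compact_closed2 cK) nK) => w /K0 ->; rewrite mulr0.
  exact: (near_eq_is_derive nz).
apply/eqP; rewrite -addr_eq0 addrC; apply/eqP; rewrite -H /L -RintegralD//.
  exact: integrable_cc.
exact: integrable_cc.
Qed.

(** Regularity on [U] only, with the derivatives supplied as data: the functions to be integrated by
    parts are cones off their apex and locally affine functions, both wild elsewhere. *)
Record C2on U u (du : 'I_2 -> R * R -> R) (ddu : 'I_2 -> 'I_2 -> R * R -> R) := MkC2on {
  C2_c0 : forall z, U z -> {for z, continuous u};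
  C2_c1 : forall i z, U z -> {for z, continuous (du i)};
  C2_c2 : forall i j z, U z -> {for z, continuous (ddu i j)};
  C2_d1 : forall i z, U z -> is_derive z (basis_vector R i) u (du i z);
  C2_d2 : forall i j z, U z -> is_derive z (basis_vector R j) (du i) (ddu i j z) }.

Lemma ibp2 U u du ddu F : open (U : set (R * R)) -> C2on U u du ddu -> field U F ->
  L u (div2 F) = \int[mu]_z (\sum_(i < 2) \sum_(j < 2) ddu i j z * F z i j).
Proof.
move=> oU [c0 c1 c2 d1 d2] HF.
have key i j : L u (pder i (pder j (fun w => F w i j))) = L (ddu i j) (fun w => F w i j).
  have [s1 s2] := HF i j.
  rewrite (ibp oU c0 (c1 i) (d1 i) (smooth_partial j s1) (supported_partial j s2)).
  by rewrite (ibp oU (c1 i) (c2 i j) (d2 i j) s1 s2) opprK.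
have I1 i j : mu.-integrable setT (EFin \o (fun z => u z * pder i (pder j (fun w => F w i j)) z)).
  have [s1 s2] := HF i j.
  apply: integrable_cc.
    apply: (continuous_mul_supp oU c0); last by do 2!apply: supported_partial.
    by apply: smooth_continuous; do 2!apply: smooth_partial.
  by apply: (@supportedS R U) => //; apply: supported_mulr; do 2!apply: supported_partial.
have I2 i j : mu.-integrable setT (EFin \o (fun z => ddu i j z * F z i j)).
  have [s1 s2] := HF i j.
  apply: integrable_cc; first exact: (continuous_mul_supp oU (c2 i j) (smooth_continuous s1)).
  by apply: (@supportedS R U) => //; apply: supported_mulr.
have sumR (h : 'I_2 -> 'I_2 -> R * R -> R) :
    (forall i j, mu.-integrable setT (EFin \o h i j)) ->
    \int[mu]_z (\sum_(i < 2) \sum_(j < 2) h i j z) =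
    \sum_(i < 2) \sum_(j < 2) \int[mu]_z h i j z.
  move=> Hh; rewrite !sum2.
  have Hs i : mu.-integrable setT (EFin \o (fun z => h i ord0 z + h i o1 z)).
    exact: (integrableD measurableT (Hh i ord0) (Hh i o1)).
  rewrite -!RintegralD//; apply: eq_Rintegral => z _; by rewrite !sum2.
rewrite sumR//; rewrite /L.
transitivity (\int[mu]_z (\sum_(i < 2) \sum_(j < 2) u z * pder i (pder j (fun w => F w i j)) z)).
  apply: eq_Rintegral => z _; rewrite /div2 mulr_sumr; apply: eq_bigr => i _.
  by rewrite mulr_sumr.
rewrite sumR//; apply: eq_bigr => i _; apply: eq_bigr => j _; exact: key.
Qed.

Lemma int_div2 F : field setT F -> \int[mu]_z div2 F z = 0.
Proof.
move=> HF; rewrite -L1E.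
rewrite (@ibp2 setT (cst 1) (fun _ => cst 0) (fun _ _ => cst 0) F openT)//.
  rewrite (_ : (fun z => _) = cst 0) ?Rintegral_cst ?mul0r//.
  by apply/funext => z; rewrite !sum2 /cst !mul0r !addr0.
split=> // *; try exact: cvg_cst; exact: is_derive_cst.
Qed.

(** * Convolution with a smooth kernel *)

Definition cball z (r : R) : set (R * R) := [set w | `|z - w| <= r].

Lemma cball_compact z r : compact (cball z r).
Proof.
have -> : cball z r = `[z.1 - r, z.1 + r] `*` `[z.2 - r, z.2 + r].
  apply/seteqP; split=> w; rewrite /cball/= prod_normE/= ge_max !in_itv/=.
    by rewrite !ler_norml => /andP[/andP[? ?] /andP[? ?]]; split; apply/andP; split; lra.
  by move=> [/andP[? ?] /andP[? ?]]; rewrite !ler_norml; apply/andP; split; apply/andP; split; lra.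
by apply: compact_setX; exact: segment_compact.
Qed.

Arguments cball_compact : clear implicits.

Lemma bounded_deriv psi : Cinf psi -> supported setT psi ->
  exists2 C, 0 < C & forall z, `|psi z| <= C.
Proof.
move=> spsi [K [cK _ K0]].
have [m m0 Hm] := continuous_bounded_on (smooth_continuous spsi) cK.
exists m => // z; have [Kz|nK] := pselect (K z); first exact: Hm.
by rewrite K0// normr0 ltW.
Qed.

Lemma smooth_lipschitz psi : Cinf psi -> supported setT psi ->
  exists2 C, 0 < C & forall z w, `|psi z - psi w| <= C * `|z - w|.
Proof.
move=> spsi supp.
have [C0 C00 H0] := bounded_deriv (smooth_partial ord0 spsi) (supported_partial ord0 supp).
have [C1 C10 H1] := bounded_deriv (smooth_partial o1 spsi) (supported_partial o1 supp).
exists (C0 + C1); first exact: addr_gt0.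
move=> z w.
have [c _ E0] := MVT_line w (z.1 - w.1) (fun y => C1_is_derive ord0 y (smooth_C1 spsi)).
have [d _ E1] := MVT_line ((z.1 - w.1) *: basis_vector R ord0 + w) (z.2 - w.2)
  (fun y => C1_is_derive o1 y (smooth_C1 spsi)).
have Ez : (z.2 - w.2) *: basis_vector R o1 + ((z.1 - w.1) *: basis_vector R ord0 + w) = z.
  rewrite /basis_vector/= [in RHS](surjective_pairing z); congr (_, _) => /=.
    by rewrite scaler0 add0r [_ *: _]mulr1 subrK.
  by rewrite scaler0 add0r [_ *: _]mulr1 subrK.
rewrite Ez in E1.
rewrite (_ : psi z - psi w = (z.2 - w.2) * pder o1 psi (d *: basis_vector R o1 + ((z.1 - w.1) *: basis_vector R ord0 + w))
   + (z.1 - w.1) * pder ord0 psi (c *: basis_vector R ord0 + w)); last first.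
  by rewrite -E0 -E1; move: (psi _) (psi _) (psi _) => *; ring.
have n1 : `|z.1 - w.1| <= `|z - w| by rewrite [in leRHS]prod_normE le_max lexx.
have n2 : `|z.2 - w.2| <= `|z - w| by rewrite [in leRHS]prod_normE le_max lexx orbT.
apply: (le_trans (ler_normD _ _)); rewrite !normrM mulrDl addrC.
by apply: lerD; rewrite mulrC; apply: ler_pM => //; rewrite ltW.
Qed.

Definition shiftf psi q : R * R -> R := fun y => psi (y - q).

Lemma shiftf_affine psi q : shiftf psi q = fun y => psi (1 *: y + - q).
Proof. by apply/funext => y; rewrite scale1r. Qed.

Lemma smooth_shiftf psi q : Cinf psi -> Cinf (shiftf psi q).
Proof. by rewrite shiftf_affine; exact: smooth_affine. Qed.

Lemma pder_shiftf psi i q : Cinf psi -> pder i (shiftf psi q) = shiftf (pder i psi) q.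
Proof. by move=> s; rewrite !shiftf_affine partial_affine//; apply/funext => y; rewrite mul1r. Qed.

Lemma supported_shiftf D psi q rho : (forall z, rho < `|z| -> psi z = 0) ->
  cball q rho `<=` D -> supported D (shiftf psi q).
Proof.
move=> H HD; exists (cball q rho); split=> //; first exact: cball_compact.
move=> z /negP; rewrite -ltNge distrC; exact: H.
Qed.

Lemma pder_out psi i rho : (forall z, rho < `|z| -> psi z = 0) ->
  forall z, rho < `|z| -> pder i psi z = 0.
Proof.
move=> H z Hz; apply: near_zero_partial.
by apply: filterS (norm_gt_near Hz) => y; exact: H.
Qed.

(** Differentiation under the integral sign, on a ball whose [rho]-neighbourhood stays in [D], since
    [f] is controlled only there. The sign comes from differentiating [psi (y - q)] in [q]. *)
Lemma is_derive_conv D f psi i p r rho : L1loc D f -> Cinf psi ->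
  (forall z, rho < `|z| -> psi z = 0) -> 0 <= rho ->
  cball p (r + rho) `<=` D -> forall q, `|p - q| < r ->
  is_derive q (basis_vector R i) (fun q => L f (shiftf psi q)) (- L f (shiftf (pder i psi) q)).
Proof.
move=> lf spsi psi0 rho0 HD q pq; apply/is_derive_sliceP.
pose v := basis_vector R i; rewrite -/v.
pose d := r - `|p - q|; have d0 : 0 < d by rewrite subr_gt0.
pose K := cball p (r + rho); have cK : compact K by exact: cball_compact.
have mK := compact_plane_measurable cK.
have close (h : R) : `|h| < d -> cball (h *: v + q) rho `<=` K.
  move=> hd w; rewrite /K /cball/= => wq.
  have -> : p - w = (p - q) - h *: v + ((h *: v + q) - w).
    by rewrite !addrA !subrK.
  apply: (le_trans (ler_normD _ _)); apply: lerD => //.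
  apply: (le_trans (ler_normB _ _)).
  have : `|h *: v| <= `|h| by rewrite normrZ ler_piMr// basis_norm.
  by move: hd; rewrite /d; lra.
have supp (phi : R * R -> R) (h : R) : (forall z, rho < `|z| -> phi z = 0) -> `|h| < d ->
    supported D (shiftf phi (h *: v + q)).
  by move=> phi0 hd; apply: (supported_shiftf phi0); exact: subset_trans (close _ hd) HD.
have suppT : supported setT psi.
  exists (cball 0 rho); split=> //; first exact: cball_compact.
  by move=> z /negP; rewrite -ltNge sub0r normrN; exact: psi0.
have [m m0 Hm] := bounded_deriv (smooth_partial i spsi) (supported_partial i suppT).
pose F (h : R) (y : plane) := f y * shiftf psi (h *: v + q) y.
(* The dominating function: all kernels centred within [d] of [q] are supported in [K]. *)
pose G (y : plane) : R := (m * `|f y|) * (y \in K)%:R.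
have dF (h : R) y : is_derive h 1 (fun h => F h y) (f y * (- shiftf (pder i psi) (h *: v + q) y)).
  rewrite /F /shiftf.
  have := is_derive_line (C1_is_derive i ((- h) *: v + (y - q)) (smooth_C1 spsi)).
  move=> H1.
  have := @is_derive1_comp R (fun s : R => psi (s *: v + (y - q))) (fun h => - h) h _ (-1) H1.
  have dN : is_derive h 1 (fun h : R => - h) (-1).
    by apply: is_deriveN; exact: is_derive_id.
  move=> /(_ dN) /(is_deriveZ (f y)).
  rewrite mulrN1 /=.
  have Es (s : R) : (- s) *: v + (y - q) = y - (s *: v + q).
    by rewrite scaleNr opprD addrCA.
  rewrite Es [_ *: _]mulrC [_ * f y]mulrC.
  congr is_derive; apply/funext => s; by rewrite /= -Es.
have iF (h : R) : `]-d, d[%classic h -> mu.-integrable setT (EFin \o F h).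
  rewrite /= in_itv/= -ltr_norml => hd.
  apply: (L1loc_intg lf); last exact: supp.
  exact/smooth_continuous/smooth_shiftf.
have KD : K `<=` D by [].
have [_ lf2] := lf; have fK := lf2 K cK KD.
have iG : mu.-integrable setT (EFin \o G).
  apply: (@integrable_supp _ K) => //.
    by move=> z zK; rewrite /G (_ : z \in K = false) ?mulr0//; apply/negP; rewrite inE.
  have := integrableZl mK m (integrable_norm fK).
  apply: eq_integrable => // z zK; by rewrite /G/= zK mulr1.
have I0 : `]-d, d[%classic (0 : R) by rewrite /= in_itv/= oppr_lt0 d0.
have dFh (h : R) (y : plane) : `]-d, d[%classic h -> setT y -> derivable (F ^~ y) h 1.
  by move=> _ _; have [] := dF h y.
have G0 y : 0 <= G y by rewrite /G mulr_ge0 ?ler0n// mulr_ge0// ltW.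
have GF (h : R) (y : plane) : `]-d, d[%classic h -> setT y -> `|partial1of2 F h y| <= G y.
  rewrite /= in_itv/= -ltr_norml => hd _; rewrite partial1of2E.
  have [_ ->] := dF h y; rewrite normrM normrN /G.
  have [yK|yK] := boolP (y \in K); first by rewrite mulr1 mulrC ler_wpM2r//; exact: Hm.
  rewrite /shiftf (pder_out i psi0) ?normr0 ?mulr0// ltNge; apply/negP => yh.
  move/negP: yK; apply; rewrite inE; apply: (close h hd).
  by rewrite /cball/= distrC.
have D1 := derivable_under_integral measurableT I0 iF dFh G0 iG GF.
have D2 := differentiation_under_integral measurableT I0 iF dFh G0 iG GF.
split; first exact: D1.
rewrite -derive1E; apply: (etrans D2).
rewrite /L -[RHS]mulN1r -RintegralZl//; last first.
  apply: (L1loc_intg lf); first exact/smooth_continuous/smooth_shiftf/smooth_partial.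
  have := supp (pder i psi) 0 (pder_out i psi0); rewrite normr0 scale0r add0r; exact.
apply: eq_Rintegral => y _.
have [_ E] := dF 0 y.
by rewrite partial1of2E E scale0r add0r mulrN mulN1r.
Qed.

(** Only size and support of the kernel enter, neither sign nor normalisation, so this serves both
    [kap], of mass [Kc], and divergences of cut-off fields, of mass 0. *)
Lemma approx_id D f p C e : open (D : set (R * R)) -> D p -> L1loc D f ->
  {for p, continuous f} -> 0 < C -> 0 < e ->
  exists2 s0, 0 < s0 & forall s phi, 0 < s < s0 -> continuous phi ->
    (forall z, 2 * s < `|z - p| -> phi z = 0) ->
    (forall z, `|phi z| <= C / s ^+ 2) ->
    `|L f phi - f p * \int[mu]_z phi z| <= e.
Proof.
move=> oD Dp lf cf C0 e0.
(* A kernel of size at most [C / s ^+ 2] is integrated over a square of area [36 * s ^+ 2]. *)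
pose e' := e / (36 * C).
have e'0 : 0 < e' by rewrite divr_gt0// mulr_gt0.
have /nbhs_ballP[r1 /= r10 H1] : nbhs p D by exact: open_nbhs_nbhs.
have /cvgrPdist_le/(_ _ e'0)/nbhs_ballP[r2 /= r20 H2] := cf.
exists (Num.min r1 r2 / 3); first by rewrite divr_gt0// lt_min r10.
move=> s phi /andP[s0 ss] cphi phi0 phiC.
have sr1 : 3 * s < r1.
  have : Num.min r1 r2 <= r1 by rewrite ge_min lexx.
  by move: ss; rewrite ltr_pdivlMr//; lra.
have sr2 : 3 * s < r2.
  have : Num.min r1 r2 <= r2 by rewrite ge_min lexx orbT.
  by move: ss; rewrite ltr_pdivlMr//; lra.
pose K : set plane := ball p (3 * s).
have mK : measurable K by exact: ball2_measurable.
have KcK : K `<=` cball p (3 * s) by move=> z /ball2P/ltW.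
have cD : cball p (3 * s) `<=` D by move=> z /= pz; apply: H1; apply/ball2P; exact: le_lt_trans sr1.
have phiK z : ~ K z -> phi z = 0.
  by move=> nK; apply: phi0; rewrite ltNge; apply/negP => h; apply: nK; apply/ball2P; rewrite distrC; lra.
have supp : supported D phi.
  exists (cball p (3 * s)); split=> //; first exact: cball_compact.
  by move=> z nz; apply: phiK => /KcK.
have suppT : supported setT phi := supportedS (fun _ _ => I) supp.
have i1 : intg f phi by exact: L1loc_intg lf cphi supp.
have i2 : intg (cst 1) phi by exact: intg_cst1.
have i3 : intg (fun z => f p * cst 1 z) phi.
  have := integrableZl measurableT (f p) i2; congr (integrable _ _ _).
  by apply/funext => z; rewrite /= -mulrA.
rewrite -L1E -L_scalel// -L_subl//.
have i4 : intg (fun z => f z - f p * cst 1 z) phi.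
  have := integrableB measurableT i1 i3; congr (integrable _ _ _).
  by apply/funext => z; rewrite /= -EFinB mulrBl.
have muK : mu K = ((3 * s *+ 2) ^+ 2)%:E by rewrite ball2_mu// mulr_ge0// ltW.
have muKfin : (mu K < +oo)%E by rewrite muK ltry.
have [_ lf2] := lf.
have fK : mu.-integrable K (EFin \o f).
  exact: (integrableS (compact_plane_measurable (cball_compact p (3 * s))) mK KcK
    (lf2 _ (cball_compact _ _) cD)).
have cK : mu.-integrable K (EFin \o (fun=> f p * cst 1 p)).
  exact: integrable_cst_fin.
have fK' : mu.-integrable K (EFin \o (fun z => f z - f p * cst 1 z)).
  have := integrableB mK fK cK; congr (integrable _ _ _).
apply: (le_trans (L_bound mK fK' i4 phiK (fun z _ => phiC z))).
have : \int[mu]_(z in K) `|f z - f p * cst 1 z| <= \int[mu]_(z in K) e'.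
  apply: le_Rintegral => //.
  - exact: (integrable_norm fK').
  - exact: integrable_cst_fin.
  - move=> z /ball2P Kz; rewrite mulr1 distrC; apply: H2; apply/ball2P.
    exact: lt_trans sr2.
rewrite Rintegral_cst// muK /= => H.
apply: (@le_trans _ _ (C / s ^+ 2 * (e' * (3 * s *+ 2) ^+ 2))).
  by apply: ler_wpM2l => //; rewrite divr_ge0 ?ltW// exprn_gt0.
rewrite /e' mulr2n le_eqVlt; apply/orP; left; apply/eqP; field.
by rewrite !gt_eqF.
Qed.

Lemma L_dominated D (fn : nat -> R * R -> R) f psi : open (D : set (R * R)) ->
  (forall n, measurable_fun D (fn n)) -> measurable_fun D f ->
  {ae mu, forall z, D z -> fn n z @[n --> \oo] --> f z} ->
  (forall K, compact (K : set (R * R)) -> K `<=` D ->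
     exists M, forall n z, K z -> `|fn n z| <= M) ->
  continuous psi -> supported D psi ->
  L (fn n) psi @[n --> \oo] --> L f psi.
Proof.
move=> oD mfn mf cvg dom cpsi [K [cK KD K0]].
have mK := compact_plane_measurable cK.
have [M HM] := dom K cK KD.
have [m m0 Hm] := continuous_bounded_on cpsi cK.
have mpsi : measurable_fun K psi by exact: continuous_plane_measurable.
have E g : L g psi = \int[mu]_(z in K) (g z * psi z).
  by apply: (@Rintegral_supp _ K (fun z => g z * psi z)) => // z /K0 ->; rewrite mulr0.
rewrite E; under eq_fun do rewrite E.
have mD := open_plane_measurable oD.
have [] := @dominated_convergence _ _ _ mu K mK
  (fun n z => (fn n z * psi z)%:E) (fun z => (f z * psi z)%:E) (fun=> (M * m)%:E).
- by move=> n; apply/measurable_EFinP/measurable_funM => //; exact: measurable_funS (mfn n).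
- by apply/measurable_EFinP/measurable_funM => //; exact: measurable_funS mf.
- apply: ae_mono cvg => z H Kz.
  apply: cvg_EFin; first exact: nearW.
  exact: (cvgM (H (KD _ Kz)) (cvg_cst (psi z))).
- by apply: integrable_cst_fin => //; exact: compact_mu_fin.
- apply: aeW => z n Kz; rewrite lee_fin normrM; apply: ler_pM => //; [exact: HM|exact: Hm].
move=> H1 _ H; apply: fine_cvg.
have -> : (fine (\int[mu]_(z in K) (f z * psi z)%:E))%:E = (\int[mu]_(z in K) (f z * psi z)%:E)%E.
  by rewrite fineK//; exact: integrable_fin_num.
exact: H.
Qed.

End calculus.

(** * The reflection kernel *)

Section kernel.
Variable R : realType.
Local Notation plane := (measurableTypeR R * measurableTypeR R)%type.
Local Notation mu := (lebesgue2 R).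
Implicit Types (D U K : set plane) (f g u psi : R * R -> R) (z w p q : R * R)
  (M C e m r s rho : R).

Definition crd (i : 'I_2) z : R := if i == ord0 then z.1 else z.2.
Definition esq z : R := z.1 ^+ 2 + z.2 ^+ 2.

Lemma smooth_crd i : Cinf (crd i).
Proof. by elim/I2P: i; [exact: smooth_fst|exact: smooth_snd]. Qed.

Lemma smooth_sqr f : Cinf f -> Cinf (fun z => f z ^+ 2).
Proof.
move=> sf; have -> : (fun z => f z ^+ 2) = fun z => f z * f z.
  by apply/funext => z; rewrite expr2.
exact: smooth_mul.
Qed.

Lemma smooth_esq : Cinf esq.
Proof. by apply: smooth_add; apply: smooth_sqr; [exact: smooth_fst|exact: smooth_snd]. Qed.

Lemma esq_ge0 z : 0 <= esq z. Proof. by rewrite addr_ge0 ?sqr_ge0. Qed.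

Lemma esqZ a z : esq (a *: z) = a ^+ 2 * esq z.
Proof. by rewrite /esq/= /GRing.scale/= !exprMn mulrDr. Qed.

Lemma esqN z : esq (- z) = esq z.
Proof. by rewrite /esq/= !sqrrN. Qed.

Lemma norm_esq z : `|z| ^+ 2 <= esq z.
Proof.
rewrite prod_normE/= /esq; case: (leP `|z.1| `|z.2|) => _;
  by rewrite real_normK ?num_real// ?lerDl ?lerDr sqr_ge0.
Qed.

Lemma esq_norm z : esq z <= 2 * `|z| ^+ 2.
Proof.
have h1 : `|z.1| <= `|z| by rewrite [leRHS]prod_normE le_max lexx.
have h2 : `|z.2| <= `|z| by rewrite [leRHS]prod_normE le_max lexx orbT.
rewrite /esq -(real_normK (num_real z.1)) -(real_normK (num_real z.2)) mulr_natl mulr2n.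
by apply: lerD; rewrite ler_sqr ?nnegrE.
Qed.

(** Never zero, as one of the two terms is positive at each point; the quotient [eta1] is thus a
    smooth cutoff, 1 for |z| <= 1 and 0 for |z| >= 2 in the Euclidean norm. *)
Definition eta_den z : R := flat 0 (4 - esq z) + flat 0 (esq z - 1).
Definition eta1 z : R := flat 0 (4 - esq z) * (eta_den z)^-1.

Lemma eta_den_gt0 z : 0 < eta_den z.
Proof.
rewrite /eta_den; have [h|h] := ltP (esq z) 4.
  by rewrite ltr_pwDl ?flat_ge0// flat_gt0// subr_gt0.
by rewrite ltr_wpDl ?flat_ge0// flat_gt0//; lra.
Qed.

Lemma smooth_eta1 : Cinf eta1.
Proof.
have s4 : Cinf (fun z => 4 - esq z) := smooth_sub (smooth_cst 4) smooth_esq.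
have s1 : Cinf (fun z => esq z - 1) := smooth_sub smooth_esq (smooth_cst 1).
apply: smooth_mul; first exact: smooth_flat.
apply: smooth_inv; first by move=> z; rewrite gt_eqF// eta_den_gt0.
by apply: smooth_add; exact: smooth_flat.
Qed.

Lemma eta1_ge0 z : 0 <= eta1 z.
Proof. by rewrite mulr_ge0 ?flat_ge0// invr_ge0 ltW// eta_den_gt0. Qed.

Lemma eta1_le1 z : eta1 z <= 1.
Proof.
by rewrite /eta1 ler_pdivrMr ?eta_den_gt0// mul1r /eta_den lerDl flat_ge0.
Qed.

Lemma eta1_1 z : esq z <= 1 -> eta1 z = 1.
Proof.
move=> h; have := eta_den_gt0 z; rewrite /eta1 /eta_den (@flat_le0 _ 0 (esq z - 1)) ?addr0; last by lra.
by move=> p; rewrite mulfV// gt_eqF.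
Qed.

Lemma eta1_0 z : 4 <= esq z -> eta1 z = 0.
Proof. by move=> h; rewrite /eta1 flat_le0 ?mul0r//; lra. Qed.

(** 1/|z|^2 made smooth by altering it in the unit disc, where the factor [1 - eta1] of [Rf]
    vanishes anyway. *)
Definition invsq z : R := (esq z + flat 0 (1 - esq z))^-1.

Lemma invsq_den_gt0 z : 0 < esq z + flat 0 (1 - esq z).
Proof.
have [h|h] := ltP (esq z) 1.
  by rewrite ltr_wpDl ?esq_ge0// flat_gt0// subr_gt0.
by rewrite ltr_pwDl ?flat_ge0//; lra.
Qed.

Lemma smooth_invsq : Cinf invsq.
Proof.
apply: smooth_inv; first by move=> z; rewrite gt_eqF// invsq_den_gt0.
apply: smooth_add; first exact: smooth_esq.
by apply: smooth_flat; apply: smooth_sub; [exact: smooth_cst|exact: smooth_esq].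
Qed.

Lemma invsqE z : 1 <= esq z -> invsq z = (esq z)^-1.
Proof. by move=> h; rewrite /invsq flat_le0 ?addr0//; lra. Qed.

(* The reflection [2 x x^T / |x|^2 - I], extended by junk at the origin. *)
Definition refl z : 'M[R]_2 :=
  \matrix_(i, j) ((2 * crd i z * crd j z - (i == j)%:R * esq z) * (esq z)^-1).

Lemma opb_refl z : opb 1 (refl z).
Proof.
move=> u1 u2 v1 v2; rewrite !mxE /crd/= mul1r.
have [->|t0] := eqVneq (esq z) 0.
  by rewrite invr0 !mulr0 !mul0r !addr0 !mulr0 !addr0 mulr0 !addr_ge0// sqr_ge0.
have tp : 0 < esq z by rewrite lt_neqAle eq_sym t0 esq_ge0.
rewrite -(ler_pM2r tp).
have -> : forall a b c d : R,
  2 * (u1 * (a * (esq z)^-1 * v1 + b * (esq z)^-1 * v2) +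
       u2 * (c * (esq z)^-1 * v1 + d * (esq z)^-1 * v2)) * esq z =
  2 * (u1 * (a * v1 + b * v2) + u2 * (c * v1 + d * v2)).
  by move=> a b c d; field.
rewrite /esq.
(* In the frame of [z] and its rotation the reflection fixes one component and negates the other;
   the slack is the sum of these two squares. *)
have h1 := sqr_ge0 ((u1 - v1) * z.1 + (u2 - v2) * z.2).
have h2 := sqr_ge0 ((u1 + v1) * z.2 - (u2 + v2) * z.1).
lra.
Qed.

Lemma reflZ a z : a != 0 -> refl (a *: z) = refl z.
Proof.
move=> a0; apply/matrixP => i j; rewrite !mxE esqZ.
have Ek k : crd k (a *: z) = a * crd k z by rewrite /crd; case: ifP.
rewrite !Ek.
have [->|t0] := eqVneq (esq z) 0; first by rewrite mulr0 invr0 !mulr0.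
by field; rewrite t0 a0.
Qed.

Lemma reflN z : refl (- z) = refl z.
Proof. by rewrite -scaleN1r reflZ// oppr_eq0 oner_neq0. Qed.

Definition Rf z : 'M[R]_2 := (1 - eta1 z) *: refl z.

Lemma RfE z i j : Rf z i j = (1 - eta1 z) * invsq z *
   (2 * crd i z * crd j z - (i == j)%:R * esq z).
Proof.
rewrite !mxE; have [h|h] := leP (esq z) 1; first by rewrite eta1_1// subrr !mul0r.
by rewrite invsqE; [ring|exact: ltW].
Qed.

Lemma smoothF_Rf : smoothF Rf.
Proof.
move=> i j; have -> : (fun z => Rf z i j) = (fun z => (1 - eta1 z) * invsq z *
   (2 * crd i z * crd j z - (i == j)%:R * esq z)).
  by apply/funext => z; rewrite RfE.
apply: smooth_mul.
  by apply: smooth_mul; [exact: smooth_sub (smooth_cst 1) smooth_eta1|exact: smooth_invsq].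
apply: smooth_sub; last exact/smooth_scale/smooth_esq.
by apply: smooth_mul; [apply: smooth_scale|]; exact: smooth_crd.
Qed.

Lemma is_derive_crd k i z :
  is_derive z (basis_vector R i) (crd k) (i == k)%:R.
Proof.
elim/I2P: k.
  by have := is_derive_fst z i.
by have := is_derive_snd z i; elim/I2P: i.
Qed.

Lemma is_derive_esq i z : is_derive z (basis_vector R i) esq (2 * crd i z).
Proof.
have := is_derive_add (is_derive_mul (is_derive_fst z i) (is_derive_fst z i))
   (is_derive_mul (is_derive_snd z i) (is_derive_snd z i)).
have -> : (fun w : R * R => w.1 * w.1 + w.2 * w.2) = esq.
  by apply/funext => w; rewrite /esq !expr2.
move/is_derive_eq; apply.
by rewrite /crd; elim/I2P: i => /=; ring.
Qed.

Lemma open_esq_gt (c : R) : open [set z | c < esq z].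
Proof.
have -> : [set z | c < esq z] = esq @^-1` [set t | c < t] by [].
apply: open_comp; first by move=> z _; exact: smooth_continuous smooth_esq z.
exact: open_gt.
Qed.

Lemma pder_near f g i z d : (\forall w \near z, f w = g w) ->
  is_derive z (basis_vector R i) g d -> pder i f z = d.
Proof.
move=> nfg dg; rewrite pderE /partial; apply: derive_val.
apply: (@near_eq_is_derive _ _ _ g f) dg.
by apply: filterS nfg => w ->.
Qed.

Lemma pder_refl z i j k : 4 < esq z -> pder k (fun w => Rf w i j) z =
  (2 * (k == i)%:R * crd j z + 2 * (k == j)%:R * crd i z) / esq z -
  4 * crd i z * crd j z * crd k z / esq z ^+ 2.
Proof.
move=> z4; have z0 : esq z != 0 by rewrite gt_eqF//; lra.
have nz : \forall w \near z, Rf w i j =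
    2 * crd i w * crd j w * (esq w)^-1 - (i == j)%:R.
  have : \forall w \near z, 4 < esq w.
    by apply: open_nbhs_nbhs; split=> //; exact: open_esq_gt.
  apply: filterS => w w4; rewrite RfE eta1_0 ?ltW// subr0 mul1r invsqE; last by lra.
  by field; rewrite gt_eqF//; lra.
apply: (pder_near nz).
have := is_derive_add (is_derive_mul (is_derive_mul (is_derive_mul
  (is_derive_cst (2:R) z (basis_vector R k)) (is_derive_crd i k z)) (is_derive_crd j k z))
  (is_derive_inv z0 (is_derive_esq k z))) (is_derive_cst (- (i == j)%:R : R) z (basis_vector R k)).
move/is_derive_eq; apply.
rewrite /cst; field; exact: z0.
Qed.

Lemma div2E F z : smoothF F -> div2 F z =
  pder ord0 (fun z => pder ord0 (fun w => F w ord0 ord0) z + pder o1 (fun w => F w ord0 o1) z) z +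
  pder o1 (fun z => pder ord0 (fun w => F w o1 ord0) z + pder o1 (fun w => F w o1 o1) z) z.
Proof.
move=> HF; rewrite /div2 !sum2.
by rewrite !partial_add//; exact/smooth_partial/HF.
Qed.

(** The first divergence of the reflection is 2x/|x|^2, the gradient of log |x|^2, which is harmonic
    off the origin. *)
Lemma div2_Rf_out z : 4 < esq z -> div2 Rf z = 0.
Proof.
move=> z4; have z0 : esq z != 0 by rewrite gt_eqF//; lra.
have nz i : \forall w \near z,
    pder ord0 (fun w => Rf w i ord0) w + pder o1 (fun w => Rf w i o1) w =
    2 * crd i w * (esq w)^-1.
  have : \forall w \near z, 4 < esq w.
    by apply: open_nbhs_nbhs; split=> //; exact: open_esq_gt.
  apply: filterS => w w4; rewrite !pder_refl//.
  have w0 : esq w != 0 by rewrite gt_eqF//; lra.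
  have E : esq w = crd ord0 w ^+ 2 + crd o1 w ^+ 2 by [].
  elim/I2P: i => /=; move: w0; rewrite E; move: (crd ord0 w) (crd o1 w) => x y w0; by field.
have dz i : is_derive z (basis_vector R i) (fun w => 2 * crd i w * (esq w)^-1)
    (2 / esq z - 4 * crd i z ^+ 2 / esq z ^+ 2).
  have := is_derive_mul (is_derive_mul (is_derive_cst (2:R) z (basis_vector R i)) (is_derive_crd i i z))
    (is_derive_inv z0 (is_derive_esq i z)).
  rewrite /cst => H; apply: (is_derive_eq H); rewrite eqxx/=; field; exact: z0.
rewrite (div2E _ smoothF_Rf) (pder_near (nz ord0) (dz ord0)) (pder_near (nz o1) (dz o1)).
have E : esq z = crd ord0 z ^+ 2 + crd o1 z ^+ 2 by [].
by move: z0; rewrite E; move: (crd ord0 z) (crd o1 z) => x y z0; field.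
Qed.

Lemma smoothF_affine F (a : R) (b : R * R) : smoothF F -> smoothF (fun z => F (a *: z + b)).
Proof. by move=> HF i j; apply: (smooth_affine a b (HF i j)). Qed.

Lemma div2_affine F (a : R) (b : R * R) : smoothF F ->
  div2 (fun z => F (a *: z + b)) = fun z => a ^+ 2 * div2 F (a *: z + b).
Proof.
move=> HF; apply/funext => z; rewrite /div2 mulr_sumr; apply: eq_bigr => i _.
rewrite mulr_sumr; apply: eq_bigr => j _.
rewrite (partial_affine j a b (HF i j)).
rewrite (partial_scale i a); last exact: (smooth_affine a b (smooth_partial j (HF i j))).
by rewrite (partial_affine i a b (smooth_partial j (HF i j))) mulrA expr2.
Qed.

Definition Rs s z := Rf (s^-1 *: z).
(** The reflection is homogeneous of degree 0, so rescaling moves only the excision; hence [kap s]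
    is [s ^- 2] times a dilation of one fixed kernel of compact support. *)
Definition kap s : R * R -> R := div2 (Rs s).

Lemma smoothF_Rs s : smoothF (Rs s).
Proof.
move=> i j; have := smoothF_affine s^-1 0 smoothF_Rf i j.
by congr Cinf; apply/funext => z; rewrite /Rs addr0.
Qed.

Lemma kapE s z : kap s z = s ^- 2 * div2 Rf (s^-1 *: z).
Proof.
rewrite /kap (_ : Rs s = fun z => Rf (s^-1 *: z + 0)); last first.
  by apply/funext => w; rewrite addr0.
by rewrite (div2_affine _ _ smoothF_Rf) addr0 exprVn.
Qed.

Lemma smooth_kap s : Cinf (kap s).
Proof. exact/smooth_div2/smoothF_Rs. Qed.

Lemma norm_gt_esq s z : 0 < s -> 2 * s < `|z| -> 4 < esq (s^-1 *: z).
Proof.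
move=> s0 h; rewrite esqZ; apply: (@lt_le_trans _ _ (s^-1 ^+ 2 * `|z| ^+ 2)).
  rewrite -exprMn mulrC (_ : 4 = 2 ^+ 2); last by ring.
  by rewrite ltr_sqr ?nnegrE//; [rewrite ltr_pdivlMr|rewrite divr_ge0// ltW].
by rewrite ler_wpM2l ?sqr_ge0 ?norm_esq.
Qed.

Lemma kap_out s z : 0 < s -> 2 * s < `|z| -> kap s z = 0.
Proof. by move=> s0 h; rewrite kapE div2_Rf_out ?mulr0// norm_gt_esq. Qed.

Lemma supported_out_norm f r : (forall z, r < `|z| -> f z = 0) -> supported setT f.
Proof.
move=> H; exists (cball 0 r); split=> //; first exact: cball_compact.
by move=> z /negP; rewrite -ltNge sub0r normrN; exact: H.
Qed.

Lemma kap_bound : exists2 C, 0 < C & forall s z, 0 < s -> `|kap s z| <= C / s ^+ 2.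
Proof.
have out z : 2 < `|z| -> div2 Rf z = 0.
  move=> h; apply: div2_Rf_out.
  by have := @norm_gt_esq 1 z ltr01; rewrite mulr1 invr1 scale1r; exact.
have [C C0 HC] := bounded_deriv (smooth_div2 smoothF_Rf) (supported_out_norm out).
exists C => // s z s0.
have s20 : 0 <= s ^- 2 by rewrite invr_ge0 exprn_ge0// ltW.
by rewrite kapE normrM ger0_norm// mulrC ler_wpM2r.
Qed.

Lemma refl_scale s z : 0 < s -> Rs s z = (1 - eta1 (s^-1 *: z)) *: refl z.
Proof. by move=> s0; rewrite /Rs /Rf reflZ// invr_eq0 gt_eqF. Qed.

Lemma RsB s s' z : 0 < s -> 0 < s' ->
  Rs s z - Rs s' z = (eta1 (s'^-1 *: z) - eta1 (s^-1 *: z)) *: refl z.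
Proof. by move=> s0 s'0; rewrite !refl_scale// -scalerBl; congr (_ *: _); move: (eta1 _) (eta1 _) => a b; ring. Qed.

Lemma unit_sub (a b : R) : 0 <= a -> a <= 1 -> 0 <= b -> b <= 1 -> `|a - b| <= 1.
Proof. by rewrite ler_norml => a0 a1 b0 b1; apply/andP; split; lra. Qed.

Lemma opb_RsB s s' z : 0 < s -> 0 < s' -> opb 1 (Rs s z - Rs s' z).
Proof.
move=> s0 s'0; rewrite RsB//.
apply: (opb_le _ (opb_norm _ (opb_refl z))); rewrite mulr1.
by apply: unit_sub; rewrite ?eta1_ge0 ?eta1_le1.
Qed.

Lemma eta1_out s z : 0 < s -> 2 * s < `|z| -> eta1 (s^-1 *: z) = 0.
Proof. by move=> s0 h; apply: eta1_0; apply/ltW/norm_gt_esq. Qed.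

Lemma eta1_in s z : 0 < s -> `|z| <= s / 2 -> eta1 (s^-1 *: z) = 1.
Proof.
move=> s0 h; apply: eta1_1; rewrite esqZ.
apply: (@le_trans _ _ (s^-1 ^+ 2 * (2 * (s / 2) ^+ 2))).
  apply: ler_wpM2l; first exact: sqr_ge0.
  apply: (le_trans (esq_norm z)); rewrite ler_wpM2l// ler_sqr ?nnegrE//.
  by rewrite divr_ge0// ltW.
have -> : s^-1 ^+ 2 * (2 * (s / 2) ^+ 2) = 2^-1 by field; rewrite gt_eqF.
lra.
Qed.

Lemma RsB_out s s' z : 0 < s <= s' -> 2 * s' < `|z| -> Rs s z - Rs s' z = 0.
Proof.
move=> /andP[s0 ss] h; have s'0 := lt_le_trans s0 ss.
rewrite RsB// !eta1_out ?subrr ?scale0r//.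
by apply: le_lt_trans h; rewrite ler_pM2l.
Qed.

Lemma RsB_in s s' z : 0 < s <= s' -> `|z| <= s / 2 -> Rs s z - Rs s' z = 0.
Proof.
move=> /andP[s0 ss] h; have s'0 := lt_le_trans s0 ss.
rewrite RsB// !eta1_in ?subrr ?scale0r//.
by apply: (le_trans h); rewrite ler_pM2r ?invr_gt0.
Qed.

Definition shiftF (F : R * R -> 'M[R]_2) p : R * R -> 'M[R]_2 := fun z => F (z - p).

Lemma shiftF_affine F p : shiftF F p = fun z => F (1 *: z + - p).
Proof. by apply/funext => z; rewrite scale1r. Qed.

Lemma smoothF_shiftF F p : smoothF F -> smoothF (shiftF F p).
Proof. by rewrite shiftF_affine; exact: smoothF_affine. Qed.

Lemma div2_shiftF F p : smoothF F -> div2 (shiftF F p) = shiftf (div2 F) p.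
Proof.
move=> HF; rewrite shiftF_affine div2_affine// shiftf_affine.
by apply/funext => z; rewrite expr1n mul1r.
Qed.

Lemma field_out D F p r : smoothF F -> (forall z, r < `|z - p| -> F z = 0) ->
  cball p r `<=` D -> field D F.
Proof.
move=> sF F0 rD i j; split; first exact: sF.
exists (cball p r); split=> //; first exact: cball_compact.
by move=> z /negP; rewrite -ltNge distrC => /F0 ->; rewrite mxE.
Qed.

Lemma smoothFB F G : smoothF F -> smoothF G -> smoothF (fun z => F z - G z).
Proof.
move=> HF HG i j; have := smooth_sub (HF i j) (HG i j).
by congr Cinf; apply/funext => z; rewrite !mxE.
Qed.

Lemma div2B F G : smoothF F -> smoothF G ->
  div2 (fun z => F z - G z) = fun z => div2 F z - div2 G z.
Proof.
move=> HF HG; have -> : (fun z => F z - G z) = fun z => F z + (-1) *: G z.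
  by apply/funext => z; rewrite scaleN1r.
rewrite div2D//; last first.
  move=> i j; have := smooth_scale (-1) (HG i j).
  by congr Cinf; apply/funext => z; rewrite !mxE.
by rewrite div2Z//; apply/funext => z; rewrite mulN1r.
Qed.

(** A multiple of the reflection about [p] by a difference of two cutoffs, which lies in [-1, 1]; it
    lives on an annulus and turns a bound on the variation into a comparison of two kernels. *)
Definition ring_field p s s' := shiftF (fun z => Rs s z - Rs s' z) p.

Lemma ring_field_field D p s s' : 0 < s <= s' -> cball p (2 * s') `<=` D ->
  field D (ring_field p s s').
Proof.
move=> ss; apply: (@field_out _ _ p (2 * s')).
  by apply/smoothF_shiftF/smoothFB; exact: smoothF_Rs.
by move=> z; exact: RsB_out.
Qed.

Lemma opb_ring_field p s s' z : 0 < s <= s' -> opb 1 (ring_field p s s' z).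
Proof. by move=> /andP[s0 ss]; apply: opb_RsB => //; exact: lt_le_trans ss. Qed.

Lemma div2_ring_field p s s' :
  div2 (ring_field p s s') = fun z => shiftf (kap s) p z - shiftf (kap s') p z.
Proof.
rewrite /ring_field div2_shiftF; last by apply: smoothFB; exact: smoothF_Rs.
by rewrite div2B//; exact: smoothF_Rs.
Qed.

Lemma kap_supported s p D : 0 < s -> cball p (2 * s) `<=` D ->
  supported D (shiftf (kap s) p).
Proof. by move=> s0; apply: supported_shiftf => z; exact: kap_out. Qed.

Lemma continuous_kap s p : continuous (shiftf (kap s) p).
Proof. exact/smooth_continuous/smooth_shiftf/smooth_kap. Qed.

Definition Kc : R := \int[mu]_z kap 1 z.

Lemma shiftf0 psi : shiftf psi 0 = psi.
Proof. by apply/funext => z; rewrite /shiftf subr0. Qed.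

(** Two scales differ by the divergence of a compactly supported ring field, whose integral is 0. *)
Lemma int_kap0 s : 0 < s -> \int[mu]_z kap s z = Kc.
Proof.
have key s1 s2 : 0 < s1 <= s2 -> \int[mu]_z kap s1 z = \int[mu]_z kap s2 z.
  move=> ss; have /andP[s10 ss'] := ss; have s20 := lt_le_trans s10 ss'.
  have H := int_div2 (@ring_field_field setT 0 s1 s2 ss (fun _ _ => I)).
  rewrite div2_ring_field !shiftf0 in H.
  have i1 : mu.-integrable setT (EFin \o kap s1).
    apply: integrable_cc; first exact/smooth_continuous/smooth_kap.
    by apply: (@supported_out_norm _ (2 * s1)) => z; exact: kap_out.
  have i2 : mu.-integrable setT (EFin \o kap s2).
    apply: integrable_cc; first exact/smooth_continuous/smooth_kap.
    by apply: (@supported_out_norm _ (2 * s2)) => z; exact: kap_out.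
  by apply/eqP; rewrite -subr_eq0 -RintegralB// H.
by move=> s0; have [h|h] := leP s 1; [apply: key|apply/esym/key]; rewrite ?s0 ?ltr01//= ltW.
Qed.

(** The mass does not depend on the centre: its derivative in [p] is the integral of a derivative
    with compact support. *)
Lemma int_kap s p : 0 < s -> \int[mu]_z shiftf (kap s) p z = Kc.
Proof.
move=> s0; pose phi q := L (cst 1) (shiftf (kap s) q).
have l1 : L1loc setT (cst 1 : R * R -> R).
  apply: L1loc_continuous; first exact: openT.
  by apply: continuous_subspaceT => z; exact: cvg_cst.
have dphi i q : is_derive q (basis_vector R i) phi (cst 0 q).
  have := @is_derive_conv R setT (cst 1) (kap s) i q 1 (2 * s) l1 (smooth_kap s).
  move=> /(_ (fun z => kap_out s0)) H.
  have := H (mulr_ge0 (ler0n _ 2) (ltW s0)) (fun _ _ => I) q.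
  rewrite subrr normr0 => /(_ ltr01) dq; apply: (is_derive_eq dq).
  rewrite L1E -pder_shiftf; last exact: smooth_kap.
  have sk := smooth_shiftf q (smooth_kap s).
  rewrite (int_derive0 (fun z => C1_is_derive i z (smooth_C1 sk))) ?oppr0//.
    exact/smooth_continuous/smooth_partial.
  exact: kap_supported.
have [c _ E0] := MVT_line (0 : R * R) p.1 (dphi ord0).
have [d _ E1] := MVT_line (p.1 *: basis_vector R ord0 + 0) p.2 (dphi o1).
move: E0 E1; rewrite /cst !mulr0 => /eqP; rewrite subr_eq0 => /eqP E0.
move=> /eqP; rewrite subr_eq0 E0 => /eqP.
have -> : p.2 *: basis_vector R o1 + (p.1 *: basis_vector R ord0 + 0) = p.
  rewrite /basis_vector/= addr0 [in RHS](surjective_pairing p); congr (_, _) => /=.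
    by rewrite scaler0 add0r [_ *: _]mulr1.
  by rewrite scaler0 addr0 [_ *: _]mulr1.
by rewrite /phi !L1E shiftf0 => ->; exact: int_kap0.
Qed.

(** Evenness allows centre and variable to be exchanged, so that averaging with [kap s] is
    self-adjoint. *)
Lemma kap_even s z : kap s (- z) = kap s z.
Proof.
have E : Rs s = fun z => Rs s ((-1) *: z + 0).
  apply/funext => w; rewrite addr0 scaleN1r /Rs scalerN /Rf reflN.
  by congr ((1 - _) *: _); rewrite /eta1 /eta_den esqN.
by rewrite {2}/kap E (div2_affine _ _ (smoothF_Rs s)) addr0 scaleN1r sqrrN expr1n mul1r.
Qed.

Lemma kap_lim D f p e : open (D : set (R * R)) -> D p -> L1loc D f ->
  {for p, continuous f} -> 0 < e ->
  exists2 s0, 0 < s0 & forall s, 0 < s < s0 ->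
    `|L f (shiftf (kap s) p) - f p * Kc| <= e.
Proof.
move=> oD Dp lf cf e0; have [C C0 HC] := kap_bound.
have [s0 s00 H] := approx_id oD Dp lf cf C0 e0.
exists s0 => // s ss; have /andP[s1 _] := ss.
rewrite -(@int_kap s p)//; apply: (H s _ ss (@continuous_kap s p)).
  by move=> z; exact: kap_out.
by move=> z; exact: HC.
Qed.

(** * Cutting fields around a point *)

Definition cut s p z : R := eta1 (s^-1 *: (z - p)).

Lemma cutE s p : cut s p = fun z => eta1 (s^-1 *: z + s^-1 *: - p).
Proof. by apply/funext => z; rewrite /cut scalerDr. Qed.

Lemma smooth_cut s p : Cinf (cut s p).
Proof. by rewrite cutE; apply: smooth_affine; exact: smooth_eta1. Qed.

Lemma cut_ge0 s p z : 0 <= cut s p z. Proof. exact: eta1_ge0. Qed.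
Lemma cut_le1 s p z : cut s p z <= 1. Proof. exact: eta1_le1. Qed.
Lemma cut_out s p z : 0 < s -> 2 * s < `|z - p| -> cut s p z = 0.
Proof. exact: eta1_out. Qed.
Lemma cut_in s p z : 0 < s -> `|z - p| <= s / 2 -> cut s p z = 1.
Proof. exact: eta1_in. Qed.

Lemma eta1_out2 z : 2 < `|z| -> eta1 z = 0.
Proof. by have := @eta1_out 1 z ltr01; rewrite invr1 scale1r mulr1. Qed.

Lemma abs_mul3 (c c' m1 m2 x y : R) : 0 <= c -> c <= c' -> `|x| <= m1 -> `|y| <= m2 ->
  `|c * x * y| <= c' * (m1 * m2).
Proof.
move=> c0 cc hx hy; rewrite !normrM (ger0_norm c0) -mulrA.
by apply: ler_pM => //; apply: ler_pM.
Qed.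

(** Leibniz: each derivative falling on the cutoff costs a factor [s^-1], at most two of them do,
    and for [s <= 1] this worst rate covers all terms. *)
Lemma cut_mul_bound g p : Cinf g -> exists2 C, 0 < C &
  forall s z i j, 0 < s <= 1 ->
    `|pder i (pder j (fun w => cut s p w * g w)) z| <= C / s ^+ 2.
Proof.
move=> sg.
have s1 := smooth_eta1; have o0 := eta1_out2.
have bd phi : Cinf phi -> (forall z, 2 < `|z| -> phi z = 0) ->
    exists2 C, 0 < C & forall z, `|phi z| <= C.
  by move=> sp op; apply: bounded_deriv => //; exact: supported_out_norm op.
have [m m0 Hm] : exists2 m, 0 < m & [/\ forall z, `|eta1 z| <= m,
    forall i z, `|pder i eta1 z| <= m & forall i j z, `|pder i (pder j eta1) z| <= m].
  have o1' i := pder_out i o0.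
  have o2' i j := pder_out i (o1' j).
  have [a a0 Ha] := bd _ s1 o0.
  have [b b0 Hb] := bd _ (smooth_partial ord0 s1) (o1' ord0).
  have [c c0 Hc] := bd _ (smooth_partial o1 s1) (o1' o1).
  have [d d0 Hd] := bd _ (smooth_partial ord0 (smooth_partial ord0 s1)) (o2' ord0 ord0).
  have [k k0 Hk] := bd _ (smooth_partial ord0 (smooth_partial o1 s1)) (o2' ord0 o1).
  have [l l0 Hl] := bd _ (smooth_partial o1 (smooth_partial ord0 s1)) (o2' o1 ord0).
  have [n n0 Hn] := bd _ (smooth_partial o1 (smooth_partial o1 s1)) (o2' o1 o1).
  exists (a + b + c + d + k + l + n); first by rewrite !addr_gt0.
  split=> [z|i z|i j z].
  - by apply: (le_trans (Ha z)); lra.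
  - elim/I2P: i; [apply: (le_trans (Hb z))|apply: (le_trans (Hc z))]; lra.
  - elim/I2P: i; elim/I2P: j;
      [apply: (le_trans (Hd z))|apply: (le_trans (Hk z))|
       apply: (le_trans (Hl z))|apply: (le_trans (Hn z))]; lra.
have [G G0 HG] : exists2 G, 0 < G & forall z, cball p 2 z -> [/\ `|g z| <= G,
    forall i, `|pder i g z| <= G & forall i j, `|pder i (pder j g) z| <= G].
  have cb phi : Cinf phi -> exists2 C, 0 < C & forall z, cball p 2 z -> `|phi z| <= C.
    by move=> sp; apply: continuous_bounded_on; [exact: smooth_continuous|exact: cball_compact].
  have [a a0 Ha] := cb _ sg.
  have [b b0 Hb] := cb _ (smooth_partial ord0 sg).
  have [c c0 Hc] := cb _ (smooth_partial o1 sg).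
  have [d d0 Hd] := cb _ (smooth_partial ord0 (smooth_partial ord0 sg)).
  have [k k0 Hk] := cb _ (smooth_partial ord0 (smooth_partial o1 sg)).
  have [l l0 Hl] := cb _ (smooth_partial o1 (smooth_partial ord0 sg)).
  have [n n0 Hn] := cb _ (smooth_partial o1 (smooth_partial o1 sg)).
  exists (a + b + c + d + k + l + n); first by rewrite !addr_gt0.
  move=> z Kz; split=> [|i|i j].
  - by apply: (le_trans (Ha z Kz)); lra.
  - elim/I2P: i; [apply: (le_trans (Hb z Kz))|apply: (le_trans (Hc z Kz))]; lra.
  - elim/I2P: i; elim/I2P: j;
      [apply: (le_trans (Hd z Kz))|apply: (le_trans (Hk z Kz))|
       apply: (le_trans (Hl z Kz))|apply: (le_trans (Hn z Kz))]; lra.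
(* Four Leibniz terms, each at most [m * G / s ^+ 2]. *)
exists (4 * m * G); first by rewrite !mulr_gt0.
move=> s z i j /andP[s0 sle1].
have scut := smooth_cut s p.
have [Kz|nK] := pselect (cball p 2 z); last first.
  have -> : pder i (pder j (fun w => cut s p w * g w)) z = 0.
    apply: (@partial_off _ (cball p 2)) => //.
    - by apply: compact_closed2; exact: cball_compact.
    - move=> w nw; apply: (@partial_off _ (cball p 2)) => //.
      + by apply: compact_closed2; exact: cball_compact.
      + move=> y /negP; rewrite -ltNge distrC => hy; rewrite cut_out ?mul0r//.
        by apply: le_lt_trans hy; lra.
  by rewrite normr0 divr_ge0// ?exprn_ge0 ?mulr_ge0 ?ltW// ltW.
have [g0 g1 g2] := HG z Kz; have [h0 h1 h2] := Hm.
pose v := s^-1 *: z + s^-1 *: - p.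
have E : pder i (pder j (fun w => cut s p w * g w)) z =
    s^-1 * s^-1 * pder i (pder j eta1) v * g z + s^-1 * pder j eta1 v * pder i g z +
    s^-1 * pder i eta1 v * pder j g z + eta1 v * pder i (pder j g) z.
  rewrite partial_mul// cutE.
  have se1 k : Cinf (fun z => pder k eta1 (s^-1 *: z + s^-1 *: - p)).
    by apply: (smooth_affine _ _ (smooth_partial k s1)).
  have se0 : Cinf (fun z => eta1 (s^-1 *: z + s^-1 *: - p)) by apply: smooth_affine.
  rewrite (partial_affine j _ _ s1).
  rewrite partial_add; last 2 first.
  - by apply: smooth_mul => //; exact: smooth_scale.
  - by apply: smooth_mul => //; exact: smooth_partial.
  rewrite (partial_mul i (smooth_scale s^-1 (se1 j)) sg).
  rewrite (partial_mul i se0 (smooth_partial j sg)).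
  rewrite (partial_scale i _ (se1 j)) (partial_affine i _ _ s1).
  rewrite (partial_affine i _ _ (smooth_partial j s1)) -/v; ring.
have s1' : 1 <= s^-1 by rewrite invf_ge1.
have si0 : 0 <= s^-1 by exact: le_trans s1'.
rewrite E.
have ss1 : s^-1 <= s^-1 * s^-1 by rewrite ler_peMr.
have a1 := abs_mul3 (mulr_ge0 si0 si0) (lexx _) (h2 i j v) g0.
have a2 := abs_mul3 si0 ss1 (h1 j v) (g1 i).
have a3 := abs_mul3 si0 ss1 (h1 i v) (g1 j).
have a4 := abs_mul3 ler01 (le_trans s1' ss1) (h0 v) (g2 i j).
rewrite mul1r in a4.
have -> : 4 * m * G / s ^+ 2 = s^-1 * s^-1 * (m * G) + s^-1 * s^-1 * (m * G) +
   s^-1 * s^-1 * (m * G) + s^-1 * s^-1 * (m * G) by rewrite expr2 invfM; ring.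
apply: (le_trans (ler_normD _ _)); apply: lerD => //.
apply: (le_trans (ler_normD _ _)); apply: lerD => //.
by apply: (le_trans (ler_normD _ _)); apply: lerD.
Qed.

(** The divergence of the cut-off field has size [s ^- 2], support of radius [2 * s] and integral 0,
    so where [f] is continuous its pairing tends to [f p * 0]. A test field can therefore be removed
    near a point at no cost in the limit. *)
Lemma cut_field_lim D f p F e : open (D : set (R * R)) -> D p -> L1loc D f ->
  {for p, continuous f} -> smoothF F -> 0 < e ->
  exists2 s0, 0 < s0 & forall s, 0 < s < s0 ->
    `|L f (div2 (fun z => cut s p z *: F z))| <= e.
Proof.
move=> oD Dp lf cf sF e0.
have [C00 C000 H00] := cut_mul_bound p (sF ord0 ord0).
have [C01 C010 H01] := cut_mul_bound p (sF ord0 o1).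
have [C10 C100 H10] := cut_mul_bound p (sF o1 ord0).
have [C11 C110 H11] := cut_mul_bound p (sF o1 o1).
pose C := C00 + C01 + C10 + C11; have C0 : 0 < C by rewrite !addr_gt0.
have [s0 s00 H] := approx_id oD Dp lf cf C0 e0.
exists (Num.min s0 1); first by rewrite lt_min s00 ltr01.
move=> s /andP[s1]; rewrite lt_min => /andP[ss0 /ltW sle1].
pose G z := cut s p z *: F z.
have sG : smoothF G.
  move=> i j; have := smooth_mul (smooth_cut s p) (sF i j).
  by congr Cinf; apply/funext => z; rewrite mxE.
have fG : field setT G.
  apply: (@field_out _ _ p (2 * s) sG) => // z hz.
  by rewrite /G cut_out// scale0r.
have := H s (div2 G); rewrite s1 ss0 => /(_ isT).
rewrite int_div2// mulr0 subr0; apply.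
- exact/smooth_continuous/smooth_div2.
- move=> z hz; have := @supported_div2 R (cball p (2 * s)) G.
  move=> /(_ (@field_out _ _ p (2 * s) sG _ (fun _ h => h))) H'.
  apply: (supported_out (H' _)).
    by move=> w hw; rewrite /G cut_out// scale0r.
  by rewrite /cball/= distrC; apply/negP; rewrite -ltNge.
- move=> z; rewrite /div2 !sum2.
  have GE i j : (fun w => G w i j) = fun w => cut s p w * F w i j.
    by apply/funext => w; rewrite mxE.
  rewrite !GE.
  have -> : C / s ^+ 2 = (C00 / s ^+ 2 + C01 / s ^+ 2) + (C10 / s ^+ 2 + C11 / s ^+ 2).
    by rewrite /C; ring.
  have ss : 0 < s <= 1 by rewrite s1.
  apply: (le_trans (ler_normD _ _)).
  by apply: lerD; apply: (le_trans (ler_normD _ _)); apply: lerD; [exact: H00|exact: H01|exact: H10|exact: H11].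
Qed.

End kernel.

(** * Cones *)

Section cone.
Variable R : realType.
Local Notation plane := (measurableTypeR R * measurableTypeR R)%type.
Local Notation mu := (lebesgue2 R).
Implicit Types (D U K : set plane) (f g u psi : R * R -> R) (z w p q : R * R)
  (M C e m r s rho a : R).

Definition contr (ddu : 'I_2 -> 'I_2 -> R * R -> R) (F : R * R -> 'M[R]_2) z : R :=
  \sum_(i < 2) \sum_(j < 2) ddu i j z * F z i j.

Lemma integrable_contr U u du ddu F : open (U : set (R * R)) -> C2on U u du ddu ->
  field U F -> mu.-integrable setT (EFin \o contr ddu F).
Proof.
move=> oU [c0 c1 c2 d1 d2] HF.
have I2 i j : mu.-integrable setT (EFin \o (fun z => ddu i j z * F z i j)).
  have [s1 s2] := HF i j.
  apply: integrable_cc.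
    exact: (continuous_mul_supp oU (c2 i j) (smooth_continuous s1)).
  by apply: (@supportedS R U) => //; apply: supported_mulr.
have := integrableD measurableT
  (integrableD measurableT (I2 ord0 ord0) (I2 ord0 o1))
  (integrableD measurableT (I2 o1 ord0) (I2 o1 o1)).
by congr (integrable _ _ _); apply/funext => z /=; rewrite /contr !sum2.
Qed.

Lemma C2on_affine U u du ddu a (b : R * R) : C2on U u du ddu ->
  C2on [set z | U (a *: z + b)] (fun z => u (a *: z + b))
    (fun i z => a * du i (a *: z + b)) (fun i j z => a ^+ 2 * ddu i j (a *: z + b)).
Proof.
have caff : continuous (fun z : R * R => a *: z + b).
  by move=> z; apply: cvgD; [apply: cvgZr; exact: cvg_id|exact: cvg_cst].
case=> c0 c1 c2 d1 d2; split.
- move=> z Uz; apply: (@continuous_comp _ _ _ (fun z => a *: z + b) u); first exact: caff.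
  exact: c0.
- move=> i z Uz; apply: cvgM; first exact: cvg_cst.
  by apply: (@continuous_comp _ _ _ (fun z => a *: z + b) (du i)); [exact: caff|exact: c1].
- move=> i j z Uz; apply: cvgM; first exact: cvg_cst.
  by apply: (@continuous_comp _ _ _ (fun z => a *: z + b) (ddu i j)); [exact: caff|exact: c2].
- by move=> i z Uz; apply: is_derive_affine; exact: d1.
- move=> i j z Uz; have := is_derive_mul (is_derive_cst (a:R) z (basis_vector R j))
     (is_derive_affine (d2 i j _ Uz)).
  move=> H; apply: (is_derive_eq H).
  by rewrite /cst mul0r add0r mulrA expr2.
Qed.

Definition enorm z : R := Num.sqrt (esq z).

Lemma esq_eq0 z : (esq z == 0) = (z == 0).
Proof.
rewrite /esq paddr_eq0 ?sqr_ge0// !sqrf_eq0; case: z => x y /=.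
by rewrite xpair_eqE.
Qed.

Lemma esq_gt0 z : z != 0 -> 0 < esq z.
Proof. by move=> z0; rewrite lt_neqAle esq_ge0 eq_sym esq_eq0 z0. Qed.

Lemma enorm_gt0 z : z != 0 -> 0 < enorm z.
Proof. by move=> z0; rewrite sqrtr_gt0 esq_gt0. Qed.

Lemma enorm_ge0 z : 0 <= enorm z. Proof. exact: sqrtr_ge0. Qed.

Lemma enorm_sqr z : enorm z ^+ 2 = esq z.
Proof. by rewrite sqr_sqrtr// esq_ge0. Qed.

Lemma norm_enorm z : `|z| <= enorm z.
Proof. by rewrite -(@ler_pXn2r _ 2)// ?nnegrE ?enorm_ge0// enorm_sqr norm_esq. Qed.

Lemma enorm_continuous : continuous enorm.
Proof.
move=> z; apply: (@continuous_comp _ _ _ (@esq R) (@Num.sqrt R)); last exact: sqrt_continuous.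
exact: (smooth_continuous (@smooth_esq R)).
Qed.

Lemma is_derive_enorm i z : z != 0 ->
  is_derive z (basis_vector R i) enorm (crd i z / enorm z).
Proof.
move=> z0; have := is_derive_comp1 (is_derive_esq i z) (is_derive1_sqrt (esq_gt0 z0)).
move=> H; apply: (is_derive_eq H); rewrite -/(enorm z).
by field; rewrite gt_eqF// enorm_gt0.
Qed.

(** A radial profile. The radius 1/2 is the inflection point of exp(-1/x): up to there this function
    is convex, which fixes the sign of the radial second derivative. *)
Definition cone0 z : R := flat 0 (2^-1 - enorm z).
Definition cone1 i z : R := - (crd i z * (enorm z)^-1 * flat 2 (2^-1 - enorm z)).
(** With h the radial profile and r = |z|, [coneP] is h''/r^2 and [coneQ] is h'/r^3: the Hessian is
    [coneP] times the square of the radial vector plus [coneQ] times that of its rotation. *)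
Definition coneP z : R :=
  (flat 4 (2^-1 - enorm z) - 2 * flat 3 (2^-1 - enorm z)) * (enorm z)^-1 * (enorm z)^-1.
Definition coneQ z : R :=
  - (flat 2 (2^-1 - enorm z) * (enorm z)^-1 * (enorm z)^-1 * (enorm z)^-1).
Definition cone2 i j z : R :=
  coneP z * crd i z * crd j z + coneQ z * ((i == j)%:R * esq z - crd i z * crd j z).

Lemma cone_C2 : C2on [set z | z != 0] cone0 cone1 cone2.
Proof.
have cen z := @enorm_continuous z.
have cfl n z : {for z, continuous (fun z => flat n (2^-1 - enorm z))}.
  apply: (@continuous_comp _ _ _ (fun z => 2^-1 - enorm z) (flat n)); last exact: flat_continuous.
  by apply: cvgB; [exact: cvg_cst|exact: cen].
have civ z : z != 0 -> {for z, continuous (fun z => (enorm z)^-1)}.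
  by move=> z0; apply: cvgV; [rewrite gt_eqF// enorm_gt0|exact: cen].
have ccrd i : continuous (@crd R i) := smooth_continuous (@smooth_crd R i).
have cesq : continuous (@esq R) := smooth_continuous (@smooth_esq R).
have cc (c : R) z : {for z, continuous (fun _ : R * R => c)} by exact: cvg_cst.
have dfl n i z : z != 0 -> is_derive z (basis_vector R i) (fun z => flat n (2^-1 - enorm z))
    (- (crd i z / enorm z) * (flat n.+2 (2^-1 - enorm z) - n%:R * flat n.+1 (2^-1 - enorm z))).
  move=> z0; apply: (@is_derive_comp1 _ (fun z => 2^-1 - enorm z) (flat n)); last exact: is_derive_flat.
  have := is_derive_add (is_derive_cst (2^-1 : R) z (basis_vector R i)) (is_deriveN (is_derive_enorm i z0)).
  by move=> H; apply: (is_derive_eq H); rewrite add0r.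
split.
- by move=> z _; exact: cfl.
- move=> i z z0; apply: cvgN; apply: cvgM; last exact: cfl.
  by apply: cvgM; [exact: ccrd|exact: civ].
- move=> i j z z0; apply: cvgD.
    apply: cvgM; last exact: ccrd.
    apply: cvgM; last exact: ccrd.
    apply: cvgM; last exact: civ.
    apply: cvgM; last exact: civ.
    by apply: cvgB; [exact: cfl|apply: cvgM; [exact: cc|exact: cfl]].
  apply: cvgM.
    apply: cvgN; do 3!(apply: cvgM; last exact: civ).
    exact: cfl.
  apply: cvgB; first by apply: cvgM; [exact: cc|exact: cesq].
  by apply: cvgM; exact: ccrd.
- move=> i z z0; apply: (is_derive_eq (dfl 0%N i z z0)).
  by rewrite mul0r subr0 /cone1 mulNr.
- move=> i j z z0.
  have en0 : enorm z != 0 by rewrite gt_eqF// enorm_gt0.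
  have := is_deriveN (is_derive_mul (is_derive_mul (is_derive_crd i j z)
    (is_derive_inv en0 (is_derive_enorm j z0))) (dfl 2 j z z0)).
  move=> H; apply: (is_derive_eq H).
  rewrite /cone2 /coneP /coneQ -enorm_sqr [in RHS]eq_sym.
  by field.
Qed.

Lemma coneP_ge0 z : 0 <= coneP z.
Proof.
have i0 : 0 <= (enorm z)^-1 by rewrite invr_ge0 enorm_ge0.
rewrite mulr_ge0// mulr_ge0//.
have [h|h] := ltP 0 (2^-1 - enorm z); last by rewrite !flat_le0// mulr0 subrr.
rewrite (flatS 3); set x := 2^-1 - enorm z in h *.
rewrite -mulrBl mulr_ge0 ?flat_ge0// subr_ge0.
have : x <= 2^-1 by rewrite /x gerBl enorm_ge0.
by rewrite -lef_pV2 ?posrE ?invr_gt0// invrK.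
Qed.

Lemma coneQ_le0 z : coneQ z <= 0.
Proof. by rewrite oppr_le0 !mulr_ge0 ?flat_ge0// invr_ge0 enorm_ge0. Qed.

Lemma cone_contr F z :
  \sum_(i < 2) \sum_(j < 2) cone2 i j z * F i j =
  coneP z * (z.1 * (F ord0 ord0 * z.1 + F ord0 o1 * z.2) +
             z.2 * (F o1 ord0 * z.1 + F o1 o1 * z.2)) +
  coneQ z * (- z.2 * (F ord0 ord0 * - z.2 + F ord0 o1 * z.1) +
             z.1 * (F o1 ord0 * - z.2 + F o1 o1 * z.1)).
Proof. rewrite !sum2 /cone2 /crd /esq/=; ring. Qed.

(** This is h'' - h'/r, the trace norm of the Hessian of the cone off its apex, as h'' is
    nonnegative and h' is nonpositive. *)
Definition coneW z : R := (coneP z - coneQ z) * esq z.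

Lemma coneW_ge0 z : 0 <= coneW z.
Proof.
rewrite mulr_ge0 ?esq_ge0//; have := coneP_ge0 z; have := coneQ_le0 z; lra.
Qed.

Lemma cone_contr_le t (F : 'M[R]_2) z : opb t F ->
  \sum_(i < 2) \sum_(j < 2) cone2 i j z * F i j <= t * coneW z.
Proof.
move=> HF; rewrite cone_contr /coneW /esq.
have h1 := ler_wpM2l (coneP_ge0 z) (HF z.1 z.2 z.1 z.2).
have q0 : 0 <= - coneQ z by rewrite oppr_ge0 coneQ_le0.
have h2 := ler_wpM2l q0 (HF z.2 (- z.1) (- z.2) z.1).
move: h1 h2; move: (coneP z) (coneQ z) => P Q h1 h2.
rewrite !sqrrN in h2. lra.
Qed.

(** Equality case of [cone_contr_le]: the reflection has eigenvalues 1 and -1 on the eigenvectors of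
    the Hessian. *)
Lemma cone_contr_refl z : z != 0 ->
  \sum_(i < 2) \sum_(j < 2) cone2 i j z * refl z i j = coneW z.
Proof.
move=> z0; have e0 : esq z != 0 by rewrite esq_eq0.
rewrite cone_contr /coneW !mxE /crd/=.
by move: (coneP z) (coneQ z) => P Q; move: e0; rewrite /esq => e0; field.
Qed.

Lemma cone_out z : 2^-1 <= enorm z -> [/\ cone0 z = 0, coneW z = 0 & forall i j, cone2 i j z = 0].
Proof.
move=> h; have h' : 2^-1 - enorm z <= 0 by rewrite subr_le0.
have P0 : coneP z = 0 by rewrite /coneP !flat_le0// mulr0 subrr !mul0r.
have Q0 : coneQ z = 0 by rewrite /coneQ flat_le0// !mul0r oppr0.
split; first by rewrite /cone0 flat_le0.
  by rewrite /coneW P0 Q0 subr0 mul0r.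
by move=> i j; rewrite /cone2 P0 Q0 !mul0r addr0.
Qed.

Lemma cone0_continuous : continuous cone0.
Proof.
move=> z; apply: (@continuous_comp _ _ _ (fun z => 2^-1 - enorm z) (flat 0)); last exact: flat_continuous.
by apply: cvgB; [exact: cvg_cst|exact: enorm_continuous].
Qed.

Definition cone p r z : R := cone0 (r^-1 *: z + r^-1 *: - p).

Lemma coneE p r z : cone p r z = cone0 (r^-1 *: (z - p)).
Proof. by rewrite scalerDr. Qed.

Lemma cone_continuous p r : continuous (cone p r).
Proof.
move=> z; apply: (@continuous_comp _ _ _ (fun z => r^-1 *: z + r^-1 *: - p) cone0).
  by apply: cvgD; [apply: cvgZr; exact: cvg_id|exact: cvg_cst].
exact: cone0_continuous.
Qed.

Definition coneh : R := cone0 0.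

Lemma coneh_gt0 : 0 < coneh.
Proof.
rewrite /coneh /cone0 /enorm (_ : esq 0 = 0) ?sqrtr0 ?subr0; last by apply/eqP; rewrite esq_eq0.
by apply: flat_gt0; rewrite invr_gt0.
Qed.

Lemma cone_center p r : cone p r p = coneh.
Proof. by rewrite coneE subrr scaler0. Qed.

Lemma scaled_far p r z : 0 < r -> r / 2 <= `|z - p| -> 2^-1 <= enorm (r^-1 *: (z - p)).
Proof.
move=> r0 h; apply: le_trans (norm_enorm _).
have ri0 : 0 <= r^-1 by rewrite invr_ge0 ltW.
by rewrite normrZ (ger0_norm ri0) mulrC ler_pdivlMr// mulrC.
Qed.

Lemma cone_far p r z : 0 < r -> r / 2 <= `|z - p| -> cone p r z = 0.
Proof. by move=> r0 h; rewrite coneE; have [-> _ _] := cone_out (scaled_far r0 h). Qed.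

Lemma field_cut_out D F s p : 0 < s -> field D F ->
  field (D `&` [set z | z != p]) (fun z => (1 - cut s p z) *: F z).
Proof.
move=> s0 HF i j; have [sF [K [cK KD K0]]] := HF i j.
have E : (fun z => ((1 - cut s p z) *: F z) i j) = fun z => (1 - cut s p z) * F z i j.
  by apply/funext => z; rewrite mxE.
rewrite E; split.
  by apply: smooth_mul => //; apply: smooth_sub; [exact: smooth_cst|exact: smooth_cut].
exists (K `&` ~` (ball p (s / 2))); split.
- apply: (subclosed_compact _ cK); last by move=> z [].
  apply: closedI; first exact: (compact_closed2 cK).
  by apply: open_closedC; exact: ball_open.
- move=> z [Kz nz]; split; first exact: KD.
  by apply/eqP => zp; apply: nz; rewrite zp; apply: ballxx; rewrite divr_gt0.
- move=> z /not_andP[nK|]; first by rewrite K0// mulr0.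
  move=> /contrapT /ball2P h; rewrite cut_in ?subrr ?mul0r// distrC; exact: ltW.
Qed.

Definition coneS p r s z : R := (1 - cut s p z) * (r^-1 ^+ 2 * coneW (r^-1 *: (z - p))).

Lemma cone_C2p p r : 0 < r -> C2on [set z | z != p] (cone p r)
  (fun i z => r^-1 * cone1 i (r^-1 *: z + r^-1 *: - p))
  (fun i j z => r^-1 ^+ 2 * cone2 i j (r^-1 *: z + r^-1 *: - p)).
Proof.
move=> r0; have := C2on_affine r^-1 (r^-1 *: - p) cone_C2.
congr C2on; apply/seteqP; split=> z /=; rewrite -scalerDr scaler_eq0 subr_eq0 invr_eq0 (gt_eqF r0)//.
Qed.

Lemma open_neq p : open [set z : R * R | z != p].
Proof.
have -> : [set z : R * R | z != p] = ~` [set p].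
  by apply/seteqP; split=> z /=; move/eqP.
apply: closed_openC; apply: compact_closed2; exact: compact_set1.
Qed.

(** Integrate the cone by parts against the ring field from [s] to [r]. Off the apex the contraction
    is the variation density, by [cone_contr_refl]; on the other side only the inner kernel [kap s]
    meets the cone. *)
Lemma coneS_int p r s : 0 < s <= r / 2 ->
  mu.-integrable setT (EFin \o coneS p r s) /\
  \int[mu]_z coneS p r s z = L (cone p r) (shiftf (kap s) p).
Proof.
move=> /andP[s0 sr]; have r0 : 0 < r by lra.
have ssr : 0 < s <= r by apply/andP; split=> //; lra.
have HF : field [set z | z != p] (ring_field p s r).
  have H0 := @ring_field_field R setT p s r ssr (fun _ _ => I).
  move=> i j; have [sm [K [cK _ K0]]] := H0 i j; split=> //.
  exists (K `&` ~` (ball p (s / 2))); split.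
  - apply: (subclosed_compact _ cK); last by move=> z [].
    apply: closedI; first exact: (compact_closed2 cK).
    by apply: open_closedC; exact: ball_open.
  - move=> z [Kz nz]; apply/eqP => zp; apply: nz; rewrite zp; apply: ballxx; by rewrite divr_gt0.
  - move=> z /not_andP[nK|]; first exact: K0.
    move=> /contrapT /ball2P h; rewrite /ring_field /shiftF RsB_in ?mxE//.
    by rewrite distrC ltW.
have E z : contr (fun i j z => r^-1 ^+ 2 * cone2 i j (r^-1 *: z + r^-1 *: - p)) (ring_field p s r) z =
    coneS p r s z.
  rewrite /contr /coneS -scalerDr; set y := r^-1 *: (z - p).
  have [zp|zp] := eqVneq z p.
    have s2 : `|p - p| <= s / 2 by rewrite subrr normr0 divr_ge0// ltW.
    rewrite zp (cut_in s0 s2) subrr mul0r !sum2 /ring_field /shiftF (RsB_in ssr s2).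
    by rewrite !mxE !mulr0 !addr0.
  have y0 : y != 0 by rewrite scaler_eq0 subr_eq0 invr_eq0 (gt_eqF r0) (negbTE zp).
  have [h|h] := leP (r / 2) `|z - p|.
    have [_ -> H2] := cone_out (scaled_far r0 h).
    by rewrite !mulr0 !sum2 !H2 !mulr0 !mul0r !addr0.
  have rE : refl (z - p) = refl y by rewrite /y reflZ// invr_eq0 gt_eqF.
  rewrite /ring_field /shiftF RsB// rE -[in RHS](cone_contr_refl y0).
  rewrite eta1_in// ?ltW// /cut !mulr_sumr; apply: eq_bigr => i _.
  by rewrite !mulr_sumr; apply: eq_bigr => j _; rewrite mxE; ring.
have Cp := @cone_C2p p r r0.
have I := integrable_contr (open_neq (p:=p)) Cp HF.
have IE : contr (fun i j z => r^-1 ^+ 2 * cone2 i j (r^-1 *: z + r^-1 *: - p)) (ring_field p s r) =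
  coneS p r s by apply/funext.
rewrite IE in I; split=> //.
have := ibp2 (open_neq (p:=p)) Cp HF; rewrite -/(contr _ _) => H.
rewrite -IE /contr -H div2_ring_field; apply: eq_L => z.
have [h|h] := leP (r / 2) `|z - p|; first by rewrite cone_far// !mul0r.
(* [Rs r] vanishes identically within [r / 2] of the centre, where the cone lives, and so does its
   divergence. *)
have -> : shiftf (kap r) p z = 0; last by rewrite subr0.
rewrite /shiftf /kap.
have nz : \forall w \near (z - p), forall i j, Rs r w i j = 0.
  have : \forall w \near (z - p), `|w| < r / 2.
    by apply: (@cvgr_lt _ _ _ _ (fun y : R * R => `|y|) `|z - p| (@norm_continuous _ _ (z - p))).
  apply: filterS => w hw i j.
  by rewrite refl_scale// eta1_in// ?subrr ?scale0r ?mxE// ltW.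
rewrite /div2 big1// => i _; rewrite big1// => j _.
apply: near_zero_partial; have := near_join nz.
by apply: filterS => w /= hw; apply: near_zero_partial; apply: filterS hw => v.
Qed.

(** Split the test field around the apex. The inner part pairs to almost 0 by [cut_field_lim]; the
    outer part is at most the integral of [coneS], which equals a pairing with [kap s] and tends to
    the height times [Kc]. *)
Lemma cone_Vle D p r : open (D : set (R * R)) -> 0 < r ->
  Vle D (cone p r) (coneh * Kc R).
Proof.
move=> oD r0 F HF F1; apply/ler_addgt0Pr => e e0.
have e2 : 0 < e / 2 by rewrite divr_gt0.
have lc A : open A -> L1loc A (cone p r).
  move=> oA; apply: L1loc_continuous => //; apply: continuous_subspaceT.
  exact: cone_continuous.
have lcT := lc setT openT.
have cp : {for p, continuous (cone p r)} by exact: cone_continuous.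
have sF := field_smoothF HF.
have [s1 s10 H1] := cut_field_lim openT (I : setT p) lcT cp sF e2.
have [s2 s20 H2] := kap_lim openT (I : setT p) lcT cp e2.
pose s := Num.min (Num.min s1 s2) r / 3.
have mpos : 0 < Num.min (Num.min s1 s2) r by rewrite !lt_min s10 s20 r0.
have s0 : 0 < s by rewrite divr_gt0.
have m1 : Num.min (Num.min s1 s2) r <= s1 by rewrite !ge_min lexx.
have m2 : Num.min (Num.min s1 s2) r <= s2 by rewrite !ge_min lexx orbT.
have m3 : Num.min (Num.min s1 s2) r <= r by rewrite !ge_min lexx !orbT.
have ss1 : 0 < s < s1 by rewrite s0 /s; lra.
have ss2 : 0 < s < s2 by rewrite s0 /s; lra.
have ssr : 0 < s <= r / 2 by rewrite s0 /s; lra.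
have := H1 s ss1; have := H2 s ss2; rewrite cone_center.
have [Iw <-] := coneS_int p ssr.
rewrite !ler_norml => /andP[_ h2] /andP[_ h1].
have HG := field_cut_out p s0 HF.
have HC : field D (fun z => cut s p z *: F z).
  by apply: fieldM => //; exact: smooth_cut.
have sG : smoothF (fun z => (1 - cut s p z) *: F z) by exact: field_smoothF HG.
have sC : smoothF (fun z => cut s p z *: F z) by exact: field_smoothF HC.
have E : div2 F = fun z => div2 (fun z => (1 - cut s p z) *: F z) z +
    div2 (fun z => cut s p z *: F z) z.
  rewrite -div2D//; congr div2; apply/funext => z.
  by rewrite -scalerDl subrK scale1r.
have iG : intg (cone p r) (div2 (fun z => (1 - cut s p z) *: F z)).
  apply: (L1loc_intg lcT); first exact/smooth_continuous/smooth_div2.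
  by apply: (@supportedS R _ setT _ (fun _ _ => I)); exact: supported_div2 HG.
have iC : intg (cone p r) (div2 (fun z => cut s p z *: F z)).
  apply: (L1loc_intg lcT); first exact/smooth_continuous/smooth_div2.
  by apply: (@supportedS R _ setT _ (fun _ _ => I)); exact: supported_div2 HC.
rewrite E L_addr//.
have HG' : field [set z | z != p] (fun z => (1 - cut s p z) *: F z).
  by apply: fieldS HG => z [].
have Cp := @cone_C2p p r r0.
rewrite (ibp2 (open_neq (p:=p)) Cp HG').
have H3 : \int[mu]_z contr (fun i j z => r^-1 ^+ 2 * cone2 i j (r^-1 *: z + r^-1 *: - p))
    (fun z => (1 - cut s p z) *: F z) z <= \int[mu]_z coneS p r s z.
  apply: le_Rintegral => //; first exact: integrable_contr (open_neq (p:=p)) Cp HG'.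
  move=> z _; rewrite /contr -scalerDr /coneS; set y := r^-1 *: (z - p).
  have c0 : 0 <= (1 - cut s p z) * r^-1 ^+ 2.
    by rewrite mulr_ge0 ?sqr_ge0// subr_ge0 cut_le1.
  have := ler_wpM2l c0 (cone_contr_le y (F1 z)).
  rewrite mul1r -[leRHS]mulrA; congr (_ <= _).
  rewrite mulr_sumr; apply: eq_bigr => i _; rewrite mulr_sumr; apply: eq_bigr => j _.
  by rewrite mxE; ring.
rewrite /contr in H3; lra.
Qed.

(** [coneh * Kc] is the limit of the integrals of [coneS], which is nonnegative and bounded below,
    uniformly in [s], on a fixed ball away from the apex. *)
Lemma Kc_gt0 : 0 < Kc R.
Proof.
pose p : R * R := 0.
have lcT : L1loc setT (cone p 1).
  by apply: L1loc_continuous; [exact: openT|apply: continuous_subspaceT; exact: cone_continuous].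
have cp : {for p, continuous (cone p 1)} by exact: cone_continuous.
(* Inside the support of the cone and off its apex; the bounds 1/8 on the ball and 1/32 on [s] keep
   the ball clear of the cutoff. *)
pose z0 : R * R := (4^-1, 0).
have z00 : z0 != 0 by rewrite xpair_eqE/= invr_eq0 pnatr_eq0.
have en0 : enorm z0 = 4^-1.
  by rewrite /enorm /esq/= expr0n addr0 sqrtr_sqr ger0_norm// invr_ge0.
have W0 : 0 < coneW z0.
  rewrite /coneW mulr_gt0 ?esq_gt0//.
  have := coneP_ge0 z0; suff : coneQ z0 < 0 by lra.
  rewrite /coneQ oppr_lt0 !mulr_gt0 ?invr_gt0 ?enorm_gt0//.
  by apply: flat_gt0; rewrite en0; lra.
have cW : {for z0, continuous coneW}.
  have C := C2_c2 cone_C2.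
  have -> : coneW = fun z => coneW z by [].
  have cen z := @enorm_continuous z.
  have cfl n z : {for z, continuous (fun z => flat n (2^-1 - enorm z))}.
    apply: (@continuous_comp _ _ _ (fun z => 2^-1 - enorm z) (flat n)); last exact: flat_continuous.
    by apply: cvgB; [exact: cvg_cst|exact: cen].
  have civ : {for z0, continuous (fun z => (enorm z)^-1)}.
    by apply: cvgV; [rewrite gt_eqF// enorm_gt0|exact: cen].
  apply: cvgM; last exact: (smooth_continuous (@smooth_esq R)).
  apply: cvgB.
    apply: cvgM; last exact: civ.
    apply: cvgM; last exact: civ.
    by apply: cvgB; [exact: cfl|apply: cvgM; [exact: cvg_cst|exact: cfl]].
  apply: cvgN; do 3!(apply: cvgM; last exact: civ).
  exact: cfl.
have W2 : coneW z0 / 2 < coneW z0 by lra.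
have /nbhs_ballP[d1 /= d10 Hd1] : \forall w \near z0, coneW z0 / 2 < coneW w.
  exact: (cvgr_gt _ cW).
pose d := Num.min d1 8^-1.
have d0 : 0 < d by rewrite lt_min d10 invr_gt0 ltr0n.
have d18 : d <= 8^-1 by rewrite ge_min lexx orbT.
have B : measurable (ball z0 d : set plane) by exact: ball2_measurable.
have muB : mu (ball z0 d) = ((d *+ 2) ^+ 2)%:E by rewrite ball2_mu// ltW.
pose c0 := coneW z0 / 2 * (d *+ 2) ^+ 2.
have c00 : 0 < c0 by rewrite mulr_gt0 ?divr_gt0// exprn_gt0// mulrn_wgt0.
have c02 : 0 < c0 / 2 by rewrite divr_gt0.
have [s2 s20 H2] := kap_lim openT (I : setT p) lcT cp c02.
pose s := Num.min s2 16^-1 / 2.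
have mpos : 0 < Num.min s2 16^-1 by rewrite !lt_min s20 invr_gt0 ltr0n.
have m1 : Num.min s2 16^-1 <= s2 by rewrite !ge_min lexx.
have m2 : Num.min s2 16^-1 <= 16^-1 by rewrite !ge_min lexx orbT.
have s0 : 0 < s by rewrite divr_gt0.
have ss : 0 < s < s2 by rewrite s0 /s; lra.
have ssr : 0 < s <= 1 / 2 by rewrite s0 /s; lra.
have := H2 s ss; rewrite cone_center.
have [Iw <-] := coneS_int p ssr.
rewrite ler_norml => /andP[_ h2].
suff H : c0 <= \int[mu]_z coneS p 1 s z.
  have : 0 < coneh * Kc R by lra.
  by rewrite pmulr_rgt0// coneh_gt0.
have S0 z : 0 <= coneS p 1 s z.
  by rewrite mulr_ge0 ?subr_ge0 ?cut_le1// mulr_ge0 ?sqr_ge0 ?coneW_ge0.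
have IB : mu.-integrable (ball z0 d : set plane) (EFin \o coneS p 1 s).
  exact: integrableS Iw.
apply: (@le_trans _ _ (\int[mu]_(z in ball z0 d) coneS p 1 s z)).
  have -> : c0 = \int[mu]_(z in ball z0 d) (coneW z0 / 2).
    by rewrite Rintegral_cst// muB.
  apply: le_Rintegral => //; first by apply: integrable_cst_fin => //; rewrite muB ltry.
  move=> z /ball2P hz; rewrite /coneS subr0 invr1 expr1n mul1r scale1r.
  have hz1 : `|z0.1 - z.1| < d by apply: le_lt_trans hz; rewrite [leRHS]prod_normE le_max lexx.
  have zn : 2 * s < `|z - p|.
    apply: (@lt_le_trans _ _ `|z.1|); last by rewrite subr0 [leRHS]prod_normE le_max lexx.
    apply: lt_le_trans (ler_norm _); move: hz1; rewrite ltr_norml /= => /andP[_].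
    by rewrite /s; lra.
  rewrite cut_out// subr0 mul1r ltW//; apply: Hd1; apply/ball2P.
  by apply: (lt_le_trans hz); rewrite ge_min lexx.
rewrite Rintegral_mkcond; apply: le_Rintegral => //.
  by rewrite -restrict_EFin; exact: (integrable_mkcond (mu := mu) (EFin \o coneS p 1 s) B).1 IB.
by move=> z _; rewrite patchE; case: ifPn.
Qed.

End cone.

(** * Smallness of the variation on small balls *)

Section regularity.
Variable R : realType.
Local Notation plane := (measurableTypeR R * measurableTypeR R)%type.
Local Notation mu := (lebesgue2 R).
Implicit Types (A D U K : set plane) (f g u psi : R * R -> R) (z w p q : R * R)
  (C c e m r s rho a : R) (M : 'M[R]_2).

Lemma L1locS A D f : measurable A -> measurable D -> A `<=` D -> L1loc D f -> L1loc A f.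
Proof.
move=> mA mD AD [mf lf]; split; first exact: measurable_funS mf.
by move=> K cK KA; apply: lf => //; exact: subset_trans AD.
Qed.

Definition pball p r : set (R * R) := [set z | z != p /\ `|z - p| < r].

Lemma pball_ball p r : pball p r `<=` ball p r.
Proof. by move=> z [_ h]; apply/ball2P; rewrite distrC. Qed.

Lemma ball_cball p r : ball p r `<=` cball p r.
Proof. by move=> z /ball2P/ltW. Qed.

Lemma field_disjoint D (F G : R * R -> 'M[R]_2) :
  (forall z, F z = 0 \/ G z = 0) -> (forall z, opb 1 (F z)) -> (forall z, opb 1 (G z)) ->
  forall z, opb 1 (F z + G z).
Proof. by move=> dis F1 G1 z; case: (dis z) => ->; rewrite ?add0r ?addr0. Qed.

Lemma field_supp_union D F : field D F ->
  exists K, [/\ compact K, K `<=` D & forall z, ~ K z -> F z = 0].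
Proof.
move=> HF.
have [_ [K00 [c00 D00 H00]]] := HF ord0 ord0; have [_ [K01 [c01 D01 H01]]] := HF ord0 o1.
have [_ [K10 [c10 D10 H10]]] := HF o1 ord0; have [_ [K11 [c11 D11 H11]]] := HF o1 o1.
exists ((K00 `|` K01) `|` (K10 `|` K11)); split.
- by apply: compactU; apply: compactU.
- by move=> z [[/D00|/D01]|[/D10|/D11]].
- move=> z /not_orP[/not_orP[n00 n01] /not_orP[n10 n11]]; apply/matrixP => i j.
  by rewrite mxE; elim/I2P: i; elim/I2P: j; [exact: H00|exact: H01|exact: H10|exact: H11].
Qed.

Lemma L_div2D D f F G : L1loc D f -> field D F -> field D G ->
  L f (div2 (fun z => F z + G z)) = L f (div2 F) + L f (div2 G).
Proof.
move=> lf HF HG; rewrite div2D; [|exact: field_smoothF HF|exact: field_smoothF HG].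
exact: L_addr (intg_div2 lf HF) (intg_div2 lf HG).
Qed.

Lemma L_div2B D f F G : L1loc D f -> field D F -> field D G ->
  L f (div2 (fun z => F z - G z)) = L f (div2 F) - L f (div2 G).
Proof.
move=> lf HF HG; rewrite div2B; [|exact: field_smoothF HF|exact: field_smoothF HG].
exact: L_subr (intg_div2 lf HF) (intg_div2 lf HG).
Qed.

(* Fields on disjoint punctured balls add up without increasing the norm, so
   only finitely many of them can have a pairing larger than [e]. *)
Lemma punctured_small D f c p e : open (D : set (R * R)) -> D p -> L1loc D f ->
  Vle D f c -> 0 < e -> exists r, [/\ 0 < r, cball p r `<=` D & Vle (pball p r) f e].
Proof.
move=> oD Dp lf Vf e0; apply: contrapT => H.
have /nbhs_ballP[r0 /= r00 Hr0] : nbhs p D by exact: open_nbhs_nbhs.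
have big r : 0 < r -> r < r0 -> exists F, [/\ field (pball p r) F,
    forall z, opb 1 (F z) & e < L f (div2 F)].
  move=> rp rr; apply: contrapT => H2; apply: H; exists r; split=> //.
    by move=> z /= hz; apply: Hr0; apply/ball2P; exact: le_lt_trans rr.
  move=> F HF F1; rewrite leNgt; apply/negP => hF; apply: H2.
  by exists F.
have iter (n : nat) r : 0 < r -> r < r0 -> exists F, [/\ field (pball p r) F,
    forall z, opb 1 (F z) & n%:R * e <= L f (div2 F)].
  elim: n r => [|n IH] r rp rr.
    have [F [HF F1 hF]] := big r rp rr.
    by exists F; split=> //; rewrite mul0r ltW// (lt_trans e0).
  have [F [HF F1 hF]] := big r rp rr.
  have [K [cK KD K0]] := field_supp_union HF.
  have nKp : ~ K p by move=> /KD[/eqP].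
  have /nbhs_ballP[t /= t0 Ht] := closed_near (compact_closed2 cK) nKp.
  (* The support [K] misses [p], so the fields chosen next, within [r'] of [p], are disjoint from
     this one. *)
  pose r' := Num.min t r / 2.
  have m0 : 0 < Num.min t r by rewrite lt_min t0.
  have m1 : Num.min t r <= t by rewrite ge_min lexx.
  have m2 : Num.min t r <= r by rewrite ge_min lexx orbT.
  have r'0 : 0 < r' by rewrite divr_gt0.
  have r'r : r' < r by rewrite /r'; lra.
  have r't : r' < t by rewrite /r'; lra.
  have [G [HG G1 hG]] := IH r' r'0 (lt_trans r'r rr).
  have pr : pball p r' `<=` pball p r by move=> z [zp hz]; split=> //; exact: lt_trans r'r.
  exists (fun z => F z + G z); split.
  - by apply: fieldD => //; exact: fieldS HG.
  - apply: field_disjoint => // z.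
    have [Kz|nK] := pselect (K z); last by left; exact: K0.
    right; apply/matrixP => i j; rewrite [RHS]mxE.
    apply: (supported_out (HG i j).2) => -[zp hz].
    by apply: (Ht z) => //; apply/ball2P; rewrite distrC (lt_trans hz).
  - have sD : pball p r `<=` D.
      by move=> z [_ hz]; apply: Hr0; apply/ball2P; rewrite distrC (lt_trans hz).
    rewrite (L_div2D lf (fieldS sD HF) (fieldS (subset_trans pr sD) HG)).
    by rewrite mulrS mulrDl mul1r lerD// ltW.
have c0 := Vle_ge0 Vf.
pose n := (Num.truncn (c / e)).+1.
have r2 : r0 / 2 < r0 by lra.
have r20 : 0 < r0 / 2 by lra.
have [F [HF F1 hF]] := iter n (r0 / 2) r20 r2.
have sD : pball p (r0 / 2) `<=` D.
  by move=> z [_ hz]; apply: Hr0; apply/ball2P; rewrite distrC (lt_trans hz).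
have := le_trans hF (Vf F (fieldS sD HF) F1).
by rewrite -ler_pdivlMr// leNgt truncnS_gt.
Qed.

(** The affine function vanishing at [p] whose rotated gradient is column [j] of [M]. *)
Definition perp_lin (M : 'M[R]_2) p j z : R :=
  - M o1 j * (z.1 - p.1) + M ord0 j * (z.2 - p.2).

(** Column [j] is the rotated gradient of [v j], hence divergence free; summing over columns gives
    [div2_curl]. *)
Definition curlF (v : 'I_2 -> R * R -> R) z : 'M[R]_2 :=
  \matrix_(i, j) (if i == ord0 then pder o1 (v j) z else - pder ord0 (v j) z).

Lemma smoothF_curl v : (forall j, Cinf (v j)) -> smoothF (curlF v).
Proof.
move=> sv i j; elim/I2P: i.
  have -> : (fun z => curlF v z ord0 j) = pder o1 (v j) by apply/funext => z; rewrite mxE.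
  exact: smooth_partial.
have -> : (fun z => curlF v z o1 j) = fun z => - pder ord0 (v j) z.
  by apply/funext => z; rewrite mxE.
by apply: smooth_opp; exact: smooth_partial.
Qed.

Lemma div2_curl v z : (forall j, Cinf (v j)) -> div2 (curlF v) z = 0.
Proof.
move=> sv; rewrite /div2 sum2.
have E0 j : (fun w => curlF v w ord0 j) = pder o1 (v j) by apply/funext => w; rewrite mxE.
have E1 j : (fun w => curlF v w o1 j) = fun w => - 1 * pder ord0 (v j) w.
  by apply/funext => w; rewrite mxE mulN1r.
rewrite -big_split big1//= => j _; rewrite E0 E1.
have s0 : Cinf (pder ord0 (v j)) by exact: smooth_partial.
have s1 : Cinf (pder o1 (v j)) by exact: smooth_partial.
rewrite (partial_scale _ _ s0) (partial_scale _ _ (smooth_partial _ s0)) mulN1r.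
rewrite (partialC ord0 j s1) (partialC o1 j s0) (partialC o1 ord0 (sv j)).
by rewrite subrr.
Qed.

Lemma smooth_perp_lin M p j : Cinf (perp_lin M p j).
Proof.
apply: smooth_add; apply: smooth_mul; try exact: smooth_cst.
- by apply: smooth_sub; [exact: smooth_fst|exact: smooth_cst].
- by apply: smooth_sub; [exact: smooth_snd|exact: smooth_cst].
Qed.

Lemma pder_perp_lin M p j i z :
  pder i (perp_lin M p j) z = if i == ord0 then - M o1 j else M ord0 j.
Proof.
have hf : Cinf (fun z : R * R => z.1 - p.1).
  by apply: smooth_sub; [exact: smooth_fst|exact: smooth_cst].
have hs : Cinf (fun z : R * R => z.2 - p.2).
  by apply: smooth_sub; [exact: smooth_snd|exact: smooth_cst].
rewrite /perp_lin (partial_add i (smooth_scale _ hf) (smooth_scale _ hs)).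
rewrite (partial_scale i _ hf) (partial_scale i _ hs).
have -> : pder i (fun z => z.1 - p.1) = fun=> (i == ord0)%:R.
  rewrite partial_add; [|exact: smooth_fst|exact: smooth_cst].
  by rewrite partial_fst partial_cst; apply/funext => w; rewrite addr0.
have -> : pder i (fun z => z.2 - p.2) = fun=> (i != ord0)%:R.
  rewrite partial_add; [|exact: smooth_snd|exact: smooth_cst].
  by rewrite partial_snd partial_cst; apply/funext => w; rewrite addr0.
by case: eqP => _ /=; rewrite mulr1 mulr0 ?addr0 ?add0r.
Qed.

(* The divergence-free field of the bump [cut s p] times an affine map has the
   prescribed value [M] at [p], and its entries are bounded uniformly in [s]. *)
Lemma curl_field : exists2 C, 0 < C & forall p s M, 0 < s ->
  (forall i j, `|M i j| <= 1) -> exists F, [/\ field (cball p (2 * s)) F,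
    F p = M, forall z i j, `|F z i j| <= C & forall z, div2 F z = 0].
Proof.
have [m m0 Hm] : exists2 m, 0 < m & forall i z, `|pder i (@eta1 R) z| <= m.
  have B i := bounded_deriv (smooth_partial i (@smooth_eta1 R))
    (supported_partial i (supported_out_norm (@eta1_out2 R))).
  have [C0 c0 H0] := B ord0; have [C1 c1 H1] := B o1.
  exists (C0 + C1); first exact: addr_gt0.
  by elim/I2P => z; [apply: (le_trans (H0 z))|apply: (le_trans (H1 z))]; lra.
(* On the support the gradient of the cutoff is at most [m / s] and the affine factor at most
   [4 * s]; the other Leibniz term is at most an entry of [M]. *)
exists (4 * m + 1) => [|p s M s0 M1]; first by lra.
pose v j z := cut s p z * perp_lin M p j z.
have sv j : Cinf (v j) by apply: smooth_mul; [exact: smooth_cut|exact: smooth_perp_lin].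
have pcut i : pder i (cut s p) = fun z => s^-1 * pder i (@eta1 R) (s^-1 *: z + s^-1 *: - p).
  by rewrite cutE (partial_affine i _ _ (@smooth_eta1 R)).
have pv i j z : pder i (v j) z = pder i (cut s p) z * perp_lin M p j z +
    cut s p z * (if i == ord0 then - M o1 j else M ord0 j).
  by rewrite /v partial_mul ?pder_perp_lin//; [exact: smooth_cut|exact: smooth_perp_lin].
have co i z : 2 * s < `|z - p| -> pder i (cut s p) z = 0.
  move=> hz; apply: near_zero_partial.
  have cN : continuous (fun w : R * R => `|w - p|).
    by move=> w; apply: cvg_norm; apply: cvgB; [exact: cvg_id|exact: cvg_cst].
  near=> w; apply: cut_out => //; near: w.
  exact: (cvgr_gt _ (cN z)).
have Bv i j z : `|pder i (v j) z| <= 4 * m + 1.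
  have [hz|hz] := ltP (2 * s) `|z - p|.
    by rewrite pv (co _ _ hz) (cut_out s0 hz) !mul0r addr0 normr0; lra.
  rewrite pv; apply: (le_trans (ler_normD _ _)); apply: lerD.
    rewrite pcut normrM normrM (gtr0_norm (_ : 0 < s^-1)) ?invr_gt0//.
    have h1 : `|perp_lin M p j z| <= 4 * s.
      have : Num.max `|(z - p).1| `|(z - p).2| <= 2 * s by rewrite -prod_normE.
      rewrite ge_max => /andP[n1 n2].
      have a1 := M1 o1 j; have a2 := M1 ord0 j.
      apply: (le_trans (ler_normD _ _)); rewrite !normrM normrN.
      have : `|M o1 j| * `|z.1 - p.1| <= 1 * (2 * s) by apply: ler_pM.
      have : `|M ord0 j| * `|z.2 - p.2| <= 1 * (2 * s) by apply: ler_pM.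
      by lra.
    have -> : 4 * m = s^-1 * m * (4 * s) by field; rewrite gt_eqF.
    apply: ler_pM => //; first by rewrite mulr_ge0// invr_ge0 ltW.
    by apply: ler_pM => //; rewrite ?invr_ge0 ?ltW ?Hm.
  rewrite normrM -[leRHS]mulr1; apply: ler_pM => //.
    by rewrite ger0_norm ?cut_ge0 ?cut_le1.
  by case: eqP => _; rewrite ?normrN.
exists (curlF v); split.
- apply: (@field_out R _ _ p (2 * s)) => //; first exact: smoothF_curl.
  move=> z hz; apply/matrixP => i j; rewrite !mxE !pv !(co _ _ hz) (cut_out s0 hz).
  by rewrite !mul0r addr0 oppr0; case: ifP.
- apply/matrixP => i j; rewrite mxE !pv cut_in; last 2 first.
    exact: s0.
    by rewrite subrr normr0 divr_ge0// ltW.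
  have -> : perp_lin M p j p = 0 by rewrite /perp_lin !subrr !mulr0 addr0.
  by elim/I2P: i => /=; rewrite mulr0 add0r mul1r// opprK.
- by move=> z i j; rewrite mxE; case: ifP => _; rewrite ?normrN.
- by move=> z; exact: div2_curl.
Unshelve. all: by end_near.
Qed.

(** The variation has no atoms. Subtracting a divergence-free field with the same value at [p] makes
    the test field vanish at [p] without changing the pairing; near [p] it is then so small that the
    total bound [c] suffices, and the rest lives on the punctured ball. *)
Lemma ball_small D f c p e : open (D : set (R * R)) -> D p -> L1loc D f ->
  Vle D f c -> 0 < e -> exists r, [/\ 0 < r, cball p r `<=` D & Vle (ball p r) f e].
Proof.
move=> oD Dp lf Vf e0.
have c0 := Vle_ge0 Vf.
have [C C0 HC] := curl_field.
(* The corrected field has norm up to [1 + 2 * C] instead of 1. *)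
pose e1 := e / 2 / (1 + 2 * C).
have e10 : 0 < e1 by rewrite !divr_gt0//; lra.
have [r [r0 rD Vr]] := punctured_small oD Dp lf Vf e10.
exists r; split=> // F HF F1.
have bD : ball p r `<=` D by apply: subset_trans rD; exact: ball_cball.
have r40 : 0 < r / 4 by rewrite divr_gt0.
have [F' [HF' F'p F'C divF']] := HC p (r / 4) (F p) r40 (fun i j => opb_entry i j (F1 p)).
have HF'b : field (ball p r) F'.
  by apply: fieldS HF' => z hz; apply/ball2P; apply: (le_lt_trans hz); lra.
pose H z := F z - F' z.
have HH : field (ball p r) H by exact: fieldB.
have oH z : opb (1 + 2 * C) (H z) by apply: opbB => //; exact: opb_entries.
have -> : L f (div2 F) = L f (div2 H).
  rewrite (L_div2B lf (fieldS bD HF) (fieldS bD HF'b)).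
  suff -> : L f (div2 F') = 0 by rewrite subr0.
  by rewrite (_ : div2 F' = fun=> 0) ?L_zero//; exact/funext.
(* Entries of size [e'] give norm [2 * e'], hence a pairing of at most [e / 2]. *)
pose e' := e / (4 * (c + 1)).
have e'0 : 0 < e' by rewrite divr_gt0//; lra.
have Hsm : \forall z \near p, forall i j, `|H z i j| <= e'.
  have Hs i j : \forall z \near p, `|H z i j| <= e'.
    have sH : Cinf (fun z => H z i j) := (HH i j).1.
    have cH : (fun z => H z i j) @ p --> H p i j := smooth_continuous sH (x := p).
    move/cvgrPdist_le: cH => /(_ _ e'0); apply: filterS => z.
    by rewrite {1}/H F'p subrr mxE sub0r normrN.
  near=> z => i j; elim/I2P: i; elim/I2P: j; near: z; exact: Hs.
have /nbhs_ballP[t /= t0 Ht] := Hsm.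
pose a := t / 4.
have a0 : 0 < a by rewrite divr_gt0.
pose H1 z := cut a p z *: H z; pose H2 z := (1 - cut a p z) *: H z.
have HH1 : field (ball p r) H1 by apply: fieldM => //; exact: smooth_cut.
have HH2 := @field_cut_out R _ _ _ p a0 HH.
have sp : ball p r `&` [set z | z != p] `<=` pball p r.
  by move=> z [/ball2P hz zp]; split=> //; rewrite distrC.
have -> : H = fun z => H1 z + H2 z.
  by apply/funext => z; rewrite /H1 /H2 -scalerDl addrC subrK scale1r.
have pD : pball p r `<=` D by apply: subset_trans bD; exact: pball_ball.
rewrite (L_div2D lf (fieldS bD HH1) (fieldS (subset_trans sp pD) HH2)).
have o1 z : opb (2 * e') (H1 z).
  apply: opb_entries => i j; rewrite mxE normrM.
  have [hz|hz] := ltP (2 * a) `|z - p|; first by rewrite cut_out// normr0 mul0r ltW.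
  rewrite -[leRHS]mul1r; apply: ler_pM => //; first by rewrite ger0_norm ?cut_ge0 ?cut_le1.
  by apply: Ht; apply/ball2P; rewrite distrC (le_lt_trans hz)// /a; lra.
have o2 z : opb (1 + 2 * C) (H2 z).
  apply: (@opb_le _ (`|1 - cut a p z| * (1 + 2 * C))); last exact: opb_norm.
  rewrite -[leRHS]mul1r ler_wpM2r//; first by lra.
  by rewrite ger0_norm ?subr_ge0 ?cut_le1// gerBl cut_ge0.
have t1 : 0 <= 2 * e' by lra.
have t2 : 0 <= 1 + 2 * C by lra.
have h1 := Vle_opb t1 Vf (fieldS bD HH1) o1 lf.
have lfp : L1loc (pball p r) f.
  apply: (@L1locS _ D) => //; last exact: open_plane_measurable.
  apply: open_plane_measurable.
  rewrite (_ : pball p r = ball p r `&` [set z | z != p]).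
    by apply: openI; [exact: ball_open|exact: open_neq].
  apply/seteqP; split=> z; last exact: sp.
  by move=> hz; split; [exact: pball_ball|case: hz].
have h2 := Vle_opb t2 Vr (fieldS sp HH2) o2 lfp.
have q1 : 2 * e' * c <= e / 2.
  have -> : 2 * e' * c = e / 2 * (c / (c + 1)) by rewrite /e'; field; lra.
  have : c / (c + 1) <= 1 by rewrite ler_pdivrMr; lra.
  by move=> /(ler_wpM2l (_ : 0 <= e / 2)); lra.
have q2 : (1 + 2 * C) * e1 = e / 2 by rewrite /e1; field; lra.
by lra.
Unshelve. all: by end_near.
Qed.

End regularity.

(** * A function with vanishing pairings vanishes almost everywhere *)

Section representative.
Variable R : realType.
Local Notation plane := (measurableTypeR R * measurableTypeR R)%type.
Local Notation mu := (lebesgue2 R).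
Implicit Types (A D U K : set plane) (f g h u psi : R * R -> R) (z w p q : R * R)
  (C c e m r s rho a : R) (M : 'M[R]_2).

(** The product sigma-algebra is the Borel one, which makes Dynkin induction from open sets
    possible. *)
Lemma plane_measurableE : @measurable _ plane = <<s [set U : set plane | open (U : set (R * R))] >>.
Proof.
set G := [set U | _].
apply/seteqP; split; last first.
  apply: smallest_sub; first exact: sigma_algebra_measurable.
  by move=> U oU; exact: open_plane_measurable.
pose T' := g_sigma_algebraType G.
have m1 : measurable_fun setT (fst : T' -> measurableTypeR R).
  apply: (@measurability _ _ T' (measurableTypeR R) setT fst (@RGenOpens.G R)).
    exact: RGenOpens.measurableE.
  move=> _ [_ [x [y ->]] <-]; rewrite setTI; apply: sub_sigma_algebra => /=.
  by apply: (@open_comp _ _ (fst : R * R -> R)) => [z _|]; [exact: cvg_fst|exact: interval_open].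
have m2 : measurable_fun setT (snd : T' -> measurableTypeR R).
  apply: (@measurability _ _ T' (measurableTypeR R) setT snd (@RGenOpens.G R)).
    exact: RGenOpens.measurableE.
  move=> _ [_ [x [y ->]] <-]; rewrite setTI; apply: sub_sigma_algebra => /=.
  by apply: (@open_comp _ _ (snd : R * R -> R)) => [z _|]; [exact: cvg_snd|exact: interval_open].
rewrite measurable_prod_measurableType.
apply: smallest_sub; first exact: smallest_sigma_algebra.
move=> _ [A mA [B mB <-]].
have -> : A `*` B = ([set: T'] `&` fst @^-1` A) `&` ([set: T'] `&` snd @^-1` B).
  by rewrite !setTI; apply/seteqP; split=> z.
have M1 := m1 (@measurableT _ T') A mA; have M2 := m2 (@measurableT _ T') B mB.
exact: (@measurableI _ T' _ _ M1 M2).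
Qed.

Definition qtent (k : nat) z : R :=
  if unpickle k is Some abr then
    let: (a, b, r) := abr : rat * rat * rat in
    Num.max 0 (ratr r - `|((ratr a, ratr b) : R * R) - z|)
  else 0.

Lemma qtent_ge0 k z : 0 <= qtent k z.
Proof. by rewrite /qtent; case: unpickle => [[[a b] r]|//]; rewrite le_max lexx. Qed.

Lemma qtent_gt0 k z : (0 < qtent k z) <-> qbox k z.
Proof.
rewrite /qtent /qbox; case: unpickle => [[[a b] r]|]; last by rewrite ltxx.
rewrite lt_max ltxx /= subr_gt0; split=> [h|/ball2P//].
by apply/ball2P.
Qed.

Lemma qtent_continuous k : continuous (qtent k).
Proof.
rewrite /qtent; case: unpickle => [[[a b] r]|]; last by move=> z; exact: cvg_cst.
move=> z; apply: (@continuous_max _ _ (fun=> 0) (fun z => ratr r - `|(ratr a, ratr b) - z|)).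
  exact: cvg_cst.
apply: cvgB; first exact: cvg_cst.
by apply: cvg_norm; apply: cvgB; [exact: cvg_cst|exact: cvg_id].
Qed.

(** Continuous functions from 0 to 1 that vanish off [U] and, for open [U], converge pointwise to
    its indicator: the tents over the boxes contained in [U] are summed with growing weight and
    truncated at 1. *)
Definition tents U n z : R :=
  Num.min 1 (n%:R * \sum_(k < n | `[< qbox k `<=` U >]) qtent k z).

Lemma tents_continuous U n : continuous (tents U n).
Proof.
move=> z; apply: (@continuous_min _ _ (fun=> 1) (fun z => n%:R * _)); first exact: cvg_cst.
apply: (@cvgM _ _ _ _ (fun=> n%:R)); first exact: cvg_cst.
by apply: (@cvg_big _ _ +%R) => [w|k _]; [exact: add_continuous|exact: qtent_continuous].
Qed.

Lemma tents_bound U n z : 0 <= tents U n z <= 1.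
Proof.
rewrite /tents ge_min lexx andbT le_min ler01 /= mulr_ge0//.
by apply: sumr_ge0 => k _; exact: qtent_ge0.
Qed.

Lemma tents_out U n z : ~ U z -> tents U n z = 0.
Proof.
move=> nU; rewrite /tents big1 ?mulr0; first by apply/min_idPr; exact: ler01.
move=> k /asboolP kU; apply/eqP; rewrite eq_le qtent_ge0 andbT leNgt; apply/negP.
by move=> /qtent_gt0 /kU.
Qed.

Lemma tents_cvg U z : open (U : set (R * R)) -> U z -> tents U n z @[n --> \oo] --> (1 : R).
Proof.
move=> oU Uz; have [k [kz kU]] := qbox_basis oU Uz.
have t0 : 0 < qtent k z by apply/qtent_gt0.
apply: cvg_near_cst; near=> n.
have kn : (k < n)%N by near: n; exact: nbhs_infty_gt.
have nn : (qtent k z)^-1 <= n%:R by near: n; exact: nbhs_infty_ger.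
apply/min_idPl; apply: (@le_trans _ _ (n%:R * qtent k z)).
  by rewrite -ler_pdivrMr// mul1r.
rewrite ler_wpM2l// (bigD1 (Ordinal kn)) /=; last exact/asboolP.
by rewrite lerDl; apply: sumr_ge0 => i _; exact: qtent_ge0.
Unshelve. all: by end_near.
Qed.

(* Open sets form a pi-system generating the Borel sets, and their indicators
   are limits of continuous functions. *)
Lemma fundamental_lemma B h : open (B : set (R * R)) -> mu.-integrable B (EFin \o h) ->
  (forall psi, continuous psi -> (forall z, ~ B z -> psi z = 0) ->
    (forall z, 0 <= psi z <= 1) -> \int[mu]_(z in B) (h z * psi z) = 0) ->
  {ae mu, forall z, B z -> h z = 0}.
Proof.
move=> oB ih H; have mB := open_plane_measurable oB.
have hin S : measurable S -> mu.-integrable (B `&` S) (EFin \o h).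
  by move=> mS; apply: integrableS ih => //; exact: measurableI.
have fin S : measurable S -> (\int[mu]_(z in B `&` S) (h z)%:E)%E \is a fin_num.
  by move=> mS; apply: integrable_fin_num (hin _ mS) => //; exact: measurableI.
have mh : measurable_fun B h by apply/measurable_EFinP; exact: measurable_int ih.
have PO U : open (U : set (R * R)) -> (\int[mu]_(z in B `&` U) (h z)%:E = 0)%E.
  move=> oU; have oBU : open ((B `&` U) : set (R * R)) by exact: openI.
  have mBU := open_plane_measurable oBU.
  have sBU : B `&` U `<=` B by move=> z [].
  rewrite integral_mkcondr.
  have mt n : measurable_fun B (tents (B `&` U) n).
    by apply: continuous_plane_measurable => //; exact: tents_continuous.
  have := @dominated_cvg _ _ _ mu B mB
    (fun n z => (h z * tents (B `&` U) n z)%:E) ((EFin \o h) \_ U)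
    (fun z => `|h z|%:E).
  have cst0 n : (\int[mu]_(z in B) (h z * tents (B `&` U) n z)%:E = 0)%E.
    have i1 : mu.-integrable B (fun z => (h z * tents (B `&` U) n z)%:E).
      apply: le_integrable ih => //.
        by apply/measurable_EFinP; apply: measurable_funM; [exact: mh|exact: mt].
      move=> z Bz; rewrite lee_fin normrM ler_piMr//.
      by have /andP[t0 t1] := tents_bound (B `&` U) n z; rewrite ger0_norm.
    rewrite -(fineK (integrable_fin_num mB i1)); congr EFin; apply: H.
    - exact: tents_continuous.
    - by move=> z nB; apply: tents_out => -[].
    - by move=> z; exact: tents_bound.
  move=> HD; have {}HD : (\int[mu]_(z in B) (h z * tents (B `&` U) n z)%:E)%E @[n --> \oo] -->
      (\int[mu]_(z in B) ((EFin \o h) \_ U) z)%E; last first.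
    move: HD; rewrite (eq_cvg _ _ cst0) => HD.
    exact: (cvg_unique (@ereal_hausdorff R) HD (cvg_cst _)).
  apply: HD.
  - by move=> n; apply/measurable_EFinP; apply: measurable_funM; [exact: mh|exact: mt].
  - move=> z Bz; rewrite patchE; case: ifPn => [/set_mem Uz|/negP nU].
      apply: cvg_EFin; first exact: nearW.
      rewrite -[X in _ --> X](mulr1 (h z)); apply: cvgM; first exact: cvg_cst.
      exact: tents_cvg.
    rewrite (_ : (fun n => _) = fun=> 0%E); first exact: cvg_cst.
    by apply/funext => n; rewrite tents_out ?mulr0// => -[_ /mem_set].
  - by [].
  - exact: (integrable_norm ih).
  - move=> n z Bz; rewrite lee_fin normrM ler_piMr//.
    by have /andP[t0 t1] := tents_bound (B `&` U) n z; rewrite ger0_norm.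
have P S : measurable S -> (\int[mu]_(z in B `&` S) (h z)%:E = 0)%E.
  move=> mS; have : <<s [set U : set plane | open (U : set (R * R))] >> S.
    by rewrite -plane_measurableE.
  move: S {mS}; apply: dynkin_induction.
  - exact: plane_measurableE.
  - by move=> U V oU oV /=; exact: openI.
  - by apply: PO; exact: openT.
  - exact: PO.
  - move=> S mS HS; have := PO setT (@openT _); rewrite setIT.
    rewrite -[X in integral _ X _](setUIDK B S) integral_setU//=. 
    + by rewrite [X in (X + _)%E]HS add0e setDE.
    + exact: measurableI.
    + exact: measurableD.
    + by rewrite setUIDK; exact/measurable_EFinP.
    + apply/disj_set2P/seteqP; split=> z // [[_ Sz] [_ nSz]]; exact: nSz.
  - move=> F mF tF HF; rewrite setI_bigcupr integral_bigcup//.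
    + by rewrite eseries0// => i _ _; exact: HF.
    + exact: trivIset_setIl.
    + by move=> k; exact: measurableI mB (mF k).
    + rewrite -setI_bigcupr; apply: hin; exact: bigcupT_measurable.
have := @integral_ae_eq _ _ _ mu B mB (cst 0%E) (EFin \o h) ih (measurable_cst _).
have E0 E : E `<=` B -> measurable E ->
    (\int[mu]_(z in E) (EFin \o h) z = \int[mu]_(z in E) cst 0%E z)%E.
  by move=> EB mE; rewrite integral0 -[RHS](P E)//; congr (integral _ _ _); rewrite setIidr.
move=> /(_ E0); apply: ae_mono => z + Bz.
by move=> /(_ Bz) [].
Qed.


(** * Fubini for averages *)

Lemma lebesgue2_sigma_finite : sigma_finite setT mu.
Proof.
exists (fun n : nat => ball (0 : R * R) n%:R : set plane).
  apply/esym/seteqP; split=> // z _.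
  exists (Num.truncn `|z|).+1 => //; apply/ball2P.
  by rewrite sub0r normrN truncnS_gt.
move=> n; split; first exact: ball2_measurable.
by rewrite ball2_mu// ltry.
Qed.

Let mu2 : {sigma_finite_measure set plane -> \bar R} :=
  HB.pack_for {sigma_finite_measure set plane -> \bar R} (mu : set plane -> \bar R)
    (Measure.class mu)
    (isSFinite.Build _ _ _ (mu : set plane -> \bar R)
       (sfinite_measure_sigma_finite lebesgue2_sigma_finite))
    (isSigmaFinite.Build _ _ _ (mu : set plane -> \bar R) lebesgue2_sigma_finite).
(** Fubini on pairs of planes. As [f] is integrable only on [K], it is replaced by its extension by
    0; the last hypothesis says that the kernel never sees the difference. *)
Lemma kernel_swap f psi k K B m m' : measurable K -> measurable B ->
  mu.-integrable K (EFin \o f) -> (mu B < +oo)%E -> continuous k -> (forall z, `|k z| <= m) ->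
  continuous psi -> (forall z, `|psi z| <= m') -> (forall z, ~ B z -> psi z = 0) ->
  (forall q y, ~ K y -> psi q * k (y - q) = 0) ->
  \int[mu]_q (psi q * \int[mu]_y (f y * k (y - q))) =
  \int[mu]_y (f y * \int[mu]_q (psi q * k (y - q))).
Proof.
move=> mK mB fK Bfin ck km cpsi psim psiB Kout.
pose g := f \_ K.
have ig : mu.-integrable setT (EFin \o g).
  by have := (integrable_mkcond (mu := mu) (EFin \o f) mK).1 fK; rewrite restrict_EFin.
pose Phi (t : plane * plane) := psi t.1 * (g t.2 * k (t.2 - t.1)).
have mg : measurable_fun setT g by apply/measurable_EFinP; exact: measurable_int ig.
have mk : measurable_fun setT (k : plane -> R) by exact: continuous_plane_measurable.
have mpsi : measurable_fun setT (psi : plane -> R) by exact: continuous_plane_measurable.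
have mPhi : measurable_fun setT Phi.
  apply: measurable_funM; first exact: (measurableT_comp mpsi measurable_fst).
  apply: measurable_funM; first exact: (measurableT_comp mg measurable_snd).
  apply: (measurableT_comp mk (f := k) (g := fun t : plane * plane => t.2 - t.1)).
  apply: (@measurable_fun_pair _ _ _ _ _ _ (fun t : plane * plane => t.2.1 - t.1.1)
    (fun t : plane * plane => t.2.2 - t.1.2)).
    apply: measurable_funB.
      exact: (measurableT_comp measurable_fst measurable_snd).
    exact: (measurableT_comp measurable_fst measurable_fst).
  apply: measurable_funB.
    exact: (measurableT_comp measurable_snd measurable_snd).
  exact: (measurableT_comp measurable_snd measurable_fst).
have mP : measurable_fun setT (EFin \o Phi) by exact/measurable_EFinP.
have mtr q : measurable_fun setT (fun y : plane => k (y - q)).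
  apply: continuous_plane_measurable => // y.
  by apply: (@continuous_comp _ _ _ (fun y : R * R => y - q) k);
    [apply: cvgB; [exact: cvg_id|exact: cvg_cst]|exact: ck].
have mtl y : measurable_fun setT (fun q : plane => k (y - q)).
  apply: continuous_plane_measurable => // q.
  by apply: (@continuous_comp _ _ _ (fun q : R * R => y - q) k);
    [apply: cvgB; [exact: cvg_cst|exact: cvg_id]|exact: ck].
have m0 : 0 <= m by apply: le_trans (km 0).
have m'0 : 0 <= m' by apply: le_trans (psim 0).
have img : mu.-integrable setT (EFin \o (fun y => m * `|g y|)).
  exact: (integrableZl measurableT m (integrable_norm ig)).
have igk q : mu.-integrable setT (EFin \o (fun y => g y * k (y - q))).
  apply: le_integrable img => //.
    by apply/measurable_EFinP; apply: measurable_funM; [exact: mg|exact: mtr].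
  move=> y _; rewrite /= lee_fin normrM [leRHS]ger0_norm ?mulr_ge0// mulrC.
  by rewrite ler_wpM2r.
have iPq q : mu.-integrable setT (EFin \o (fun y => Phi (q, y))).
  exact: (integrableZl measurableT (psi q) (igk q)).
have icB c : mu.-integrable setT ((EFin \o cst c) \_ B).
  apply: (integrable_mkcond (mu := mu) (EFin \o cst c) mB).1.
  exact: integrable_cst_fin.
have ipk y : mu.-integrable setT (EFin \o (fun q => psi q * k (y - q))).
  apply: le_integrable (icB (m' * m)) => //.
    by apply/measurable_EFinP; apply: measurable_funM; [exact: mpsi|exact: mtl].
  move=> q _; rewrite /= patchE; case: ifPn => [_|/negP nB].
    by rewrite lee_fin normrM (ger0_norm (mulr_ge0 m'0 m0)) ler_pM.
  have nBq : ~ B q by move=> Bq; apply: nB; exact: mem_set.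
  by rewrite psiB// mul0r normr0 abse_ge0.
have iPy y : mu.-integrable setT (EFin \o (fun q => Phi (q, y))).
  have := integrableZl measurableT (g y) (ipk y); congr (integrable _ _ _).
  by apply/funext => q; rewrite /Phi /= mulrCA.
pose c := m' * \int[mu]_y (m * `|g y|).
have iPhi : (mu2 \x mu2)%E.-integrable setT (EFin \o Phi).
  apply/(integrable12ltyP _ _ mP).
  apply: (@le_lt_trans _ _ (\int[mu]_q ((EFin \o cst c) \_ B) q)%E); last first.
    by rewrite ltey_eq integrable_fin_num.
  apply: ge0_le_integral => //.
  - by move=> q _; apply: integral_ge0 => y _; exact: abse_ge0.
  - apply: (measurable_fun_fubini_tonelli_F (abse \o (EFin \o Phi))).
      exact: measurableT_comp.
    by move=> t; exact: abse_ge0.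
  - exact: measurable_int (icB c).
  - move=> q _; rewrite patchE; case: ifPn => [_|/negP nB]; last first.
      rewrite integral0_eq// => y _; rewrite /= /Phi/= psiB ?mul0r ?normr0//.
      by move=> Bq; apply: nB; exact: mem_set.
    have -> : (EFin \o cst c) q = (\int[mu]_y (m' * (m * `|g y|))%:E)%E.
      rewrite /= /c -RintegralZl//.
      exact: (fineK (integrable_fin_num measurableT (integrableZl measurableT m' img))).
    apply: ge0_le_integral => //.
    - by apply: measurableT_comp => //; exact: measurable_int (iPq q).
    - by apply: measurable_int; exact: (integrableZl measurableT m' img).
    - move=> y _; rewrite /= lee_fin /Phi/= normrM normrM ler_pM// mulrC ler_wpM2r//.
have E1 q : psi q * \int[mu]_y (f y * k (y - q)) = \int[mu]_y Phi (q, y).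
  have [Bq|nB] := eqVneq (psi q) 0.
    rewrite Bq mul0r /Phi/= Bq; under eq_Rintegral do rewrite mul0r.
    by rewrite /Rintegral integral0.
  have EE y : f y * k (y - q) = g y * k (y - q).
    rewrite /g patchE; case: ifPn => // /negP nK.
    have := Kout q y (fun Ky => nK (mem_set Ky)) => /eqP.
    by rewrite mulf_eq0 (negbTE nB)/= => /eqP ->; rewrite !mulr0.
  by under eq_Rintegral do rewrite EE; rewrite -RintegralZl.
have E2 y : f y * \int[mu]_q (psi q * k (y - q)) = \int[mu]_q Phi (q, y).
  have -> : \int[mu]_q Phi (q, y) = g y * \int[mu]_q (psi q * k (y - q)).
    by rewrite -RintegralZl//; under eq_Rintegral do rewrite /Phi/= mulrCA.
  rewrite /g patchE; case: ifPn => // /negP nK.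
  under eq_Rintegral do rewrite (Kout _ _ (fun Ky => nK (mem_set Ky))).
  by rewrite /Rintegral integral0 mulr0 mul0r.
under eq_Rintegral do rewrite E1.
under [RHS]eq_Rintegral do rewrite E2.
rewrite /Rintegral; congr fine.
under eq_integral do rewrite fineK ?(integrable_fin_num _ (iPq _))//.
under [RHS]eq_integral do rewrite fineK ?(integrable_fin_num _ (iPy _))//.
exact: (Fubini iPhi).
Qed.

End representative.

(** * The continuous representative *)

Section regular.
Variable R : realType.
Local Notation plane := (measurableTypeR R * measurableTypeR R)%type.
Local Notation mu := (lebesgue2 R).
Local Notation Kc := (Kc R).
Implicit Types (A B D U K : set plane) (f g h u psi : R * R -> R) (z w p q : R * R)
  (C c e m r s rho a : R) (M : 'M[R]_2).

Lemma norm_triangle3 (a b c d t1 t2 t3 : R) : `|a - b| <= t1 -> `|a - c| <= t2 ->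
  `|b - d| <= t3 -> `|c - d| <= t1 + t2 + t3.
Proof. by rewrite !ler_norml => /andP[? ?] /andP[? ?] /andP[? ?]; apply/andP; split; lra. Qed.

Lemma near_ball2 p r : 0 < r -> \forall q \near p, `|p - q| < r.
Proof. by move=> r0; apply/nbhs_ballP; exists r => //= q /ball2P. Qed.

Lemma near_cball p r : 0 < r -> \forall q \near p, `|p - q| <= r.
Proof. by move=> r0; apply: filterS (near_ball2 p r0) => q /ltW. Qed.

(** The convolution of [f] with [kap s], which approximates [Kc * f]. *)
Definition mean f s q := L f (shiftf (kap s) q).

Lemma intg_kap D f s q : 0 < s -> L1loc D f -> cball q (2 * s) `<=` D ->
  intg f (shiftf (kap s) q).
Proof.
move=> s0 lf qD; apply: (L1loc_intg lf); first exact: continuous_kap.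
exact: kap_supported.
Qed.

(** The difference is the pairing of [f] with a ring field; its negative is a test field too. *)
Lemma mean_ring A f e q s s' : 0 < s <= s' -> cball q (2 * s') `<=` A -> L1loc A f ->
  Vle A f e -> `|mean f s q - mean f s' q| <= e.
Proof.
move=> /andP[s0 ss] qA lf Vf.
have ss' : 0 < s <= s' by rewrite s0.
have s'0 := lt_le_trans s0 ss.
have qA' : cball q (2 * s) `<=` A.
  by apply: subset_trans qA => z /= hz; apply: (le_trans hz); rewrite ler_pM2l.
have HF := ring_field_field ss' qA.
have E : L f (div2 (ring_field q s s')) = mean f s q - mean f s' q.
  by rewrite /mean div2_ring_field L_subr//; [exact: (intg_kap s0 lf qA')|exact: (intg_kap s'0 lf qA)].
have h1 := Vf _ HF (fun z => opb_ring_field q z ss').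
have h2 := Vf _ (fieldN HF) (fun z => opbN (opb_ring_field q z ss')).
have E2 : (fun z => - ring_field q s s' z) = fun z => (-1) *: ring_field q s s' z.
  by apply/funext => z; rewrite scaleN1r.
move: h2; rewrite E2 div2Z; last exact: field_smoothF HF.
rewrite (L_scaler _ (intg_div2 lf HF)).
by rewrite mulN1r E lerNl => h2; rewrite ler_norml h2 -E.
Qed.

(** Near [p] the variation is below [e], so the means form a uniform Cauchy family there. A quarter
    of the radius from [ball_small] leaves room for all rings centred near [p]. *)
Lemma mean_uniform D f c p e : open (D : set (R * R)) -> D p -> L1loc D f ->
  Vle D f c -> 0 < e -> exists r, [/\ 0 < r, cball p (4 * r) `<=` D &
    forall q s s', `|p - q| <= r -> 0 < s <= r -> 0 < s' <= r ->
      `|mean f s q - mean f s' q| <= e].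
Proof.
move=> oD Dp lf Vf e0; have [r [r0 rD Vr]] := ball_small oD Dp lf Vf e0.
have r4 : 0 < r / 4 by rewrite divr_gt0.
exists (r / 4); split=> //.
  by apply: subset_trans rD => z /= hz; apply: (le_trans hz); lra.
have bD : ball p r `<=` D by apply: subset_trans rD; exact: ball_cball.
have lb : L1loc (ball p r) f.
  apply: (L1locS _ _ bD lf); first exact: ball2_measurable.
  exact: open_plane_measurable.
move=> q s s' pq.
have qb a : a <= r / 4 -> cball q (2 * a) `<=` ball p r.
  move=> ar z hz; apply/ball2P; have {}hz : `|q - z| <= 2 * a := hz.
  have -> : p - z = (p - q) + (q - z) by rewrite addrA subrK.
  by apply: (le_lt_trans (ler_normD _ _)); lra.
wlog ss : s s' / s <= s'.
  move=> H /[dup] s1 /andP[s0 sr] /[dup] s1' /andP[s0' sr'].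
  have [ss|ss] := leP s s'; first exact: H.
  by rewrite distrC; apply: H => //; exact: ltW.
move=> /andP[s0 sr] /andP[s0' sr']; apply: (mean_ring _ (qb _ sr') lb Vr).
by rewrite s0.
Qed.

Lemma mean_bound D f s rho p : 0 < s -> L1loc D f -> cball p (rho + 2 * s) `<=` D ->
  exists m, forall q, `|p - q| <= rho -> `|mean f s q| <= m.
Proof.
move=> s0 lf pD; have [C C0 HC] := kap_bound R.
set K : set plane := cball p (rho + 2 * s) in pD *.
have cK : compact (K : set (R * R)) := @cball_compact R p (rho + 2 * s).
have mK := compact_plane_measurable cK.
exists (C / s ^+ 2 * \int[mu]_(z in K) `|f z|) => q pq.
have qK : cball q (2 * s) `<=` K.
  move=> z hz; have {}hz : `|q - z| <= 2 * s := hz.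
  rewrite /K /cball /=; have -> : p - z = (p - q) + (q - z) by rewrite addrA subrK.
  by apply: (le_trans (ler_normD _ _)); lra.
apply: L_bound => //.
- exact: (lf.2 K cK pD).
- apply: (intg_kap s0 lf); exact: subset_trans pD.
- move=> z nK; apply: kap_out => //; rewrite ltNge; apply/negP => hz; apply: nK; apply: qK.
  by rewrite /cball /= distrC.
- by move=> z _; exact: HC.
Qed.

Lemma mean_continuous D f s p r : 0 < s -> 0 < r -> L1loc D f -> cball p (r + 2 * s) `<=` D ->
  {for p, continuous (mean f s)}.
Proof.
move=> s0 r0 lf pD.
set K : set plane := cball p (r + 2 * s) in pD *.
have cK : compact (K : set (R * R)) := @cball_compact R p (r + 2 * s).
have mK := compact_plane_measurable cK.
have supp : supported setT (@kap R s).
  by apply: (@supported_out_norm _ _ (2 * s)) => z; exact: kap_out.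
have [C C0 HC] := smooth_lipschitz (smooth_kap s) supp.
have fK := lf.2 K cK pD.
set I := \int[mu]_(z in K) `|f z|.
have I0 : 0 <= I by apply: Rintegral_ge0.
have lip q : `|p - q| <= r -> `|mean f s p - mean f s q| <= C * `|p - q| * I.
  move=> pq.
  have qK : cball q (2 * s) `<=` K.
    move=> z hz; have {}hz : `|q - z| <= 2 * s := hz.
    rewrite /K /cball /=; have -> : p - z = (p - q) + (q - z) by rewrite addrA subrK.
    by apply: (le_trans (ler_normD _ _)); lra.
  have pK : cball p (2 * s) `<=` K by move=> z hz; apply: (le_trans hz); lra.
  have i1 := intg_kap s0 lf (subset_trans pK pD).
  have i2 := intg_kap s0 lf (subset_trans qK pD).
  rewrite /mean -L_subr//; apply: L_bound => //.
  - have := integrableB measurableT i1 i2; congr (integrable _ _ _).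
    by apply/funext => z; rewrite /= -EFinB mulrBr.
  - move=> z nK; rewrite /shiftf !kap_out ?subrr//.
      by rewrite ltNge; apply/negP => hz; apply: nK; apply: qK; rewrite /cball /= distrC.
    by rewrite ltNge; apply/negP => hz; apply: nK; apply: pK; rewrite /cball /= distrC.
  - move=> z _; apply: (le_trans (HC _ _)).
    have -> : z - p - (z - q) = q - p by rewrite opprB addrC addrA subrK.
    by rewrite distrC.
apply/cvgrPdist_le => e e0.
have CI : 0 < C * I + 1 by rewrite ltr_wpDl// mulr_ge0// ltW.
have d0 : 0 < Num.min r (e / (C * I + 1)) by rewrite lt_min r0 divr_gt0.
near=> q.
have pq : `|p - q| < Num.min r (e / (C * I + 1)).
  by near: q; exact: near_ball2.
have [pr pe] : `|p - q| <= r /\ `|p - q| <= e / (C * I + 1).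
  by move: pq; rewrite lt_min => /andP[/ltW ? /ltW ?].
apply: (le_trans (lip q pr)).
rewrite mulrAC; apply: (@le_trans _ _ ((C * I + 1) * `|p - q|)).
  by rewrite ler_wpM2r// lerDl.
by rewrite mulrC -ler_pdivlMr.
Unshelve. all: by end_near.
Qed.

Definition scale n : R := n.+1%:R^-1.

Lemma scale_gt0 n : 0 < scale n. Proof. by rewrite invr_gt0. Qed.

Lemma scale_small e : 0 < e -> exists N, forall n, (N <= n)%N -> scale n <= e.
Proof.
move=> e0; exists (Num.truncn e^-1) => n Nn; rewrite /scale -[leRHS]invrK.
rewrite lef_pV2 ?posrE ?invr_gt0//.
by apply: (le_trans (ltW (truncnS_gt _))); rewrite ler_nat ltnS.
Qed.

(** The candidate for the continuous representative, a locally uniform limit of continuous means;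
    division by the mass of the kernel makes it agree with [f]. *)
Definition rep f q : R := lim (mean f (scale n) q @[n --> \oo]) / Kc.

Lemma mean_cvg D f c q : open (D : set (R * R)) -> D q -> L1loc D f -> Vle D f c ->
  mean f (scale n) q @[n --> \oo] --> Kc * rep f q.
Proof.
move=> oD Dq lf Vf.
rewrite /rep mulrCA divff ?mulr1; last by rewrite gt_eqF// Kc_gt0.
apply: cauchy_cvg; apply: cauchy_exP => e e0.
have e2 : 0 < e / 2 by rewrite divr_gt0.
have [r [r0 rD Hr]] := mean_uniform oD Dq lf Vf e2.
exists (mean f r q); have [N HN] := scale_small r0.
exists N => // n /= Nn; rewrite /ball /=; apply: (@le_lt_trans _ _ (e / 2)); last by lra.
by apply: Hr; rewrite ?subrr ?normr0 ?(ltW r0) ?r0 ?lexx ?scale_gt0 ?HN.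
Qed.

Lemma mean_rep D f c p r e : open (D : set (R * R)) -> L1loc D f -> Vle D f c ->
  0 < r -> cball p (4 * r) `<=` D ->
  (forall q s s', `|p - q| <= r -> 0 < s <= r -> 0 < s' <= r ->
      `|mean f s q - mean f s' q| <= e) ->
  forall q s, `|p - q| <= r -> 0 < s <= r -> `|mean f s q - Kc * rep f q| <= e.
Proof.
move=> oD lf Vf r0 rD H q s pq sr.
have Dq : D q by apply: rD; rewrite /cball /=; lra.
have cv := mean_cvg oD Dq lf Vf.
have [N HN] := scale_small r0.
have : `|mean f s q - mean f (scale n) q| @[n --> \oo] --> `|mean f s q - Kc * rep f q|.
  by apply: cvg_norm; apply: cvgB; [exact: cvg_cst|exact: cv].
move=> cv2; apply: (@ler_cvg_to _ _ _ _ _ _ _ _ cv2 (cvg_cst e)).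
exists N => // n /= Nn.
by apply: H => //; rewrite scale_gt0 HN.
Qed.

Lemma rep_continuous D f c p : open (D : set (R * R)) -> D p -> L1loc D f -> Vle D f c ->
  {for p, continuous (rep f)}.
Proof.
move=> oD Dp lf Vf; apply/cvgrPdist_le => e e0.
have K0 := Kc_gt0 R.
have e1 : 0 < e * Kc / 3 by rewrite divr_gt0// mulr_gt0.
have [r [r0 rD Hr]] := mean_uniform oD Dp lf Vf e1.
have H := mean_rep oD lf Vf r0 rD Hr.
have rD' : cball p (r + 2 * r) `<=` D.
  by apply: subset_trans rD => z /= hz; apply: (le_trans hz); lra.
have /cvgrPdist_le/(_ _ e1) := mean_continuous r0 r0 lf rD'.
move=> near_q; near=> q.
have pq : `|p - q| <= r.
  by near: q; exact: near_cball.
have h1 : `|mean f r p - mean f r q| <= e * Kc / 3 by near: q.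
have h2 := H p r; have h3 := H q r pq; rewrite r0 lexx in h2 h3.
have {}h2 := h2 _ isT; rewrite subrr normr0 in h2; have {}h2 := h2 (ltW r0).
have {}h3 := h3 isT.
have := norm_triangle3 h1 h2 h3.
rewrite -mulrBr normrM gtr0_norm// (_ : _ + _ + _ = Kc * e); last by field.
by rewrite ler_pM2l.
Unshelve. all: by end_near.
Qed.

Lemma mean_bounded : exists2 C, 0 < C & forall psi s q, 0 < s -> continuous psi ->
  (forall z, 0 <= psi z <= 1) -> `|mean psi s q| <= C.
Proof.
have [C C0 HC] := kap_bound R.
(* Kernel size [C / s ^+ 2] times the area [36 * s ^+ 2] of the square used. *)
exists (C * 36); first by rewrite mulr_gt0.
move=> psi s q s0 cpsi b1.
pose K : set plane := ball q (3 * s).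
have mK : measurable K by exact: ball2_measurable.
have muK : mu K = ((3 * s *+ 2) ^+ 2)%:E by rewrite ball2_mu// mulr_ge0// ltW.
have muKf : (mu K < +oo)%E by rewrite muK ltry.
have lpsi : L1loc setT psi.
  by apply: L1loc_continuous; [exact: openT|apply: continuous_subspaceT].
have iK : mu.-integrable K (EFin \o psi).
  have cc := @cball_compact R q (3 * s).
  exact: (integrableS (compact_plane_measurable cc) mK (@ball_cball R q (3 * s)) (lpsi.2 _ cc (@subsetT _ _))).
have h : `|mean psi s q| <= C / s ^+ 2 * \int[mu]_(z in K) `|psi z|.
  apply: L_bound => //.
  - exact: (intg_kap s0 lpsi).
  - move=> z nK; apply: kap_out => //; rewrite ltNge; apply/negP => hz; apply: nK.
    by apply/ball2P; rewrite distrC; lra.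
  - by move=> z _; exact: HC.
apply: (le_trans h).
have : \int[mu]_(z in K) `|psi z| <= \int[mu]_(z in K) 1.
  apply: le_Rintegral => //.
  - exact: (integrable_norm iK).
  - exact: integrable_cst_fin.
  - by move=> z _; have /andP[p0 p1] := b1 z; rewrite ger0_norm.
rewrite Rintegral_cst// muK /= mul1r => hI.
apply: (@le_trans _ _ (C / s ^+ 2 * (3 * s *+ 2) ^+ 2)).
  by apply: ler_wpM2l => //; rewrite divr_ge0 ?ltW// exprn_gt0.
rewrite mulr2n le_eqVlt; apply/orP; left; apply/eqP; field.
by rewrite gt_eqF.
Qed.


Lemma continuous_within D g : (forall z, D z -> {for z, continuous g}) ->
  {within D, continuous g}.
Proof. by move=> H; apply: continuous_in_subspaceT => z /set_mem; exact: H. Qed.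

Lemma continuous_on_measurable D g : open (D : set (R * R)) ->
  (forall z, D z -> {for z, continuous g}) -> measurable_fun D g.
Proof. by move=> oD H; apply: continuous_within_measurable => //; exact: continuous_within. Qed.

Lemma cvg_shift N (u : nat -> R) (l : R) :
  u n @[n --> \oo] --> l <-> u (n + N)%N @[n --> \oo] --> l.
Proof. by rewrite -(cvg_shiftn N). Qed.

Lemma mean_weak_lim D f c p r e psi : open (D : set (R * R)) -> L1loc D f -> Vle D f c ->
  0 < r -> cball p (4 * r) `<=` D ->
  (forall q s s', `|p - q| <= r -> 0 < s <= r -> 0 < s' <= r ->
      `|mean f s q - mean f s' q| <= e) ->
  continuous psi -> (forall z, ~ ball p (r / 2) z -> psi z = 0) ->
  L (mean f (scale n)) psi @[n --> \oo] --> L (fun q => Kc * rep f q) psi.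
Proof.
move=> oD lf Vf r0 rD H cpsi psi0.
(* The sequence is shifted by [N] so that every scale is at most [r], as the uniform estimates
   require. *)
have [N HN] := scale_small r0.
have bD : ball p r `<=` D.
  by apply: subset_trans rD => z /ball2P hz; apply: (le_trans (ltW hz)); lra.
have key : L (mean f (scale (n + N))) psi @[n --> \oo] --> L (fun q => Kc * rep f q) psi.
  apply: (@L_dominated R (ball p r)) => //; first exact: ball_open.
  - move=> n; apply: continuous_on_measurable; first exact: ball_open.
    move=> z /ball2P hz; apply: (@mean_continuous D f _ z (r / 2)) => //.
    + exact: scale_gt0.
    + by rewrite divr_gt0.
    + apply: subset_trans rD => w hw; have {}hw : `|z - w| <= r / 2 + 2 * scale (n + N) := hw.
      have hs := HN (n + N)%N (leq_addl _ _).
      rewrite /cball /=; have -> : p - w = (p - z) + (z - w) by rewrite addrA subrK.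
      by apply: (le_trans (ler_normD _ _)); lra.
  - apply: continuous_on_measurable; first exact: ball_open.
    move=> z hz; apply: cvgM; first exact: cvg_cst.
    by apply: rep_continuous Vf => //; exact: bD.
  - apply: aeW => z hz.
    exact: (cvg_shift N (fun n => mean f (scale n) z) _).1 (mean_cvg oD (bD _ hz) lf Vf).
  - move=> K cK KB; have r3D : cball p (r + 2 * r) `<=` D.
      by apply: subset_trans rD => w hw; apply: (le_trans hw); lra.
    have [m Hm] := mean_bound r0 lf r3D.
    exists (e + m) => n z /KB /ball2P /ltW pz.
    have hs : 0 < scale (n + N) <= r by rewrite scale_gt0 HN// leq_addl.
    have rr : 0 < r <= r by rewrite r0 lexx.
    have h1 := H z _ _ pz hs rr; have h2 := Hm z pz.
    rewrite -[X in `|X|](subrK (mean f r z)); apply: (le_trans (ler_normD _ _)).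
    exact: lerD.
  - exists (cball p (r / 2)); split; first exact: cball_compact.
    + by move=> z hz; apply/ball2P; apply: (le_lt_trans hz); lra.
    + by move=> z nz; apply: psi0 => /ball2P hz; apply: nz; exact: ltW.
exact: (cvg_shift N (fun n => L (mean f (scale n)) psi) _).2 key.
Qed.

Lemma mean_swap D f psi p r s : open (D : set (R * R)) -> L1loc D f ->
  0 < s <= r -> cball p (3 * r) `<=` D -> continuous psi ->
  (forall z, ~ ball p (r / 2) z -> psi z = 0) -> (forall z, 0 <= psi z <= 1) ->
  L (mean f s) psi = L f (mean psi s).
Proof.
move=> oD lf /andP[s0 sr] rD cpsi psi0 psi1.
have [C C0 HC] := kap_bound R.
have cK := @cball_compact R p (3 * r).
have E q y : shiftf (kap s) y q = shiftf (kap s) q y.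
  by rewrite /shiftf -opprB kap_even.
rewrite /L /mean.
have := @kernel_swap R f psi (kap s) (cball p (3 * r)) (ball p (r / 2)) (C / s ^+ 2) 1
  (compact_plane_measurable cK) (ball2_measurable _ _) (lf.2 _ cK rD).
rewrite ball2_mu ?ltry; last by lra.
move=> /(_ isT (smooth_continuous (smooth_kap s)) (fun z => HC s z s0) cpsi).
have p1 z : `|psi z| <= 1 by have /andP[? ?] := psi1 z; rewrite ger0_norm.
move=> /(_ p1 psi0) Hs.
under eq_Rintegral do rewrite mulrC.
rewrite [LHS]Hs; last first.
  move=> q y ny; have [hq|nq] := pselect (ball p (r / 2) q); last by rewrite psi0 ?mul0r.
  suff hy : 2 * s < `|y - q| by rewrite (kap_out s0 hy) mulr0.
  rewrite ltNge; apply/negP => hy; apply: ny; rewrite /cball /=.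
  move/ball2P: hq => hq; rewrite distrC in hy.
  have -> : p - y = (p - q) + (q - y) by rewrite addrA subrK.
  by apply: (le_trans (ler_normD _ _)); clear -hq hy sr s0; lra.
apply: eq_Rintegral => y _; congr (_ * _); apply: eq_Rintegral => q _.
by rewrite -E.
Qed.

(** Here the averaging has been moved to the continuous [psi], where [kap_lim] applies at every
    point; [mean_bounded] supplies the domination. *)
Lemma weak_mean_lim D f psi p r : open (D : set (R * R)) -> L1loc D f ->
  0 < r -> cball p (3 * r) `<=` D -> continuous psi ->
  (forall z, ~ ball p (r / 2) z -> psi z = 0) -> (forall z, 0 <= psi z <= 1) ->
  L f (mean psi (scale n)) @[n --> \oo] --> L f (fun z => psi z * Kc).
Proof.
move=> oD lf r0 rD cpsi psi0 psi1.
have [N HN] := scale_small r0.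
have cK := @cball_compact R p (3 * r).
set K : set plane := cball p (3 * r) in rD cK *.
have mK : measurable K := compact_plane_measurable cK.
have fK := lf.2 K cK rD.
have [C C0 HC] := mean_bounded.
have lpsi : L1loc setT psi.
  by apply: L1loc_continuous; [exact: openT|apply: continuous_subspaceT].
have pB z : ~ K z -> forall q, ball p (r / 2) q -> 2 * r < `|q - z|.
  move=> nK q /ball2P hq; rewrite ltNge; apply/negP => h; apply: nK; rewrite /K /cball /=.
  have -> : p - z = (p - q) + (q - z) by rewrite addrA subrK.
  by apply: (le_trans (ler_normD _ _)); lra.
have out n z : ~ K z -> mean psi (scale (n + N)) z = 0.
  move=> nK; rewrite /mean /L (_ : (fun q => _) = fun=> 0); first by rewrite /Rintegral integral0.
  apply/funext => q; have [hq|nq] := pselect (ball p (r / 2) q); last by rewrite psi0 ?mul0r.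
  rewrite /shiftf kap_out ?mulr0 ?scale_gt0//; apply: le_lt_trans (pB z nK q hq).
  by rewrite ler_pM2l// HN// leq_addl.
have EL n : L f (mean psi (scale (n + N))) =
    \int[mu]_(z in K) (f z * mean psi (scale (n + N)) z).
  by apply: (@Rintegral_supp _ K (fun z => f z * _)) => // z /out ->; rewrite mulr0.
have EL2 : L f (fun z => psi z * Kc) = \int[mu]_(z in K) (f z * (psi z * Kc)).
  apply: (@Rintegral_supp _ K (fun z => f z * (psi z * Kc))) => // z nK.
  rewrite psi0 ?mul0r ?mulr0// => /(pB z nK); rewrite subrr normr0; lra.
apply: (cvg_shift N (fun n => L f (mean psi (scale n))) _).2.
rewrite EL2 (eq_cvg _ _ EL).
have mf : measurable_fun K f by apply/measurable_EFinP; exact: measurable_int fK.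
have mpsi n : measurable_fun K (mean psi (scale (n + N))).
  apply: (@measurable_funS _ _ _ _ setT) => //; apply: continuous_on_measurable; first exact: openT.
  by move=> z _; apply: (@mean_continuous setT psi _ z 1) => //; exact: scale_gt0.
have ifK : mu.-integrable K (EFin \o (fun z => C * `|f z|)).
  exact: (integrableZl mK C (integrable_norm fK)).
have := @dominated_cvg _ _ _ mu K mK (fun n z => (f z * mean psi (scale (n + N)) z)%:E)
  (fun z => (f z * (psi z * Kc))%:E) (fun z => (C * `|f z|)%:E).
have i2 : mu.-integrable K (fun z => (f z * (psi z * Kc))%:E).
  apply: (le_integrable mK _ _ (integrableZl mK Kc fK)).
    apply/measurable_EFinP; apply: measurable_funM; first exact: mf.
    by apply: measurable_funM => //; exact: continuous_plane_measurable.
  move=> z Kz; rewrite lee_fin /= mulrA [leRHS]normrM mulrC normrM ler_wpM2l//.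
  by rewrite normrM ler_piMr// ger0_norm; have /andP[? ?] := psi1 z.
move=> HD; apply: fine_cvg.
have -> : (fine (\int[mu]_(z in K) (f z * (psi z * Kc))%:E))%:E =
    (\int[mu]_(z in K) (f z * (psi z * Kc))%:E)%E.
  by rewrite fineK//; exact: integrable_fin_num.
apply: HD => //.
- by move=> n; apply/measurable_EFinP; apply: measurable_funM; [exact: mf|exact: mpsi].
- move=> z Kz; apply: cvg_EFin; first exact: nearW.
  apply: cvgM; first exact: cvg_cst.
  apply: (cvg_shift N (fun n => mean psi (scale n) z) _).1.
  apply/cvgrPdist_le => e e0.
  have [s0 s00 Hs] := kap_lim (@openT _) I lpsi (cpsi z) e0.
  have [N' HN'] := scale_small (divr_gt0 s00 (ltr0n _ 2)).
  exists N' => // n /= Nn; rewrite distrC; apply: Hs; rewrite scale_gt0/=.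
  by apply: (le_lt_trans (HN' n Nn)); lra.
- move=> n z Kz; rewrite lee_fin normrM mulrC ler_wpM2r//; apply: HC => //; exact: scale_gt0.
Qed.


Lemma L1loc_cont D g : open (D : set (R * R)) -> (forall z, D z -> {for z, continuous g}) ->
  L1loc D g.
Proof. by move=> oD H; apply: L1loc_continuous => //; exact: continuous_within. Qed.

Lemma within_continuousP D g : open (D : set (R * R)) ->
  {within D, continuous g} <-> forall z, D z -> {for z, continuous g}.
Proof.
move=> oD; split; last exact: continuous_within.
by rewrite (@continuous_open_subspace _ _ D g oD) => H z Dz; apply: H; exact: mem_set.
Qed.

(** The means of [f], tested with [psi], tend to [Kc * rep f]; with the averaging moved to [psi]
    they tend to [Kc * f]. So [f - rep f] is annihilated by every such [psi]. *)
Lemma rep_ae_local D f c p : open (D : set (R * R)) -> D p -> L1loc D f -> Vle D f c ->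
  exists2 r, 0 < r & {ae mu, forall z, ball p r z -> f z = rep f z}.
Proof.
move=> oD Dp lf Vf.
have [r [r0 rD Hr]] := mean_uniform oD Dp lf Vf ltr01.
exists (r / 2); first by rewrite divr_gt0.
have K0 := Kc_gt0 R.
have crep z : D z -> {for z, continuous (rep f)} by move=> Dz; exact: rep_continuous Vf.
have lrep := L1loc_cont oD crep.
have cK := @cball_compact R p (r / 2).
have KD : cball p (r / 2) `<=` D.
  by apply: subset_trans rD => z hz; apply: (le_trans hz); lra.
have r3D : cball p (3 * r) `<=` D.
  by apply: subset_trans rD => z hz; apply: (le_trans hz); lra.
have mK := compact_plane_measurable cK.
have mB : measurable (ball p (r / 2) : set plane) by exact: ball2_measurable.
have ifB : mu.-integrable (ball p (r / 2) : set plane) (EFin \o f).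
  exact: (integrableS mK mB (@ball_cball R p (r / 2)) (lf.2 _ cK KD)).
have irB : mu.-integrable (ball p (r / 2) : set plane) (EFin \o rep f).
  exact: (integrableS mK mB (@ball_cball R p (r / 2)) (lrep.2 _ cK KD)).
have ihB : mu.-integrable (ball p (r / 2) : set plane) (EFin \o (fun z => f z - rep f z)).
  have := integrableB mB ifB irB; congr (integrable _ _ _).
suff H : {ae mu, forall z, ball p (r / 2) z -> f z - rep f z = 0}.
  apply: ae_mono H => z /[apply] /eqP.
  by rewrite subr_eq0 => /eqP.
apply: (fundamental_lemma (ball_open _ _) ihB) => psi cpsi psi0 psi1.
have supp : supported D psi.
  exists (cball p (r / 2)); split=> //.
  by move=> z nz; apply: psi0 => /ball_cball.
have h1 := mean_weak_lim oD lf Vf r0 rD Hr cpsi psi0.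
have h2 := weak_mean_lim oD lf r0 r3D cpsi psi0 psi1.
have E : L (fun q => Kc * rep f q) psi = L f (fun z => psi z * Kc).
  apply: (cvg_unique (@Rhausdorff R) h1).
  apply: cvg_trans h2; apply: near_eq_cvg.
  have [N HN] := scale_small r0; exists N => // n /= Nn.
  by apply/esym; apply: (mean_swap oD lf _ r3D cpsi psi0 psi1); rewrite scale_gt0 HN.
have if' : intg f psi by exact: L1loc_intg lf cpsi supp.
have ir' : intg (rep f) psi by exact: L1loc_intg lrep cpsi supp.
have E2 : L f psi = L (rep f) psi.
  have E3 : L f (fun z => psi z * Kc) = Kc * L f psi.
    by rewrite -L_scaler//; apply: eq_L => z; rewrite [Kc * _]mulrC.
  move: E; rewrite E3 (@L_scalel _ (rep f) Kc psi ir') => /(mulfI _) -> //.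
  by rewrite gt_eqF.
transitivity (L (fun z => f z - rep f z) psi); last by rewrite L_subl// E2 subrr.
rewrite /L (@Rintegral_supp _ (ball p (r / 2)) (fun z => (f z - rep f z) * psi z))//.
by move=> z /psi0 ->; rewrite mulr0.
Qed.

Lemma rep_ae D f c : open (D : set (R * R)) -> L1loc D f -> Vle D f c ->
  {ae mu, forall z, D z -> f z = rep f z}.
Proof.
move=> oD lf Vf.
(* Stated as an implication, this holds almost everywhere for every box, good or bad, so that the
   countable intersection over all [k] can be taken. *)
pose P k z := {ae mu, forall w, qbox k w -> f w = rep f w} -> qbox k z -> f z = rep f z.
have : {ae mu, forall z, forall k, P k z}.
  apply: ae_foralln => k.
  have [H|nH] := pselect {ae mu, forall w, qbox k w -> f w = rep f w}.
    by apply: ae_mono H => z + _.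
  by apply: aeW => z /nH.
apply: ae_mono => z H Dz.
have [r r0 Hr] := rep_ae_local oD Dz lf Vf.
have [k [kz kr]] := qbox_basis (ball_open z r) (ballxx z r0).
apply: (H k) => //.
by apply: ae_mono Hr => w + /kr.
Qed.

Lemma L_ae D f g psi : open (D : set (R * R)) -> {ae mu, forall z, D z -> f z = g z} ->
  L1loc D f -> L1loc D g -> continuous psi -> supported D psi -> L f psi = L g psi.
Proof.
move=> oD fg lf lg cpsi supp; rewrite /L /Rintegral; congr fine.
have mi h : L1loc D h -> measurable_fun setT (fun z => (h z * psi z)%:E).
  by move=> lh; exact: measurable_int (L1loc_intg lh cpsi supp).
apply: ae_eq_integral => //; [exact: mi|exact: mi|].
apply: ae_mono fg => z H _.
have [Dz|nD] := pselect (D z); first by rewrite H.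
by rewrite (supported_out supp nD) !mulr0.
Qed.

Lemma Vle_ae D f g c : open (D : set (R * R)) -> {ae mu, forall z, D z -> f z = g z} ->
  L1loc D f -> L1loc D g -> Vle D f c -> Vle D g c.
Proof.
move=> oD fg lf lg Vf F HF F1.
rewrite -(L_ae oD fg lf lg) ?Vf//; [exact: continuous_div2 HF|exact: supported_div2].
Qed.

Lemma continuous_ae_eq D f g : open (D : set (R * R)) ->
  (forall z, D z -> {for z, continuous f}) -> (forall z, D z -> {for z, continuous g}) ->
  {ae mu, forall z, D z -> f z = g z} -> forall z, D z -> f z = g z.
Proof.
move=> oD cf cg fg z Dz; apply/eqP/negPn/negP => ne.
have cd : {for z, continuous (fun z => f z - g z)} by apply: cvgB; [exact: cf|exact: cg].
have d0 : 0 < `|f z - g z| by rewrite normr_gt0 subr_eq0.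
have dn : \forall w \near z, 0 < `|f w - g w| by exact: cd (norm_gt_near d0).
have Dn : nbhs z D by exact: open_nbhs_nbhs.
have /nbhs_ballP[r /= r0 Hr] : nbhs z ([set w | 0 < `|f w - g w|] `&` D) by exact: filterI.
have [N [mN N0 HN]] := fg.
have BN : ball z r `<=` N.
  move=> w /Hr[h Dw]; apply: HN => /(_ Dw) E; move: h.
  by rewrite /= E subrr normr0 ltxx.
have B0 := le_measure mu (mem_set (ball2_measurable z r)) (mem_set mN) BN.
have : (mu (ball z r) <= 0%:E)%E by apply: (le_trans B0); rewrite le_eqVlt; apply/orP; left; apply/eqP.
rewrite ball2_mu ?(ltW r0)// lee_fin leNgt => /negP; apply.
by rewrite exprn_gt0// mulrn_wgt0.
Qed.

Lemma point_value_eq D f g z : open (D : set (R * R)) -> D z ->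
  (forall z, D z -> {for z, continuous g}) -> {ae mu, forall z, D z -> f z = g z} ->
  point_value D f z = g z.
Proof.
move=> oD Dz cg fg; rewrite /point_value.
case: xgetP => [h -> [/(within_continuousP _ oD) ch fh]|/(_ g)[]]; last first.
  by split=> //; exact: continuous_within.
apply: (continuous_ae_eq oD ch cg) => //.
apply: (@filterS2 _ _ (ae_filter_ringOfSetsType mu) _ _ _ _ fg fh) => w H1 H2 Dw.
by rewrite -H1// H2.
Qed.

End regular.

(** * Local affine approximation *)

Section taylor.
Variable R : realType.
Local Notation plane := (measurableTypeR R * measurableTypeR R)%type.
Local Notation mu := (lebesgue2 R).
Local Notation Kc := (Kc R).
Implicit Types (A B D U K : set plane) (f g h u psi : R * R -> R) (z w p q : R * R)
  (C c e m r s rho : R).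

Lemma prod_norm_lt z r : (`|z| < r) = (`|z.1| < r) && (`|z.2| < r).
Proof. by rewrite [`|z|]prod_normE gt_max. Qed.

(** The mean value theorem along two axis-parallel segments; the corner stays in the ball because
    the norm is the sup norm. *)
Lemma increment u (du : 'I_2 -> R * R -> R) p r :
  (forall i q, `|p - q| < r -> is_derive q (basis_vector R i) u (du i q)) ->
  forall q, `|p - q| < r -> exists w1 w2, [/\ `|p - w1| < r, `|p - w2| < r &
    u q - u p = (q.1 - p.1) * du ord0 w1 + (q.2 - p.2) * du o1 w2].
Proof.
move=> dU q; rewrite prod_norm_lt => /andP[q1 q2].
pose q' : R * R := (p.1, q.2).
have E1 t : t *: basis_vector R o1 + p = (p.1, t + p.2).
  by rewrite /basis_vector/=; congr (_, _) => /=; rewrite ?scaler0 ?add0r// [_ *: _]mulr1.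
have E0 t : t *: basis_vector R ord0 + q' = (t + p.1, q.2).
  by rewrite /basis_vector/=; congr (_, _) => /=; rewrite ?scaler0 ?add0r// [_ *: _]mulr1.
have in1 t : `|t| <= `|q.2 - p.2| -> `|p - (t *: basis_vector R o1 + p)| < r.
  move=> ht; rewrite E1 prod_norm_lt /= subrr normr0 (le_lt_trans _ q1)//=.
  rewrite opprD addrCA subrr addr0 normrN; apply: (le_lt_trans ht).
  by rewrite distrC.
have in0 t : `|t| <= `|q.1 - p.1| -> `|p - (t *: basis_vector R ord0 + q')| < r.
  move=> ht; rewrite E0 prod_norm_lt /= q2 andbT.
  rewrite opprD addrCA subrr addr0 normrN; apply: (le_lt_trans ht).
  by rewrite distrC.
have [c1 hc1] := @MVT_on_line R u (basis_vector R o1) p (du o1) (q.2 - p.2)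
  (fun t ht => dU o1 _ (in1 t ht)).
have [c0 hc0] := @MVT_on_line R u (basis_vector R ord0) q' (du ord0) (q.1 - p.1)
  (fun t ht => dU ord0 _ (in0 t ht)).
have -> : (q.1 - p.1) *: basis_vector R ord0 + q' = q.
  by rewrite E0 subrK -surjective_pairing.
have -> : (q.2 - p.2) *: basis_vector R o1 + p = q' by rewrite E1 subrK.
move=> H0 H1; exists (c0 *: basis_vector R ord0 + q'), (c1 *: basis_vector R o1 + p).
split; [exact: in0|exact: in1|].
by rewrite -H0 -H1; ring.
Qed.

Lemma taylor2 u (du : 'I_2 -> R * R -> R) (ddu : 'I_2 -> 'I_2 -> R * R -> R) p r m :
  (forall i q, `|p - q| < r -> is_derive q (basis_vector R i) u (du i q)) ->
  (forall i j q, `|p - q| < r -> is_derive q (basis_vector R j) (du i) (ddu i j q)) ->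
  (forall i j q, `|p - q| < r -> `|ddu i j q| <= m) ->
  forall q, `|p - q| < r ->
    `|u q - (u p + (q.1 - p.1) * du ord0 p + (q.2 - p.2) * du o1 p)| <= 4 * m * r ^+ 2.
Proof.
move=> dU ddU Hm q pq.
have r0 : 0 <= r by exact: le_trans (ltW pq).
have m0 : 0 <= m by apply: le_trans (Hm ord0 ord0 q pq).
have bd i w : `|p - w| < r -> `|du i w - du i p| <= 2 * m * r.
  move=> pw; have [w1 [w2 [h1 h2 ->]]] := increment (ddU i) pw.
  move: pw; rewrite prod_norm_lt distrC => /andP[/= a1]; rewrite distrC => a2.
  apply: (le_trans (ler_normD _ _)); rewrite !normrM.
  have : `|w.1 - p.1| * `|ddu i ord0 w1| <= r * m by apply: ler_pM => //; [exact: ltW|exact: Hm].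
  have : `|w.2 - p.2| * `|ddu i o1 w2| <= r * m by apply: ler_pM => //; [exact: ltW|exact: Hm].
  by lra.
have [w1 [w2 [h1 h2 E]]] := increment dU pq.
have -> : u q - (u p + (q.1 - p.1) * du ord0 p + (q.2 - p.2) * du o1 p) =
    (q.1 - p.1) * (du ord0 w1 - du ord0 p) + (q.2 - p.2) * (du o1 w2 - du o1 p).
  by rewrite -[u q](subrK (u p)) E; ring.
move: pq; rewrite prod_norm_lt distrC => /andP[/= a1]; rewrite distrC => a2.
apply: (le_trans (ler_normD _ _)); rewrite !normrM.
have b1 : `|q.1 - p.1| * `|du ord0 w1 - du ord0 p| <= r * (2 * m * r).
  by apply: ler_pM => //; [exact: ltW|exact: bd].
have b2 : `|q.2 - p.2| * `|du o1 w2 - du o1 p| <= r * (2 * m * r).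
  by apply: ler_pM => //; [exact: ltW|exact: bd].
by apply: (le_trans (lerD b1 b2)); rewrite le_eqVlt; apply/orP; left; apply/eqP; ring.
Qed.

(** Homogeneous coordinates: affine functions become row vectors, and evaluating them at finitely
    many points becomes a matrix product. *)
Definition hom z (k : 'I_3) : R :=
  if k == 0 then 1 else if k == 1 then z.1 else z.2.

Definition aff (a : 'rV[R]_3) z : R := \sum_k a 0 k * hom z k.

Lemma affE a z : aff a z = a 0 0 + a 0 1 * z.1 + a 0 2 * z.2.
Proof. by rewrite /aff !big_ord_recl big_ord0 /hom /= addr0 mulr1 addrA; congr (_ + a _ _ * _ + a _ _ * _); apply: val_inj. Qed.

Definition mkaff (a0 a1 a2 : R) : 'rV[R]_3 :=
  \row_k (if k == 0 then a0 else if k == 1 then a1 else a2).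

Lemma mkaffE a0 a1 a2 z : aff (mkaff a0 a1 a2) z = a0 + a1 * z.1 + a2 * z.2.
Proof. by rewrite affE !mxE. Qed.

Lemma affB a b z : aff (a - b) z = aff a z - aff b z.
Proof. by rewrite !affE !mxE; ring. Qed.

Lemma aff_continuous a : continuous (aff a).
Proof.
move=> z; have -> : aff a = fun z => a 0 0 + a 0 1 * z.1 + a 0 2 * z.2.
  by apply/funext => w; exact: affE.
apply: cvgD; first apply: cvgD; first exact: cvg_cst.
  by apply: cvgM; [exact: cvg_cst|exact: cvg_fst].
by apply: cvgM; [exact: cvg_cst|exact: cvg_snd].
Qed.

(** The kernel placed in the single entry (i, j) of a matrix field has as second divergence exactly
    the second partial to be tested. *)
Lemma second_derivative_bound D f c r p i j : 0 < r -> L1loc D f -> Vle D f c ->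
  cball p (2 * r) `<=` D -> forall m, (forall z, `|kap r z| <= m) ->
  `|L f (shiftf (pder i (pder j (kap r))) p)| <= 2 * m * c.
Proof.
move=> r0 lf Vf pD m Hm.
have m0 : 0 <= m by apply: le_trans (Hm 0).
pose F z : 'M[R]_2 := shiftf (kap r) p z *: delta_mx i j.
have HF : field D F.
  move=> k l.
  have -> : (fun z => F z k l) = fun z => shiftf (kap r) p z * (delta_mx i j : 'M[R]_2) k l.
    by apply/funext => z; rewrite mxE.
  split; first by apply: smooth_mul; [exact/smooth_shiftf/smooth_kap|exact: smooth_cst].
  by apply: supported_mull; exact: kap_supported.
have oF z : opb (2 * m) (F z).
  apply: opb_entries => k l; rewrite mxE mxE; case: (_ && _) => /=.
    by rewrite mulr1 /shiftf.
  by rewrite mulr0 normr0.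
have E : div2 F = shiftf (pder i (pder j (kap r))) p.
  apply/funext => z; rewrite /div2 (bigD1 i)//= [X in _ + X]big1 ?addr0; last first.
    move=> k ki; rewrite big1// => l _.
    rewrite (_ : (fun w => F w k l) = fun=> 0) ?partial_cst ?partial_cst//.
    by apply/funext => w; rewrite !mxE (negbTE ki) mulr0.
  rewrite (bigD1 j)//= [X in _ + X]big1 ?addr0; last first.
    move=> l lj; rewrite (_ : (fun w => F w i l) = fun=> 0) ?partial_cst ?partial_cst//.
    by apply/funext => w; rewrite !mxE (negbTE lj) andbF mulr0.
  rewrite (_ : (fun w => F w i j) = shiftf (kap r) p); last first.
    by apply/funext => w; rewrite !mxE !eqxx mulr1.
  rewrite (pder_shiftf _ _ (smooth_kap r)) (pder_shiftf _ _ (smooth_partial _ (smooth_kap r))).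
  by [].
rewrite -E ler_norml; apply/andP; split; last first.
  by apply: (Vle_opb _ Vf HF oF lf); rewrite mulr_ge0.
have := Vle_opb (_ : 0 <= 2 * m) Vf (fieldZ (-1) HF) (fun z => _) lf.
rewrite (div2Z _ (field_smoothF HF)) (L_scaler _ (intg_div2 lf HF)).
rewrite mulN1r lerNl; apply; first by rewrite mulr_ge0.
by move=> z; rewrite scaleN1r; exact: opbN.
Qed.

(* [mean f r] is a C^2 function at distance at most [c] from [Kc * f], and its
   second derivatives are themselves pairings of [f] with test fields. *)
Lemma affine_approx D p : open (D : set (R * R)) -> D p ->
  exists r C, [/\ 0 < r, 0 <= C, ball p r `<=` D & forall f c, L1loc D f -> Vle D f c ->
    exists a, forall q, ball p r q -> `|rep f q - aff a q| <= C * c].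
Proof.
move=> oD Dp; have /nbhs_ballP[r0 /= r00 Hr0] : nbhs p D by exact: open_nbhs_nbhs.
pose r := r0 / 5; have rp : 0 < r by rewrite divr_gt0.
have rD : cball p (4 * r) `<=` D.
  move=> z hz; apply: Hr0; apply/ball2P; apply: (le_lt_trans hz).
  by rewrite /r; lra.
have [C1 C10 HC1] := kap_bound R.
pose m := C1 / r ^+ 2.
have K0 := Kc_gt0 R.
have m0 : 0 <= m by rewrite divr_ge0 ?ltW// exprn_gt0.
(* The 1 bounds the distance from [Kc * f] to its mean; the other term is the Taylor remainder with
   second derivatives at most [2 * m * c]. *)
exists r, ((1 + 4 * (2 * m) * r ^+ 2) / Kc); split=> //.
- apply: divr_ge0; last exact: ltW.
  by apply: addr_ge0 => //; apply: mulr_ge0; [apply: mulr_ge0 => //; exact: mulr_ge0|exact: sqr_ge0].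
- by move=> z /ball2P hz; apply: rD; apply: (le_trans (ltW hz)); lra.
move=> f c lf Vf.
have sub z : `|p - z| <= r -> cball z (2 * r) `<=` D.
  move=> pz; apply: subset_trans rD => w hw; have {}hw : `|z - w| <= 2 * r := hw.
  rewrite /cball /=; have -> : p - w = (p - z) + (z - w) by rewrite addrA subrK.
  by apply: (le_trans (ler_normD _ _)); clear -pz hw rp; lra.
have H q s s' : `|p - q| <= r -> 0 < s <= r -> 0 < s' <= r ->
    `|mean f s q - mean f s' q| <= c.
  move=> pq; wlog ss : s s' / s <= s'.
    move=> W hs hs'; have [ss|ss] := leP s s'; first exact: W.
    by rewrite distrC; apply: W => //; exact: ltW.
  move=> /andP[s0 sr] /andP[s0' sr'].
  have ss' : 0 < s <= s' by rewrite s0.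
  apply: (mean_ring ss' _ lf Vf); apply: subset_trans (sub q pq) => z hz.
  by apply: (le_trans hz); rewrite ler_pM2l.
have ap := mean_rep oD lf Vf rp rD H.
pose u := mean f r; pose du i q := - L f (shiftf (pder i (kap r)) q).
pose ddu i j q := L f (shiftf (pder j (pder i (kap r))) q).
have r3D : cball p (r + 2 * r) `<=` D.
  by apply: subset_trans rD => z hz; apply: (le_trans hz); lra.
have r20 : 0 <= 2 * r by lra.
have dU i q : `|p - q| < r -> is_derive q (basis_vector R i) u (du i q).
  exact: (is_derive_conv i lf (smooth_kap r) (fun z => @kap_out R r z rp) r20 r3D).
have ddU i j q : `|p - q| < r -> is_derive q (basis_vector R j) (du i) (ddu i j q).
  move=> pq; have := is_derive_conv j lf (smooth_partial i (smooth_kap r))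
    (@pder_out R _ i _ (fun z => @kap_out R r z rp)) r20 r3D pq.
  rewrite /du /ddu => HH; rewrite -[L f _]opprK.
  exact: is_deriveN.
have bd i j q : `|p - q| < r -> `|ddu i j q| <= 2 * m * c.
  by move=> pq; apply: (second_derivative_bound j i rp lf Vf (sub q (ltW pq))) => z; exact: HC1.
pose a := mkaff ((u p - p.1 * du ord0 p - p.2 * du o1 p) / Kc) (du ord0 p / Kc) (du o1 p / Kc).
exists a => q /ball2P pq.
have T := taylor2 dU ddU bd pq.
have rr : 0 < r <= r by rewrite rp lexx.
have A := ap q r (ltW pq) rr.
have -> : rep f q - aff a q = (Kc * rep f q - (u p + (q.1 - p.1) * du ord0 p + (q.2 - p.2) * du o1 p)) / Kc.
  by rewrite /a mkaffE; field; rewrite gt_eqF.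
rewrite normrM (gtr0_norm (_ : 0 < Kc^-1)) ?invr_gt0//.
rewrite [leRHS]mulrAC ler_pM2r ?invr_gt0// [leRHS]mulrDl mul1r.
rewrite -[X in `|X - _|](subrK (u q)) -addrA; apply: (le_trans (ler_normD _ _)).
apply: lerD; first by rewrite distrC.
by apply: (le_trans T); rewrite le_eqVlt; apply/orP; left; apply/eqP; ring.
Qed.

End taylor.

(** * Removing locally affine parts *)

Section linked.
Variable R : realType.
Local Notation plane := (measurableTypeR R * measurableTypeR R)%type.
Local Notation mu := (lebesgue2 R).
Implicit Types (A B D U K : set plane) (f g h u psi : R * R -> R) (z w p q : R * R)
  (C c e m r s rho : R) (a b : 'rV[R]_3).

Definition cfun D f := forall z, D z -> {for z, continuous f}.

Lemma rep_cfun D f c z : open (D : set (R * R)) -> cfun D f -> Vle D f c -> D z ->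
  rep f z = f z.
Proof.
move=> oD cf Vf Dz; have lf := L1loc_cont oD cf.
apply/esym; apply: (continuous_ae_eq oD cf _ _ Dz); last exact: rep_ae Vf.
by move=> w Dw; exact: rep_continuous Vf.
Qed.

Lemma affine_approx_cfun D p : open (D : set (R * R)) -> D p ->
  exists r C, [/\ 0 < r, 0 <= C, ball p r `<=` D & forall f c, cfun D f -> Vle D f c ->
    exists a, forall q, ball p r q -> `|f q - aff a q| <= C * c].
Proof.
move=> oD Dp; have [r [C [r0 C0 rD H]]] := affine_approx oD Dp.
exists r, C; split=> // f c cf Vf.
have [a Ha] := H f c (L1loc_cont oD cf) Vf; exists a => q pq.
by rewrite -(rep_cfun oD cf Vf (rD _ pq)); exact: Ha.
Qed.

(** Values at [p] and at two points shifted by [r / 2] bound the slopes by [4 * m / r], with a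
    constant independent of the affine function. *)
Lemma aff_grow p r q r' : 0 < r -> 0 < r' -> exists2 C, 0 <= C & forall a m,
  (forall z, ball p r z -> `|aff a z| <= m) -> forall z, ball q r' z -> `|aff a z| <= C * m.
Proof.
move=> r0 r'0; pose rho := `|p - q| + r'.
have rho0 : 0 <= rho by rewrite addr_ge0// ltW.
exists (1 + 8 * rho / r) => [|a m H z /ball2P qz].
  by apply: addr_ge0 => //; apply: divr_ge0; [exact: mulr_ge0|exact: ltW].
have pz : `|p - z| <= rho.
  have -> : p - z = (p - q) + (q - z) by rewrite addrA subrK.
  by apply: (le_trans (ler_normD _ _)); rewrite lerD2l ltW.
have m0 : `|aff a p| <= m by apply: H; exact: ballxx.
have r20 : `|r / 2| < r by rewrite gtr0_norm ?divr_gt0//; lra.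
have i1 : ball p r ((p.1 + r / 2, p.2) : R * R).
  apply/ball2P; rewrite prod_norm_lt /= subrr normr0 r0 andbT.
  by rewrite opprD addNKr normrN.
have i2 : ball p r ((p.1, p.2 + r / 2) : R * R).
  apply/ball2P; rewrite prod_norm_lt /= subrr normr0 r0 /=.
  by rewrite opprD addNKr normrN.
have b1 : `|a 0 1| <= 4 * m / r.
  have := H _ i1; rewrite affE /= => h1; move: (m0); rewrite affE => h0.
  have : `|a 0 1 * (r / 2)| <= 2 * m.
    have -> : a 0 1 * (r / 2) = (a 0 0 + a 0 1 * (p.1 + r / 2) + a 0 2 * p.2) -
      (a 0 0 + a 0 1 * p.1 + a 0 2 * p.2) by ring.
    by apply: (le_trans (ler_normB _ _)); clear -h1 h0; lra.
  rewrite normrM (gtr0_norm (divr_gt0 r0 _)) // => h.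
  by rewrite ler_pdivlMr//; clear -h; lra.
have b2 : `|a 0 2| <= 4 * m / r.
  have := H _ i2; rewrite affE /= => h1; move: (m0); rewrite affE => h0.
  have : `|a 0 2 * (r / 2)| <= 2 * m.
    have -> : a 0 2 * (r / 2) = (a 0 0 + a 0 1 * p.1 + a 0 2 * (p.2 + r / 2)) -
      (a 0 0 + a 0 1 * p.1 + a 0 2 * p.2) by ring.
    by apply: (le_trans (ler_normB _ _)); clear -h1 h0; lra.
  rewrite normrM (gtr0_norm (divr_gt0 r0 _)) // => h.
  by rewrite ler_pdivlMr//; clear -h; lra.
have : Num.max `|(p - z).1| `|(p - z).2| <= rho by rewrite -prod_normE.
rewrite ge_max => /andP[/= n1 n2]; rewrite distrC in n1; rewrite distrC in n2.
have -> : aff a z = aff a p + a 0 1 * (z.1 - p.1) + a 0 2 * (z.2 - p.2).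
  by rewrite !affE; ring.
have -> : (1 + 8 * rho / r) * m = m + 4 * m / r * rho + 4 * m / r * rho.
  by field; rewrite gt_eqF.
apply: (le_trans (ler_normD _ _)); apply: lerD; last by rewrite normrM ler_pM.
by apply: (le_trans (ler_normD _ _)); apply: lerD => //; rewrite normrM ler_pM.
Qed.

(** One affine function fits [f] near both points, with radius and constant independent of [f]. This
    is an equivalence relation on [D] with open classes, which is all that is needed from connected
    components. *)
Definition linked D p q := exists r C, [/\ 0 < r, 0 <= C, ball p r `<=` D, ball q r `<=` D &
  forall f c, cfun D f -> Vle D f c ->
    exists a, forall z, ball p r z \/ ball q r z -> `|f z - aff a z| <= C * c].

Lemma linked_refl D p : open (D : set (R * R)) -> D p -> linked D p p.
Proof.
move=> oD Dp; have [r [C [r0 C0 rD H]]] := affine_approx_cfun oD Dp.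
exists r, C; split=> // f c cf Vf; have [a Ha] := H f c cf Vf.
by exists a => z [] /Ha.
Qed.

Lemma linked_sym D p q : linked D p q -> linked D q p.
Proof.
move=> [r [C [r0 C0 rD rD' H]]]; exists r, C; split=> // f c cf Vf.
by have [a Ha] := H f c cf Vf; exists a => z [] h; apply: Ha; [right|left].
Qed.

Lemma ball_sub q q' r r' : `|q - q'| + r' <= r -> ball q' r' `<=` ball q r.
Proof.
move=> h z /ball2P qz; apply/ball2P; have -> : q - z = (q - q') + (q' - z) by rewrite addrA subrK.
by apply: (le_lt_trans (ler_normD _ _)); clear -h qz; lra.
Qed.

Lemma ball_le q r r' : r' <= r -> ball q r' `<=` ball q r.
Proof. by move=> h; apply: ball_sub; rewrite subrr normr0 add0r. Qed.

Lemma linked_near D p q : linked D p q ->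
  exists2 r, 0 < r & forall q', ball q r q' -> linked D p q'.
Proof.
move=> [r [C [r0 C0 rD rD' H]]]; exists (r / 2); first by rewrite divr_gt0.
move=> q' /ball2P qq'; have s1 : ball p (r / 2) `<=` ball p r by apply: ball_le; lra.
have s2 : ball q' (r / 2) `<=` ball q r by apply: ball_sub; clear -qq'; lra.
exists (r / 2), C; split=> //; [by rewrite divr_gt0|exact: subset_trans rD
  |exact: subset_trans rD'|].
move=> f c cf Vf; have [a Ha] := H f c cf Vf.
by exists a => z [/s1|/s2] h; apply: Ha; [left|right].
Qed.

(* An affine function close to [f] near one point is close to [f] near every
   linked point. *)
Lemma linked_bound D p q r0 C0 : linked D p q -> 0 < r0 -> 0 <= C0 ->
  exists r C, [/\ 0 < r, 0 <= C, ball q r `<=` D & forall f c a, cfun D f -> Vle D f c ->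
    (forall z, ball p r0 z -> `|f z - aff a z| <= C0 * c) ->
    forall z, ball q r z -> `|f z - aff a z| <= C * c].
Proof.
move=> [r [C [rp Cp rD rD' H]]] r00 C00.
have rm : 0 < Num.min r r0 by rewrite lt_min rp.
have [C2 C20 HC2] := @aff_grow p (Num.min r r0) q r rm rp.
exists r, (C + C2 * (C + C0)); split=> //; first by rewrite addr_ge0// mulr_ge0// addr_ge0.
move=> f c a cf Vf Ha z qz.
have [a1 Ha1] := H f c cf Vf.
have close w : ball p (Num.min r r0) w -> `|aff (a1 - a) w| <= (C + C0) * c.
  move=> hw; rewrite affB mulrDl.
  have h1 : `|f w - aff a1 w| <= C * c.
    by apply: Ha1; left; apply: ball_le hw; rewrite ge_min lexx.
  have h2 : `|f w - aff a w| <= C0 * c.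
    by apply: Ha; apply: ball_le hw; rewrite ge_min lexx orbT.
  have -> : aff a1 w - aff a w = (f w - aff a w) - (f w - aff a1 w) by ring.
  by apply: (le_trans (ler_normB _ _)); rewrite addrC lerD.
have h3 := HC2 _ _ close z qz.
have h4 := Ha1 z (or_intror qz).
have -> : f z - aff a z = (f z - aff a1 z) + aff (a1 - a) z by rewrite affB; ring.
apply: (le_trans (ler_normD _ _)); rewrite mulrDl -mulrA; exact: lerD.
Qed.

Lemma linked_trans D q p w : linked D p q -> linked D q w -> linked D p w.
Proof.
move=> pq qs; have [r [C [r0 C0 rD rD' H]]] := pq.
have [r1 [C1 [r10 C10 rD1 H1]]] := linked_bound qs r0 C0.
have m1 : Num.min r r1 <= r by rewrite ge_min lexx.
have m2 : Num.min r r1 <= r1 by rewrite ge_min lexx orbT.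
exists (Num.min r r1), (C + C1); split=> //.
- by rewrite lt_min r0.
- exact: addr_ge0.
- by apply: subset_trans rD; exact: ball_le.
- by apply: subset_trans rD1; exact: ball_le.
move=> f c cf Vf; have c0 := Vle_ge0 Vf.
have [a Ha] := H f c cf Vf; exists a => z [hz|hz].
  apply: (@le_trans _ _ (C * c)); first by apply: Ha; left; exact: ball_le hz.
  by rewrite ler_wpM2r// lerDl.
apply: (@le_trans _ _ (C1 * c)); last by rewrite ler_wpM2r// lerDr.
apply: (H1 f c a cf Vf) => [v hv|]; last exact: ball_le hz.
by apply: Ha; right.
Qed.

(** A canonical point of the class: linked points define the same set, so the choice made by [get]
    is the same. *)
Definition cl D q : R * R := get [set p | D p /\ linked D p q].

Lemma clP D q : open (D : set (R * R)) -> D q -> D (cl D q) /\ linked D (cl D q) q.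
Proof.
by move=> oD Dq; apply: (@getPex _ [set p | D p /\ linked D p q]); exists q; split=> //; exact: linked_refl.
Qed.

Lemma cl_eq D q q' : linked D q q' -> cl D q = cl D q'.
Proof.
move=> qq'; rewrite /cl; congr (get _); apply/seteqP; split=> p [Dp pq]; split=> //.
  exact: linked_trans qq'.
exact: linked_trans (linked_sym qq').
Qed.

Lemma cl_near D q : open (D : set (R * R)) -> D q ->
  exists2 r, 0 < r & forall z, ball q r z -> cl D z = cl D q.
Proof.
move=> oD Dq; have [r r0 Hr] := linked_near (linked_refl oD Dq).
by exists r => // z /Hr h; apply/esym/cl_eq.
Qed.

(** One affine function per class. As classes are open, it has zero Hessian on [D] even if there are
    infinitely many classes. *)
Definition locaff D (a : R * R -> 'rV[R]_3) z := aff (a (cl D z)) z.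

Lemma near_of_ball p r (P : R * R -> Prop) : 0 < r -> (forall z, ball p r z -> P z) ->
  \forall z \near p, P z.
Proof. by move=> r0 H; apply/nbhs_ballP; exists r. Qed.

Lemma locaff_near D (k : R * R -> 'rV[R]_3) z : open (D : set (R * R)) -> D z ->
  \forall w \near z, locaff D k w = aff (k (cl D z)) w.
Proof.
move=> oD Dz; have [r r0 Hr] := cl_near oD Dz.
by apply: (near_of_ball r0) => w /Hr; rewrite /locaff => ->.
Qed.

Lemma is_derive_near f g z v d : (\forall w \near z, f w = g w) ->
  is_derive z v g d -> is_derive z v f d.
Proof.
move=> H dg; have [v0|v0] := eqVneq v 0.
  move: dg; rewrite v0 => dg.
  have E h : is_derive z 0 h 0.
    apply/is_derive_sliceP; rewrite (_ : (fun _ => _) = cst (h z)); first exact: is_derive_cst.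
    by apply/funext => t; rewrite scaler0 add0r.
  have -> : d = 0.
    by rewrite -(@derive_val _ _ _ _ _ _ _ dg) (@derive_val _ _ _ _ _ _ _ (E g)).
  exact: E.
apply: (@near_eq_is_derive _ _ _ g f) dg => //.
by apply: filterS H => w ->.
Qed.

Lemma continuous_near f g z : (\forall w \near z, f w = g w) ->
  {for z, continuous g} -> {for z, continuous f}.
Proof.
move=> H /cvgrPdist_lt cg; apply/cvgrPdist_lt => e e0.
by rewrite (nbhs_singleton H); apply: filterS2 H (cg e e0) => w ->.
Qed.

Lemma locaff_cfun D (k : R * R -> 'rV[R]_3) : open (D : set (R * R)) -> cfun D (locaff D k).
Proof.
by move=> oD z Dz; apply: (continuous_near (locaff_near k oD Dz)); exact: aff_continuous.
Qed.

Lemma L_locaff D (k : R * R -> 'rV[R]_3) F : open (D : set (R * R)) -> field D F ->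
  L (locaff D k) (div2 F) = 0.
Proof.
move=> oD HF.
pose du (i : 'I_2) z := if i == ord0 then k (cl D z) 0 1 else k (cl D z) 0 2.
have du_near i z : D z -> \forall w \near z, du i w = du i z.
  move=> Dz; have [r r0 Hr] := cl_near oD Dz.
  by apply: (near_of_ball r0) => w /Hr; rewrite /du => ->.
have C2 : C2on D (locaff D k) du (fun _ _ _ => 0).
  split.
  - exact: locaff_cfun.
  - by move=> i z Dz; apply: (continuous_near (du_near i z Dz)); exact: cvg_cst.
  - by move=> i j z _; exact: cvg_cst.
  - move=> i z Dz; apply: (is_derive_near (locaff_near k oD Dz)).
    rewrite (_ : aff _ = fun w => k (cl D z) 0 0 + k (cl D z) 0 1 * w.1 + k (cl D z) 0 2 * w.2);
      last by apply/funext => w; rewrite affE.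
    have d1 := is_derive_mul (is_derive_cst (k (cl D z) 0 1) z (basis_vector R i)) (is_derive_fst z i).
    have d2 := is_derive_mul (is_derive_cst (k (cl D z) 0 2) z (basis_vector R i)) (is_derive_snd z i).
    have H := is_derive_add (is_derive_add (is_derive_cst (k (cl D z) 0 0) z (basis_vector R i)) d1) d2.
    apply: (is_derive_eq H); rewrite /du /cst /= !mul0r !add0r.
    by case: eqP => _ /=; rewrite mulr1 mulr0 ?addr0 ?add0r.
  - move=> i j z Dz; apply: (is_derive_near (du_near i z Dz)); exact: is_derive_cst.
rewrite (ibp2 oD C2 HF) /Rintegral integral0_eq// => z _.
by rewrite !sum2 !mul0r !addr0.
Qed.


Lemma Vle_subaff D f c (k : R * R -> 'rV[R]_3) : open (D : set (R * R)) -> cfun D f ->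
  Vle D f c -> Vle D (fun z => f z - locaff D k z) c.
Proof.
move=> oD cf Vf F HF F1.
have ll : L1loc D (locaff D k) by apply: L1loc_cont => //; exact: locaff_cfun.
rewrite (L_subl (intg_div2 (L1loc_cont oD cf) HF) (intg_div2 ll HF)).
by rewrite (L_locaff k oD HF) subr0; exact: Vf.
Qed.

Lemma hom_bound z k : `|hom z k| <= 1 + `|z|.
Proof.
have [z1 z2] : `|z.1| <= `|z| /\ `|z.2| <= `|z|.
  by rewrite [`|z|]prod_normE; split; rewrite le_max lexx ?orbT.
have z0 : 0 <= `|z| by [].
by rewrite /hom; case: ifP => _; [rewrite normr1|case: ifP => _]; lra.
Qed.

(* Subtracting a locally affine function changes neither the variation nor,
   thanks to [pinvmx], the values at the points [x i]. *)
Lemma normalize D N (x : 'I_N -> R * R) m : open (D : set (R * R)) -> 0 <= m ->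
  (forall i, D (x i)) ->
  exists (rho bnd : R * R -> R), (forall q, D q -> 0 < rho q /\ ball q (rho q) `<=` D) /\
    forall f c, cfun D f -> Vle D f c -> c <= m -> (forall i, `|f (x i)| <= m) ->
    exists g, [/\ cfun D g, Vle D g c, forall i, g (x i) = f (x i) &
      forall q z, D q -> ball q (rho q) z -> `|g z| <= bnd q].
Proof.
move=> oD m0 Dx.
have base p : exists rC : R * R, D p -> [/\ 0 < rC.1, 0 <= rC.2 &
    forall f c, cfun D f -> Vle D f c ->
      exists a, forall z, ball p rC.1 z -> `|f z - aff a z| <= rC.2 * c].
  have [Dp|nD] := pselect (D p); last by exists 0.
  have [r [C [r0 C0 rD H]]] := affine_approx_cfun oD Dp.
  by exists (r, C).
have [b0 Hb0] := choice base.
have ext q : exists rC : R * R, D q -> [/\ 0 < rC.1, 0 <= rC.2, ball q rC.1 `<=` D,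
    forall z, ball q rC.1 z -> cl D z = cl D q &
    forall f c a, cfun D f -> Vle D f c ->
      (forall z, ball (cl D q) (b0 (cl D q)).1 z -> `|f z - aff a z| <= (b0 (cl D q)).2 * c) ->
      forall z, ball q rC.1 z -> `|f z - aff a z| <= rC.2 * c].
  have [Dq|nD] := pselect (D q); last by exists 0.
  have [Dp pq] := clP oD Dq; have [r0 C0 _] := Hb0 _ Dp.
  have [r [C [rp Cp rD H]]] := linked_bound pq r0 C0.
  have [r' r'0 Hr'] := cl_near oD Dq.
  have m1 : Num.min r r' <= r by rewrite ge_min lexx.
  have m2 : Num.min r r' <= r' by rewrite ge_min lexx orbT.
  exists (Num.min r r', C) => _ /=; split=> //.
  - by rewrite lt_min rp.
  - by apply: subset_trans rD; exact: ball_le.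
  - by move=> z /(ball_le m2); exact: Hr'.
  - by move=> f c a cf Vf Ha z /(ball_le m1); exact: (H f c a cf Vf Ha).
have [b1 Hb1] := choice ext.
(* Multiplication by [X p] evaluates an affine function at the data points in the class of [p]; the
   other columns are 0. *)
pose X p : 'M[R]_(3, N) := \matrix_(k, i) (if cl D (x i) == p then hom (x i) k else 0).
pose v i := m + (b1 (x i)).2 * m.
have v0 i : 0 <= v i.
  by have [_ C0 _ _ _] := Hb1 _ (Dx i); apply: addr_ge0 => //; exact: mulr_ge0.
pose B p k := \sum_i v i * `|pinvmx (X p) i k|.
have B0 p k : 0 <= B p k by apply: sumr_ge0 => i _; exact: mulr_ge0.
pose bnd q := (b1 q).2 * m + \sum_k B (cl D q) k * (1 + (`|q| + (b1 q).1)).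
exists (fun q => (b1 q).1), bnd; split=> [q Dq|]; first by have [] := Hb1 q Dq.
move=> f c cf Vf cm fm; have c0 := Vle_ge0 Vf.
have ap p : exists a, D p -> forall z, ball p (b0 p).1 z -> `|f z - aff a z| <= (b0 p).2 * c.
  have [Dp|nD] := pselect (D p); last by exists 0.
  by have [_ _ /(_ f c cf Vf)[a Ha]] := Hb0 p Dp; exists a.
have [a Ha] := choice ap.
have near_a q z : D q -> ball q (b1 q).1 z -> `|f z - aff (a (cl D q)) z| <= (b1 q).2 * c.
  move=> Dq; have [_ _ _ _ H] := Hb1 q Dq; apply: (H f c _ cf Vf).
  by apply: Ha; have [] := clP oD Dq.
(* An affine function with the values of [a p] at those data points, but with coefficients bounded
   through these values alone. Subtracting [a p - b p] keeps the data while removing the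
   uncontrolled part. *)
pose b p := a p *m X p *m pinvmx (X p).
have bX p : b p *m X p = a p *m X p by rewrite /b mulmxKpV// submxMl.
have affX (u : 'rV[R]_3) p i : (u *m X p) 0 i = if cl D (x i) == p then aff u (x i) else 0.
  rewrite mxE /aff; case: ifP => h; last by rewrite big1// => k _; rewrite mxE h mulr0.
  by apply: eq_bigr => k _; rewrite mxE h.
have bx i : aff (b (cl D (x i))) (x i) = aff (a (cl D (x i))) (x i).
  have := affX (b (cl D (x i))) (cl D (x i)) i; rewrite eqxx => <-.
  by rewrite bX affX eqxx.
have vb p i : `|(a p *m X p) 0 i| <= v i.
  rewrite affX; case: eqP => [<-|_]; last by rewrite normr0.
  have [r0 C0 _ _ _] := Hb1 _ (Dx i).
  have h := near_a (x i) (x i) (Dx i) (ballxx _ r0).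
  rewrite -[aff _ _](subKr (f (x i))); apply: (le_trans (ler_normB _ _)).
  by apply: lerD; [exact: fm|apply: (le_trans h); exact: ler_wpM2l].
have bB p k : `|b p 0 k| <= B p k.
  rewrite /b [X in `|X|]mxE; apply: (le_trans (ler_norm_sum _ _ _)).
  by apply: ler_sum => i _; rewrite normrM ler_wpM2r.
exists (fun z => f z - locaff D (fun p => a p - b p) z); split.
- by move=> z Dz; apply: cvgB; [exact: cf|exact: locaff_cfun].
- exact: Vle_subaff.
- by move=> i; rewrite /locaff affB bx subrr subr0.
- move=> q z Dq qz; have [r0 C0 _ clq _] := Hb1 q Dq.
  rewrite /locaff (clq z qz) affB opprB addrCA addrC.
  apply: (le_trans (ler_normD _ _)); apply: lerD.
    by apply: (le_trans (near_a q z Dq qz)); exact: ler_wpM2l.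
  rewrite /aff; apply: (le_trans (ler_norm_sum _ _ _)); apply: ler_sum => k _.
  rewrite normrM; apply: ler_pM => //.
  apply: (le_trans (hom_bound _ _)); rewrite lerD2l.
  have -> : z = q - (q - z) by rewrite subKr.
  apply: (le_trans (ler_normB _ _)); rewrite lerD2l.
  by move/ball2P: qz => /ltW.
Qed.

End linked.

(** * Almost everywhere convergent minimising sequences *)

Section minimizing.
Variable R : realType.

(* The midpoints of two near-minimisers stay in the larger set, so the
   parallelogram identity forces near-minimisers to be close to each other. *)
Lemma min_seq (T : Type) (X : nat -> T -> Prop) (mid hd : T -> T -> T) (J : T -> R)
    (e : nat -> R) :
  (forall n f, X n.+1 f -> X n f) -> (forall n, exists f, X n f) ->
  (forall n f g, X n f -> X n g -> X n (mid f g)) ->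
  (forall f, X 0%N f -> 0 <= J f <= 1) ->
  (forall f g, X 0%N f -> X 0%N g -> J (mid f g) + J (hd f g) = (J f + J g) / 2) ->
  (forall n, 0 < e n) -> (forall n, e n.+1 <= e n) ->
  exists fn, forall n, X n (fn n) /\ J (hd (fn n) (fn n.+1)) <= e n.
Proof.
move=> dec ne Xmid J01 par e0 edec.
have mono m n f : (m <= n)%N -> X n f -> X m f.
  elim: n => [|n IH]; first by rewrite leqn0 => /eqP ->.
  by rewrite leq_eqVlt => /orP[/eqP -> //|/IH H /dec].
pose j n := inf [set J f | f in X n].
have hl n : has_lbound [set J f | f in X n].
  by exists 0 => _ [f Xf <-]; have /andP[] := J01 f (mono 0%N n f (leq0n _) Xf).
have ne' n : [set J f | f in X n] !=set0 by have [f Xf] := ne n; exists (J f), f.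
have jle n f : X n f -> j n <= J f by move=> Xf; apply: ge_inf => //; exists f.
have jmono m n : (m <= n)%N -> j m <= j n.
  move=> mn; apply: lb_le_inf => // _ [f Xf <-]; apply: jle; exact: mono Xf.
have hs : has_sup (range j).
  split; first by exists (j 0%N), 0%N.
  exists 1 => _ [n _ <-]; have [f Xf] := ne n; apply: (le_trans (jle n f Xf)).
  by have /andP[] := J01 f (mono 0%N n f (leq0n _) Xf).
pose s := sup (range j).
have js n : j n <= s by apply: ub_le_sup; [case: hs|exists n].
have adh n : exists N, s - e n / 2 < j N.
  have e2 : 0 < e n / 2 by rewrite divr_gt0.
  by have [_ [N _ <-] hN] := sup_adherent e2 hs; exists N.
have [N HN] := choice adh.
(* A nondecreasing choice of indices beyond [N n], where the infima [j] are within [e n / 2] of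
   their supremum [s]. *)
pose k n := (\sum_(i < n.+1) N i + n)%N.
have kS n : (k n <= k n.+1)%N by rewrite /k (big_ord_recr n.+1)/= leq_add// leq_addr.
have kN n : (N n <= k n)%N.
  by rewrite /k big_ord_recr/= -addnA addnCA leq_addr.
have kn n : (n <= k n)%N by rewrite leq_addl.
have pick n : exists f, X (k n) f /\ J f < j (k n) + e n / 2.
  have e2 : 0 < e n / 2 by rewrite divr_gt0.
  have [|_ [f Xf <-] hf] := @inf_adherent _ [set J f | f in X (k n)] _ e2; first by split.
  by exists f.
have [fn Hfn] := choice pick; exists fn => n; split.
  by have [Xf _] := Hfn n; exact: mono Xf.
have [X1 h1] := Hfn n; have [X2 h2] := Hfn n.+1.
have X2' := mono _ _ _ (kS n) X2.
have h3 := jle _ _ (Xmid _ _ _ X1 X2').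
have h4 := par _ _ (mono 0%N _ _ (leq0n _) X1) (mono 0%N _ _ (leq0n _) X2).
have h5 := HN n; have h6 := jmono _ _ (kN n).
have h7 := js (k n.+1); have h8 := edec n; have h9 := e0 n.
by clear -h1 h2 h3 h4 h5 h6 h7 h8 h9; lra.
Qed.

Local Notation plane := (measurableTypeR R * measurableTypeR R)%type.
Local Notation mu := (lebesgue2 R).
Implicit Types (A B D U K : set plane) (f g h u psi : R * R -> R) (z w p q : R * R)
  (C c e m r s rho : R).

Let half : R := 2^-1.

Lemma half_lt1 : `|half| < 1.
Proof. by rewrite /half ger0_norm ?invr_ge0// invf_lt1// ltr1n. Qed.

Lemma cvg_of_abs_series (u : nat -> R) (m : R) :
  (forall n, \sum_(i < n) `|u i - u i.+1| <= m) -> cvgn u.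
Proof.
move=> H.
pose d i := u i.+1 - u i.
have sE n : \sum_(i < n) `|u i - u i.+1| = [normed series d] n.
  by rewrite -[RHS]/(series (fun i => `|d i|) n) seriesEord; apply: eq_bigr => i _; rewrite distrC.
have : cvgn (series d).
  apply: normed_cvg; apply: nondecreasing_is_cvgn.
    have nd : nondecreasing_seq (series (fun i => `|d i|)).
      by apply: nondecreasing_series => i _ _; exact: normr_ge0.
    exact: nd.
  by exists m => _ [n _ <-]; rewrite -sE.
have -> : u = fun n => u 0%N + series d n.
  by apply/funext => n; exact: eq_sum_telescope.
by move=> cd; apply: is_cvgD; [exact: is_cvg_cst|].
Qed.

Lemma ae_cvg_of_square B (fn : nat -> R * R -> R) C : measurable B -> (mu B < +oo)%E ->
  (forall n, measurable_fun B (fn n)) ->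
  (forall n, mu.-integrable B (EFin \o (fun z => (fn n z - fn n.+1 z) ^+ 2))) ->
  (forall n, \int[mu]_(z in B) (fn n z - fn n.+1 z) ^+ 2 <= C * 4^-1 ^+ n) ->
  {ae mu, forall z, B z -> cvgn (fun n => fn n z)}.
Proof.
move=> mB Bfin mf iq HC.
pose d n z := fn n z - fn n.+1 z.
have md n : measurable_fun B (fun z => `|d n z|).
  by apply: measurableT_comp => //; exact: measurable_funB.
pose m := (C + fine (mu B)) / 2.
have bd n : (\int[mu]_(z in B) `|d n z|%:E <= (m * half ^+ n)%:E)%E.
  have ic : mu.-integrable B (EFin \o (fun=> half ^+ n)) by exact: integrable_cst_fin.
  have i1 := integrableZl mB (2 ^+ n) (iq n).
  have i2 := integrableD mB i1 ic.
  have i3 := integrableZl mB half i2.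
  apply: (@le_trans _ _ (\int[mu]_(z in B) (half * (2 ^+ n * d n z ^+ 2 + half ^+ n))%:E)%E).
    apply: ge0_le_integral => //.
    - exact/measurable_EFinP.
    - exact: measurable_int i3.
    - move=> z _; rewrite lee_fin.
      have p2 : 0 < 2 ^+ n :> R by rewrite exprn_gt0.
      rewrite /half exprVn -[X in _ * X ^+ 2]/(d n z) -(real_normK (num_real (d n z))).
      set t := `|d n z|; set P := 2 ^+ n in p2 *.
      have -> : 2^-1 * (P * t ^+ 2 + P^-1) = t + (P * t - 1) ^+ 2 / (2 * P).
        by field; rewrite gt_eqF.
      by rewrite lerDl divr_ge0 ?sqr_ge0// mulr_ge0// ltW.
  have fm : mu B = (fine (mu B))%:E by rewrite fineK// ge0_fin_numE// measure_ge0.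
  have E : (\int[mu]_(z in B) (half * (2 ^+ n * d n z ^+ 2 + half ^+ n))%:E)%E =
      (half * (2 ^+ n * \int[mu]_(z in B) d n z ^+ 2 + half ^+ n * fine (mu B)))%:E.
    rewrite -[LHS](fineK (integrable_fin_num mB i3)); congr EFin.
    transitivity (\int[mu]_(z in B) (half * (2 ^+ n * d n z ^+ 2 + half ^+ n))); first by [].
    rewrite RintegralZl//.
    congr (half * _); rewrite RintegralD//.
    congr (_ + _); last by rewrite Rintegral_cst.
    by rewrite RintegralZl//; exact: (iq n).
  rewrite E lee_fin /m /half.
  have := ler_wpM2l (exprn_ge0 n (ler0n R 2)) (HC n).
  rewrite mulrCA -exprMn_comm; last by rewrite /GRing.comm mulrC.
  have -> : 2 * 4^-1 = 2^-1 :> R by field.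
  by rewrite -/(d n); move=> h; set I := 2 ^+ n * _ in h *; lra.
have ci := @integral_nneseries _ _ _ mu B mB (fun n z => `|d n z|%:E).
have mS : measurable_fun B (fun z => \sum_(n <oo) `|d n z|%:E)%E.
  by apply: ge0_emeasurable_sum => // n _; exact/measurable_EFinP.
have S0 z : (0 <= \sum_(n <oo) `|d n z|%:E)%E by apply: nneseries_ge0 => n _ _; rewrite lee_fin.
have fS : (\int[mu]_(z in B) (\sum_(n <oo) `|d n z|%:E) < +oo)%E.
  rewrite ci//; last by move=> n; exact/measurable_EFinP.
  apply: (@le_lt_trans _ _ (\sum_(n <oo) (m * half ^+ n)%:E)%E).
    by apply: lee_nneseries => // n _ _; exact: integral_ge0.
  have m0 : 0 <= m.
    rewrite -[m]mulr1 -(expr0 half) -lee_fin; apply: le_trans (bd 0%N).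
    by apply: integral_ge0 => z _; rewrite lee_fin.
  apply: (@le_lt_trans _ _ (2 * m)%:E); last exact: ltry.
  apply: le_trans (epsilon_trick0 xpredT (mulr_ge0 (ler0n R 2) m0)).
  apply: lee_nneseries => n _; first by rewrite lee_fin mulr_ge0// exprn_ge0// invr_ge0.
  rewrite lee_fin natrX exprS /half exprVn le_eqVlt; apply/orP; left; apply/eqP; field.
  by rewrite expf_neq0.
have iS : mu.-integrable B (fun z => \sum_(n <oo) `|d n z|%:E)%E.
  apply/integrableP; split=> //.
  by under eq_integral do rewrite gee0_abs//.
have := integrable_ae mB iS.
apply: ae_mono => z H Bz.
have {}H := H Bz.
apply: (@cvg_of_abs_series _ (fine (\sum_(n <oo) `|d n z|%:E)%E)) => n.
rewrite -lee_fin fineK// -sumEFin -(big_mkord xpredT (fun i => `|fn i z - fn i.+1 z|%:E)).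
by apply: nneseries_lim_ge => i _ _; rewrite lee_fin.
Qed.


Lemma series_dominated (t : nat -> R) : (forall k, 0 <= t k <= half ^+ k.+1) ->
  [/\ cvgn (series t), 0 <= limn (series t) <= 1 & forall k, t k <= limn (series t)].
Proof.
move=> H; have t0 k : 0 <= t k by have /andP[] := H k.
have g0 k : 0 <= geometric half half k.
  by rewrite /geometric /= mulr_ge0 ?exprn_ge0 ?invr_ge0.
have tg k : t k <= geometric half half k.
  by rewrite /geometric/= -exprS; have /andP[] := H k.
have cg : series (geometric half half) @ \oo --> half * (1 - half)^-1.
  exact: cvg_geometric_series half_lt1.
have ct : cvgn (series t) by apply: (series_le_cvg t0 g0 tg); apply/cvg_ex; exists (half * (1 - half)^-1).
have nd : nondecreasing_seq (series t) by apply: nondecreasing_series => i _ _; exact: t0.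
have le n := nondecreasing_cvgn_le nd ct n.
split=> // [|k].
  apply/andP; split; first by have := le 0%N; rewrite /series/= big_geq.
  have -> : 1 = half * (1 - half)^-1 by rewrite /half; field.
  apply: (ler_cvg_to ct cg); near=> n; rewrite /series /=.
  by apply: ler_sum => i _; exact: tg.
apply: le_trans (le k.+1); rewrite /series /= big_nat_recr//= lerDr.
by apply: sumr_ge0.
Unshelve. all: by end_near.
Qed.

Lemma limn_series_par (a b u v : nat -> R) : cvgn (series a) -> cvgn (series b) ->
  cvgn (series u) -> cvgn (series v) -> (forall k, a k + b k = (u k + v k) / 2) ->
  limn (series a) + limn (series b) = (limn (series u) + limn (series v)) / 2.
Proof.
move=> ca cb cu cv e.
have c1 : series a n + series b n @[n --> \oo] --> limn (series a) + limn (series b).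
  exact: cvgD.
apply: (cvg_unique (@Rhausdorff R) c1).
have -> : (fun n => series a n + series b n) = fun n => (series u n + series v n) / 2.
  apply/funext => n; rewrite /series /= -!big_split /= mulr_suml.
  by apply: eq_bigr => k _; rewrite e.
by apply: cvgM; [exact: cvgD|exact: cvg_cst].
Qed.

(** [min_seq] is applied to a weighted sum, over countably many boxes, of squared L^2 norms; this
    quadratic functional satisfies the parallelogram identity. *)
Lemma ae_cvg_seq D (rho bnd : R * R -> R) (X : nat -> (R * R -> R) -> Prop) :
  open (D : set (R * R)) -> (forall q, D q -> 0 < rho q /\ ball q (rho q) `<=` D) ->
  (forall n f, X n.+1 f -> X n f) -> (forall n, exists f, X n f) ->
  (forall n f g, X n f -> X n g -> X n (fun z => (f z + g z) / 2)) ->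
  (forall f, X 0%N f -> measurable_fun D f /\
     forall q z, D q -> ball q (rho q) z -> `|f z| <= bnd q) ->
  exists fn, (forall n, X n (fn n)) /\ {ae mu, forall z, D z -> cvgn (fun n => fn n z)}.
Proof.
move=> oD Hrho dec ne Xmid Xb.
pose G k := exists q, D q /\ qbox k `<=` ball q (rho q).
(* Only boxes inside some ball with a known bound are kept; they still cover [D]. *)
pose B k : set plane := if `[< G k >] then qbox k else set0.
have BM k : exists m, 0 <= m /\ forall f, X 0%N f -> forall z, B k z -> `|f z| <= m.
  rewrite /B; case: asboolP => [[q [Dq kq]]|_]; last by exists 0.
  exists `|bnd q|; split=> // f Xf z kz; apply: le_trans (ler_norm _).
  by have [_] := Xb f Xf; apply => //; exact: kq.
have [m Hm] := choice BM.
have m0 k : 0 <= m k by have [] := Hm k.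
have mB k : measurable (B k).
  by rewrite /B; case: asboolP => _; [exact: qbox_measurable|exact: measurable0].
have Bfin k : (mu (B k) < +oo)%E.
  by rewrite /B; case: asboolP => _; [exact: qbox_fin|rewrite measure0].
have BD k : B k `<=` D.
  rewrite /B; case: asboolP => [[q [Dq kq]]|_]; last by move=> z [].
  by apply: (subset_trans kq); have [] := Hrho q Dq.
pose b k := fine (mu (B k)).
have b0 k : 0 <= b k by rewrite fine_ge0// measure_ge0.
(* Weaker than [X 0], but stable under half differences too. *)
pose Y f := measurable_fun D f /\ forall k z, B k z -> `|f z| <= m k.
have XY f : X 0%N f -> Y f.
  move=> Xf; split; first by have [] := Xb f Xf.
  by move=> k z; have [_ H] := Hm k; exact: H.
pose hd f g : R * R -> R := fun z => (f z - g z) / 2.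
pose mid f g : R * R -> R := fun z => (f z + g z) / 2.
have Yhd f g : Y f -> Y g -> Y (hd f g).
  move=> [mf bf] [mg bg]; split.
    by apply: measurable_funM => //; exact: measurable_funB.
  move=> k z kz; rewrite /hd normrM (ger0_norm (_ : 0 <= 2^-1)) ?invr_ge0//.
  by have := ler_normB (f z) (g z); have := bf k z kz; have := bg k z kz; lra.
have Ymid f g : Y f -> Y g -> Y (mid f g).
  move=> [mf bf] [mg bg]; split.
    by apply: measurable_funM => //; exact: measurable_funD.
  move=> k z kz; rewrite /mid normrM (ger0_norm (_ : 0 <= 2^-1)) ?invr_ge0//.
  by have := ler_normD (f z) (g z); have := bf k z kz; have := bg k z kz; lra.
have iq f k : Y f -> mu.-integrable (B k) (EFin \o (fun z => f z ^+ 2)).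
  move=> [mf bf]; apply: measurable_bounded_integrable => //.
    by apply: measurable_funX; apply: measurable_funS mf => //; exact: open_plane_measurable.
  exists (m k ^+ 2); split; rewrite ?num_real// => M hM z kz.
  apply: le_trans (ltW hM); rewrite /= normrX lerXn2r ?nnegrE//; exact: bf.
(* Chosen so that box [k] contributes at most [half ^+ k.+1], which puts the sum in [0, 1]. *)
pose c k := half ^+ k.+1 / ((1 + m k ^+ 2) * (1 + b k)).
have h1 k : 0 < 1 + m k ^+ 2 by rewrite ltr_pwDl ?sqr_ge0.
have h2 k : 0 < 1 + b k by rewrite ltr_pwDl.
have hp k : 0 < half ^+ k.+1 by rewrite exprn_gt0// invr_gt0.
have c0 k : 0 < c k by rewrite divr_gt0// mulr_gt0.
pose t f k := c k * \int[mu]_(z in B k) f z ^+ 2.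
have I0 f k : 0 <= \int[mu]_(z in B k) f z ^+ 2.
  by apply: Rintegral_ge0 => z _; exact: sqr_ge0.
have tb f : Y f -> forall k, 0 <= t f k <= half ^+ k.+1.
  move=> Yf k; apply/andP; split; first by apply: mulr_ge0 => //; exact: ltW.
  have le : \int[mu]_(z in B k) f z ^+ 2 <= m k ^+ 2 * b k.
    rewrite -Rintegral_cst//; apply: le_Rintegral => //.
    - exact: iq.
    - exact: integrable_cst_fin.
    - move=> z kz; rewrite -(real_normK (num_real (f z))) lerXn2r ?nnegrE//.
      by have [_ H] := Yf; exact: H.
  rewrite /t /c mulrAC ler_pdivrMr ?mulr_gt0// ler_pM2l//.
  apply: (le_trans le); apply: ler_pM; rewrite ?sqr_ge0 ?b0 ?lerDr//.
pose J f := limn (series (t f)).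
have par f g : Y f -> Y g -> J (mid f g) + J (hd f g) = (J f + J g) / 2.
  move=> Yf Yg.
  have [c1 _ _] := series_dominated (tb _ Yf); have [c2 _ _] := series_dominated (tb _ Yg).
  have [c3 _ _] := series_dominated (tb _ (Ymid _ _ Yf Yg)).
  have [c4 _ _] := series_dominated (tb _ (Yhd _ _ Yf Yg)).
  have e k : t (mid f g) k + t (hd f g) k = (t f k + t g k) / 2.
    rewrite /t -!mulrDr -mulrA; congr (_ * _).
    have i1 := iq _ k Yf; have i2 := iq _ k Yg.
    have i3 := iq _ k (Ymid _ _ Yf Yg); have i4 := iq _ k (Yhd _ _ Yf Yg).
    have i5 : mu.-integrable (B k) (EFin \o (fun z => f z ^+ 2 + g z ^+ 2)).
      exact: (integrableD (mB k) i1 i2).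
    rewrite -[LHS]RintegralD// -[in RHS]RintegralD// [RHS]mulrC -RintegralZl//.
    by apply: eq_Rintegral => z _; rewrite /mid /hd; field.
  exact: limn_series_par.
have J01 f : X 0%N f -> 0 <= J f <= 1.
  by move=> /XY Yf; have [_ ->] := series_dominated (tb _ Yf).
have mono n f : X n f -> X 0%N f by elim: n f => // n IH f /dec /IH.
have e0 n : 0 < (4^-1 : R) ^+ n by rewrite exprn_gt0// invr_gt0.
have edec n : (4^-1 : R) ^+ n.+1 <= 4^-1 ^+ n.
  by rewrite exprS ler_piMl ?(ltW (e0 n))// invf_le1// ler1n.
have [fn Hfn] := min_seq dec ne Xmid J01 (fun f g Xf Xg => par f g (XY _ Xf) (XY _ Xg)) e0 edec.
have Yn n : Y (fn n) by apply: XY; apply: mono (Hfn n).1.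
exists fn; split=> [n|]; first by have [] := Hfn n.
have aek k : {ae mu, forall z, B k z -> cvgn (fun n => fn n z)}.
  have E n : (fun z => (fn n z - fn n.+1 z) ^+ 2) = fun z => 4 * hd (fn n) (fn n.+1) z ^+ 2.
    by apply/funext => z; rewrite /hd; field.
  have ih n := iq _ k (Yhd _ _ (Yn n) (Yn n.+1)).
  (* The factor 4 because the difference is twice the half difference; [c k] undoes the weight of
     box [k]. *)
  apply: (@ae_cvg_of_square (B k) fn (4 / c k) (mB k) (Bfin k)).
  - move=> n; apply: measurable_funS (Yn n).1 => //; exact: open_plane_measurable.
  - by move=> n; rewrite E; exact: (integrableZl (mB k) 4 (ih n)).
  - move=> n; rewrite E RintegralZl// mulrAC -mulrA ler_pM2l// ler_pdivlMr// mulrC.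
    have [_ _ le] := series_dominated (tb _ (Yhd _ _ (Yn n) (Yn n.+1))).
    by apply: (le_trans (le k)); have [] := Hfn n.
have := ae_foralln aek.
apply: ae_mono => z H Dz.
have [r0 rD] := Hrho z Dz.
have [k [kz kr]] := qbox_basis (ball_open z (rho z)) (ballxx z r0).
apply: (H k); rewrite /B; case: asboolP => // nG; exfalso; apply: nG.
by exists z.
Qed.

End minimizing.

(** * Lower semicontinuity *)

Section lsc.
Variable R : realType.
Local Notation plane := (measurableTypeR R * measurableTypeR R)%type.
Local Notation mu := (lebesgue2 R).
Local Notation Kc := (Kc R).
Implicit Types (A B D U K : set plane) (f g h u psi : R * R -> R) (z w p q : R * R)
  (C c e m r s rho : R).

Lemma field_sum N D (F : 'I_N -> R * R -> 'M[R]_2) : (forall i, field D (F i)) ->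
  field D (fun z => \sum_i F i z).
Proof.
elim: N F => [|N IH] F H.
  by rewrite (_ : (fun z => _) = fun=> 0); [exact: field0|apply/funext => z; rewrite big_ord0].
rewrite (_ : (fun z => _) = fun z => F ord0 z + \sum_i F (lift ord0 i) z).
  by apply: fieldD => //; exact: IH.
by apply/funext => z; rewrite big_ord_recl.
Qed.

Lemma div20 : div2 (fun=> 0 : 'M[R]_2) = fun=> 0.
Proof.
apply/funext => z; rewrite /div2 big1// => i _; rewrite big1// => j _.
rewrite (_ : (fun w => _) = fun=> 0); first by rewrite !partial_cst.
by apply/funext => w; rewrite mxE.
Qed.

Lemma L_div2_sum N D f (F : 'I_N -> R * R -> 'M[R]_2) : L1loc D f ->
  (forall i, field D (F i)) ->
  L f (div2 (fun z => \sum_i F i z)) = \sum_i L f (div2 (F i)).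
Proof.
move=> lf; elim: N F => [|N IH] F H.
  rewrite big_ord0 (_ : (fun z => _) = fun=> 0); first by rewrite div20 L_zero.
  by apply/funext => z; rewrite big_ord0.
rewrite big_ord_recl -IH//.
rewrite -(L_div2D lf (H ord0) (field_sum (fun i => H (lift ord0 i)))).
by congr (L f (div2 _)); apply/funext => z; rewrite big_ord_recl.
Qed.

Lemma L_div2Z D f F c : L1loc D f -> field D F ->
  L f (div2 (fun z => c *: F z)) = c * L f (div2 F).
Proof.
move=> lf HF; by rewrite (div2Z _ (field_smoothF HF)) (L_scaler _ (intg_div2 lf HF)).
Qed.

Lemma L_ring D f p s s' : L1loc D f -> 0 < s <= s' -> cball p (2 * s') `<=` D ->
  L f (div2 (ring_field p s s')) = mean f s p - mean f s' p.
Proof.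
move=> lf /andP[s0 ss] pD; have s'0 := lt_le_trans s0 ss.
have pD' : cball p (2 * s) `<=` D.
  by apply: subset_trans pD => z hz; apply: (le_trans hz); rewrite ler_pM2l.
by rewrite /mean div2_ring_field L_subr//; [exact: (intg_kap s0 lf pD')|exact: (intg_kap s'0 lf pD)].
Qed.

Lemma uniform_small N (P : 'I_N -> R -> Prop) :
  (forall i, exists2 s0, 0 < s0 & forall s, 0 < s < s0 -> P i s) ->
  exists2 s0, 0 < s0 & forall i s, 0 < s < s0 -> P i s.
Proof.
elim: N P => [|N IH] P H; first by exists 1 => // -[].
have [s1 s10 H1] := H ord0; have [s2 s20 H2] := IH _ (fun i => H (lift ord0 i)).
exists (Num.min s1 s2); first by rewrite lt_min s10.
move=> i s /andP[s0]; rewrite lt_min => /andP[a b].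
by case: (unliftP ord0 i) => [j ->|->]; [apply: H2|apply: H1]; rewrite s0.
Qed.

Variables (D : set plane) (N : nat) (x : 'I_N -> R * R).
Hypotheses (oD : open (D : set (R * R))) (xD : forall i, D (x i)) (xinj : injective x).

(** Cutoffs of scale [s] reach [2 * s], so those at distinct data points have disjoint supports. *)
Lemma separated : exists2 s0, 0 < s0 & forall s, 0 < s < s0 ->
  (forall i, cball (x i) (2 * s) `<=` D) /\
  forall i j, i != j -> 4 * s < `|x i - x j|.
Proof.
have H i : exists2 s0, 0 < s0 & forall s, 0 < s < s0 ->
    cball (x i) (2 * s) `<=` D /\ forall j, i != j -> 4 * s < `|x i - x j|.
  have /nbhs_ballP[r /= r0 Hr] : nbhs (x i) D by exact: open_nbhs_nbhs.
  have [s1 s10 H1] : exists2 s0, 0 < s0 & forall j s, 0 < s < s0 -> i != j -> 4 * s < `|x i - x j|.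
    apply: uniform_small => j.
    have [->|ij] := eqVneq i j; first by exists 1.
    have d0 : 0 < `|x i - x j|.
      by rewrite normr_gt0 subr_eq0; apply: contraNneq ij => /xinj ->.
    by exists (`|x i - x j| / 4) => [|s /andP[_ h] _]; [rewrite divr_gt0|lra].
  exists (Num.min s1 (r / 2)); first by rewrite lt_min s10 divr_gt0.
  move=> s /andP[s0]; rewrite lt_min => /andP[a b]; split.
    by move=> z hz; apply: Hr; apply/ball2P; apply: (le_lt_trans hz); lra.
  by move=> j; apply: H1; rewrite s0.
have [s0 s00 Hs] := uniform_small H; exists s0 => // s hs.
by split=> [i|i j]; have [a b] := Hs i s hs; [exact: a|exact: b].
Qed.

(** [F0] is removed around each data point and a ring put in its place. The outer scale [r / 4]
    keeps the ring within [r / 2], where [F0] is cut away entirely, so the norms do not add. *)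
Definition testF (F0 : R * R -> 'M[R]_2) (tau : 'I_N -> R) r e z : 'M[R]_2 :=
  (F0 z - \sum_i cut r (x i) z *: F0 z) - \sum_i tau i *: ring_field (x i) e (r / 4) z.

Lemma ring_out p s s' z : 0 < s <= s' -> 2 * s' < `|z - p| -> ring_field p s s' z = 0.
Proof. by move=> ss h; rewrite /ring_field /shiftF RsB_out. Qed.

Lemma opb_testF F0 tau r e z : (forall z, opb 1 (F0 z)) -> (forall i, `|tau i| <= 1) ->
  (forall i j, i != j -> 4 * r < `|x i - x j|) -> 0 < e <= r / 4 ->
  opb 1 (testF F0 tau r e z).
Proof.
move=> F1 tau1 sep ee; have r0 : 0 < r by have /andP[? ?] := ee; lra.
have far i : 2 * r < `|z - x i| ->
    cut r (x i) z *: F0 z = 0 /\ tau i *: ring_field (x i) e (r / 4) z = 0.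
  move=> h; rewrite cut_out// scale0r; split=> //.
  by rewrite ring_out ?scaler0//; apply: lt_trans h; lra.
have [[i hi]|none] := pselect (exists i, `|z - x i| <= 2 * r); last first.
  have h i : 2 * r < `|z - x i|.
    by rewrite ltNge; apply/negP => h; apply: none; exists i.
  rewrite /testF !big1 ?subr0; first exact: F1.
    by move=> i _; have [] := far i (h i).
  by move=> i _; have [] := far i (h i).
have fj j : j != i -> 2 * r < `|z - x j|.
  move=> ji; have := sep j i ji; rewrite ltNge => s1; rewrite ltNge; apply/negP => h.
  move/negP: s1; apply; have -> : x j - x i = (z - x i) - (z - x j) by rewrite opprB [RHS]addrC addrA subrK.
  by apply: (le_trans (ler_normB _ _)); lra.
have -> : testF F0 tau r e z =
    (F0 z - cut r (x i) z *: F0 z) - tau i *: ring_field (x i) e (r / 4) z.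
  rewrite /testF; congr (_ - _ - _); rewrite (bigD1 i)//= big1 ?addr0// => j ji;
    by have [] := far j (fj j ji).
have [h|h] := leP `|z - x i| (r / 2).
  rewrite cut_in// scale1r subrr sub0r; apply: opbN.
  apply: (@opb_le _ (`|tau i| * 1)); first by rewrite mulr1.
  by apply: opb_norm; exact: opb_ring_field.
rewrite ring_out//; last by apply: le_lt_trans h; lra.
rewrite scaler0 subr0 -[X in X - _]scale1r -scalerBl.
apply: (@opb_le _ (`|1 - cut r (x i) z| * 1)); last exact: opb_norm.
by rewrite mulr1 ger0_norm ?subr_ge0 ?cut_le1// gerBl cut_ge0.
Qed.

Lemma field_ring_sum (tau : 'I_N -> R) r e : (forall i, cball (x i) (2 * r) `<=` D) ->
  0 < e <= r / 4 -> forall i, field D (fun z => tau i *: ring_field (x i) e (r / 4) z).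
Proof.
move=> rD ee i; apply: fieldZ; apply: ring_field_field => //.
apply: subset_trans (rD i) => z hz; apply: (le_trans hz).
by have /andP[? ?] := ee; lra.
Qed.

Lemma field_testF F0 tau r e : field D F0 -> (forall i, cball (x i) (2 * r) `<=` D) ->
  0 < e <= r / 4 -> field D (testF F0 tau r e).
Proof.
move=> HF0 rD ee; apply: fieldB; last exact/field_sum/field_ring_sum.
by apply: fieldB => //; apply: field_sum => i; apply: fieldM => //; exact: smooth_cut.
Qed.

Definition cutoff_part f F0 r : R :=
  L f (div2 F0) - \sum_i L f (div2 (fun z => cut r (x i) z *: F0 z)).

Lemma L_testF f F0 tau r e : L1loc D f -> field D F0 ->
  (forall i, cball (x i) (2 * r) `<=` D) -> 0 < e <= r / 4 ->
  L f (div2 (testF F0 tau r e)) =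
  cutoff_part f F0 r - \sum_i tau i * (mean f e (x i) - mean f (r / 4) (x i)).
Proof.
move=> lf HF0 rD ee.
have H1 i : field D (fun z => cut r (x i) z *: F0 z) by apply: fieldM => //; exact: smooth_cut.
have H2 := field_ring_sum tau rD ee.
rewrite (L_div2B lf (fieldB HF0 (field_sum H1)) (field_sum H2)).
rewrite (L_div2B lf HF0 (field_sum H1)) (L_div2_sum lf H1) (L_div2_sum lf H2).
congr (_ - _); apply: eq_bigr => i _.
have HR : field D (ring_field (x i) e (r / 4)).
  apply: ring_field_field => //; apply: subset_trans (rD i) => z hz.
  by apply: (le_trans hz); have /andP[? ?] := ee; lra.
rewrite (L_div2Z _ lf HR) (L_ring lf ee)//.
by apply: subset_trans (rD i) => z hz; apply: (le_trans hz); have /andP[? ?] := ee; lra.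
Qed.

(* Letting the inner radius of the rings tend to 0 brings in the values of [f]
   at the points [x i]. *)
Lemma cutoff_ineq f c F0 tau r : cfun D f -> Vle D f c -> field D F0 ->
  (forall z, opb 1 (F0 z)) -> (forall i, `|tau i| <= 1) ->
  (forall i, cball (x i) (2 * r) `<=` D) ->
  (forall i j, i != j -> 4 * r < `|x i - x j|) -> 0 < r ->
  cutoff_part f F0 r + \sum_i tau i * mean f (r / 4) (x i) <=
  c + \sum_i tau i * (Kc * f (x i)).
Proof.
move=> cf Vf HF0 F1 tau1 rD sep r0; have lf := L1loc_cont oD cf.
have r40 : 0 < r / 4 by rewrite divr_gt0.
have [M HM] := scale_small r40.
have cv : cutoff_part f F0 r - \sum_i tau i * (mean f (scale R n) (x i) - mean f (r / 4) (x i))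
    @[n --> \oo] -->
    cutoff_part f F0 r - \sum_i tau i * (Kc * f (x i) - mean f (r / 4) (x i)).
  apply: cvgB; first exact: cvg_cst.
  apply: (@cvg_big _ _ +%R) => [w|i _]; first exact: add_continuous.
  apply: cvgM; first exact: cvg_cst.
  apply: cvgB; last exact: cvg_cst.
  by rewrite -(rep_cfun oD cf Vf (xD i)); exact: mean_cvg Vf.
have : cutoff_part f F0 r - \sum_i tau i * (Kc * f (x i) - mean f (r / 4) (x i)) <= c.
  apply: (cvgr_to_le cv); exists M => // n /= Mn.
  have ee : 0 < scale R n <= r / 4 by rewrite scale_gt0 HM.
  rewrite -(L_testF tau lf HF0 rD ee); apply: Vf; first exact: field_testF.
  by move=> z; exact: opb_testF.
rewrite (_ : \sum_i tau i * (Kc * f (x i) - mean f (r / 4) (x i)) =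
  \sum_i tau i * (Kc * f (x i)) - \sum_i tau i * mean f (r / 4) (x i)); first by lra.
by rewrite -sumrB; apply: eq_bigr => i _; rewrite mulrBr.
Qed.

(** The left side of [cutoff_ineq] involves only pairings, which pass to the limit; on its right
    side the point values of [fn n] are absorbed by the data term of the minimising sequence.
    Letting [r] tend to 0 afterwards brings back the point values of the limit. *)
Lemma lower_semicontinuity (y : 'I_N -> R) lam (fn : nat -> R * R -> R) (cn en : nat -> R) m f c :
  0 <= lam <= Kc -> (forall n, cfun D (fn n)) -> (forall n, Vle D (fn n) (cn n)) ->
  (forall n, cn n + lam * \sum_i `|fn n (x i) - y i| <= m + en n) ->
  en n @[n --> \oo] --> (0 : R) ->
  (forall psi, continuous psi -> supported D psi -> L (fn n) psi @[n --> \oo] --> L f psi) ->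
  cfun D f -> Vle D f c ->
  Vle D f (m - lam * \sum_i `|f (x i) - y i|).
Proof.
move=> /andP[lam0 lamK] cfn Vfn Hm en0 cvL cf Vf F0 HF0 F1.
have lf := L1loc_cont oD cf.
have K0 := Kc_gt0 R.
pose sg i := Num.sg (f (x i) - y i).
(* The sign is taken from the limit [f], so that its data term is reproduced exactly; [lam <= Kc] is
   what makes [tau i] an admissible coefficient. *)
pose tau i := lam / Kc * sg i.
have tauK i : tau i * Kc = lam * sg i by rewrite /tau; field; rewrite gt_eqF.
have sg1 i : `|sg i| <= 1 by rewrite normr_sg; case: (_ != 0).
have tau1 i : `|tau i| <= 1.
  rewrite /tau normrM -[leRHS]mulr1; apply: ler_pM => //.
  by rewrite ger0_norm ?divr_ge0 ?(ltW K0)// ler_pdivrMr// mul1r.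
have cF := continuous_div2 HF0.
have sF := supported_div2 HF0.
have step r : 0 < r -> (forall i, cball (x i) (2 * r) `<=` D) ->
    (forall i j, i != j -> 4 * r < `|x i - x j|) ->
    cutoff_part f F0 r + \sum_i tau i * mean f (r / 4) (x i) <= m + \sum_i lam * sg i * y i.
  move=> r0 rD sep.
  have r40 : 0 < r / 4 by rewrite divr_gt0.
  have cv : cutoff_part (fn n) F0 r + \sum_i tau i * mean (fn n) (r / 4) (x i)
      @[n --> \oo] --> cutoff_part f F0 r + \sum_i tau i * mean f (r / 4) (x i).
    apply: cvgD.
      apply: cvgB; first exact: cvL.
      apply: (@cvg_big _ _ +%R) => [w|i _]; first exact: add_continuous.
      have H1 : field D (fun z => cut r (x i) z *: F0 z) by apply: fieldM => //; exact: smooth_cut.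
      by apply: cvL; [exact: continuous_div2 H1|exact: supported_div2].
    apply: (@cvg_big _ _ +%R) => [w|i _]; first exact: add_continuous.
    apply: cvgM; first exact: cvg_cst.
    apply: cvL; first exact: continuous_kap.
    apply: kap_supported => //; apply: subset_trans (rD i) => z hz.
    by apply: (le_trans hz); lra.
  have cv2 : m + en n + \sum_i lam * sg i * y i @[n --> \oo] --> m + 0 + \sum_i lam * sg i * y i.
    by apply: cvgD; [apply: cvgD => //; exact: cvg_cst|exact: cvg_cst].
  rewrite -[X in X + \sum_i lam * _ * _]addr0.
  apply: (ler_cvg_to cv cv2); apply: nearW => n.
  apply: (le_trans (cutoff_ineq (cfn n) (Vfn n) HF0 F1 tau1 rD sep r0)).
  apply: (@le_trans _ _ (cn n + (lam * \sum_i `|fn n (x i) - y i| + \sum_i lam * sg i * y i))); last first.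
    by rewrite addrA lerD2r.
  rewrite lerD2l mulr_sumr -big_split /=; apply: ler_sum => i _.
  rewrite mulrA tauK -!mulrA -mulrDr ler_wpM2l//.
  have -> : sg i * fn n (x i) = sg i * (fn n (x i) - y i) + sg i * y i by ring.
  rewrite lerD2r; apply: (le_trans (ler_norm _)); rewrite normrM ler_piMl//.
have [s1 s10 Hs1] := separated.
rewrite lerBrDr; apply/ler_addgt0Pr => e e0.
(* Each data point contributes two errors of size [d]: from removing [F0] and from replacing a mean
   by a point value. *)
pose d := e / (2 * (N%:R + 1)).
have N0 : 0 <= N%:R :> R by [].
have d0 : 0 < d by rewrite divr_gt0// mulr_gt0// ltr_wpDl.
have [s2 s20 Hs2] := uniform_small (fun i => cut_field_lim oD (xD i) lf (cf _ (xD i)) (field_smoothF HF0) d0).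
have [s3 s30 Hs3] := uniform_small (fun i => kap_lim oD (xD i) lf (cf _ (xD i)) d0).
pose r := Num.min s1 (Num.min s2 s3) / 2.
have mp : 0 < Num.min s1 (Num.min s2 s3) by rewrite !lt_min s10 s20.
have r0 : 0 < r by rewrite divr_gt0.
have : r < Num.min s1 (Num.min s2 s3) by rewrite /r; lra.
rewrite !lt_min => /and3P[r1 r2 r3].
have [rD sep] : (forall i, cball (x i) (2 * r) `<=` D) /\
  forall i j, i != j -> 4 * r < `|x i - x j| by apply: Hs1; rewrite r0.
have := step r r0 rD sep; rewrite /cutoff_part.
have b1 : \sum_i L f (div2 (fun z => cut r (x i) z *: F0 z)) <= N%:R * d.
  rewrite -[X in X%:R * d]card_ord -sumr_const mulr_suml; apply: ler_sum => i _.
  by rewrite mul1r; apply: (le_trans (ler_norm _)); apply: Hs2; rewrite r0.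
have b2 : lam * \sum_i `|f (x i) - y i| <=
    \sum_i tau i * mean f (r / 4) (x i) - \sum_i lam * sg i * y i + N%:R * d.
  rewrite -[X in X%:R * d]card_ord -sumr_const mulr_suml -sumrB -big_split mulr_sumr /=.
  apply: ler_sum => i _; rewrite mul1r.
  have h : `|mean f (r / 4) (x i) - f (x i) * Kc| <= d.
    by apply: Hs3; lra.
  have E : lam * `|f (x i) - y i| = tau i * (f (x i) * Kc) - lam * sg i * y i.
    have -> : tau i * (f (x i) * Kc) = lam * sg i * f (x i).
      by rewrite [f _ * _]mulrC mulrA tauK.
    by rewrite -mulrBr -mulrA -normrEsg.
  rewrite E.
  have : `|tau i * (mean f (r / 4) (x i) - f (x i) * Kc)| <= d.
    by rewrite normrM -[leRHS]mul1r ler_pM.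
  rewrite mulrBr ler_norml => /andP[h1 _]; lra.
have dd : 2 * (N%:R * d) <= e.
  have -> : 2 * (N%:R * d) = e * (N%:R / (N%:R + 1)) by rewrite /d; field; rewrite gt_eqF// ltr_wpDl.
  by rewrite ler_piMr ?(ltW e0)// ler_pdivrMr ?mul1r ?lerDl// ltr_wpDl.
move=> st; lra.
Qed.

End lsc.

(** * Existence for small weights *)

Section existence.
Variable R : realType.
Local Notation plane := (measurableTypeR R * measurableTypeR R)%type.
Local Notation mu := (lebesgue2 R).
Local Notation Kc := (Kc R).
Implicit Types (A B D U K : set plane) (f g h u psi : R * R -> R) (z w p q : R * R)
  (C c e m r s rho : R).

Lemma VleD D f g c c' : open (D : set (R * R)) -> L1loc D f -> L1loc D g ->
  Vle D f c -> Vle D g c' -> Vle D (fun z => f z + g z) (c + c').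
Proof.
move=> oD lf lg Vf Vg F HF F1.
rewrite (L_addl (intg_div2 lf HF) (intg_div2 lg HF)).
by apply: lerD; [exact: Vf|exact: Vg].
Qed.

Lemma VleZ D f c a : L1loc D f -> Vle D f c -> Vle D (fun z => a * f z) (`|a| * c).
Proof.
move=> lf Vf F HF F1.
rewrite (L_scalel _ (intg_div2 lf HF)).
have -> : a * L f (div2 F) = L f (div2 (fun z => a *: F z)) by rewrite (L_div2Z _ lf HF).
have o z : opb `|a| (a *: F z) by rewrite -[`|a|]mulr1; exact: opb_norm.
exact: (Vle_opb (normr_ge0 a) Vf (fieldZ a HF) o lf).
Qed.

Lemma locally_bounded_compact D (rho bnd : R * R -> R) (P : (R * R -> R) -> Prop) :
  (forall q, D q -> 0 < rho q) ->
  (forall f, P f -> forall q z, D q -> ball q (rho q) z -> `|f z| <= bnd q) ->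
  forall K, compact (K : set (R * R)) -> K `<=` D ->
    exists M : R, forall f z, P f -> K z -> `|f z| <= M.
Proof.
move=> Hrho Hb K /compact_near_coveringP cK KD.
have := cK R (nbhs +oo) (fun M z => forall f, P f -> `|f z| <= M) _.
case.
  move=> q Kq; have r0 := Hrho q (KD q Kq).
  exists (ball q (rho q), [set M | bnd q <= M]).
    split; first exact: nbhsx_ballx.
    by apply: nbhs_pinfty_ge; rewrite num_real.
  move=> [z M] [/= hz hM] f Pf; apply: le_trans hM.
  exact: (Hb f Pf q z (KD q Kq) hz).
move=> M [_ HM]; exists (M + 1) => f z Pf Kz.
by apply: (HM (M + 1)) => //; rewrite ltrDl.
Qed.

Lemma ae_limit D (fn : nat -> R * R -> R) : open (D : set (R * R)) ->
  (forall n, cfun D (fn n)) ->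
  (forall K, compact (K : set (R * R)) -> K `<=` D ->
     exists M, forall n z, K z -> `|fn n z| <= M) ->
  {ae mu, forall z, D z -> cvgn (fun n => fn n z)} ->
  exists f, L1loc D f /\ forall psi, continuous psi -> supported D psi ->
    L (fn n) psi @[n --> \oo] --> L f psi.
Proof.
move=> oD cfn bdd cv.
(* The upper limit is measurable without reference to the exceptional null set, and equals the limit
   wherever that exists. *)
pose f z := fine (limn_esup (fun n => (fn n z)%:E)).
have mfn n : measurable_fun D (fn n) := continuous_on_measurable oD (cfn n).
have mf : measurable_fun D f.
  apply: measurableT_comp => //; apply: measurable_fun_limn_esup => n.
  exact/measurable_EFinP.
have cvf : {ae mu, forall z, D z -> fn n z @[n --> \oo] --> f z}.
  apply: ae_mono cv => z H Dz.
  have h := H Dz; have hE : (fn n z)%:E @[n --> \oo] --> (limn (fun n => fn n z))%:E.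
    by apply: cvg_EFin => //; exact: nearW.
  by rewrite /f (cvg_limn_einf_sup hE).
exists f; split; last by move=> psi cpsi supp; exact: (L_dominated oD mfn mf cvf bdd cpsi supp).
split=> // K cK KD.
have [M HM] := bdd K cK KD.
have mK := compact_plane_measurable cK.
have mD := open_plane_measurable oD.
have [] // := @dominated_convergence _ _ _ mu K mK
  (fun n z => (fn n z)%:E) (EFin \o f) (fun=> M%:E).
- by move=> n; apply/measurable_EFinP; exact: measurable_funS (mfn n).
- by apply/measurable_EFinP; exact: measurable_funS mf.
- apply: ae_mono cvf => z H Kz.
  by apply: cvg_EFin; [exact: nearW|exact: H (KD _ Kz)].
- by apply: integrable_cst_fin => //; exact: compact_mu_fin.
- by apply: aeW => z n Kz; rewrite lee_fin; exact: HM.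
Qed.

Lemma Vle_weak_limit D (fn : nat -> R * R -> R) f c : (forall n, Vle D (fn n) c) ->
  (forall psi, continuous psi -> supported D psi -> L (fn n) psi @[n --> \oo] --> L f psi) ->
  Vle D f c.
Proof.
move=> Vf cv F HF F1.
apply: (cvgr_to_le (cv _ (continuous_div2 HF) (supported_div2 HF))); apply: nearW => n.
exact: Vf.
Qed.

Lemma Vle_le D f c c' : c <= c' -> Vle D f c -> Vle D f c'.
Proof. by move=> cc Vf F HF F1; apply: le_trans cc; exact: Vf. Qed.

(* The direct method. Locally affine functions are not penalised, so a
   minimising sequence only becomes locally bounded after [normalize]. *)
Lemma exists_minimizer D N (x : 'I_N -> R * R) (y : 'I_N -> R) lam :
  open (D : set (R * R)) -> (forall i, D (x i)) -> injective x -> 0 < lam <= Kc ->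
  exists f c, [/\ cfun D f, Vle D f c & forall g c', cfun D g -> Vle D g c' ->
    c + lam * \sum_i `|f (x i) - y i| <= c' + lam * \sum_i `|g (x i) - y i|].
Proof.
move=> oD xD xinj /andP[lam0 lamK].
pose E f c := c + lam * \sum_i `|f (x i) - y i|.
pose S := [set v | exists f c, [/\ cfun D f, Vle D f c & v = E f c]].
have S0 : S !=set0.
  exists (E (fun=> 0) 0), (fun=> 0), 0; split=> //; first by move=> z _; exact: cvg_cst.
  exact: Vle_zero.
have sum0 f : 0 <= \sum_i `|f (x i) - y i| by apply: sumr_ge0.
have Sl : has_lbound S.
  exists 0 => _ [f [c [_ Vf ->]]]; have c0 := Vle_ge0 Vf.
  by rewrite /E addr_ge0// mulr_ge0// ltW.
pose m := inf S.
have mle f c : cfun D f -> Vle D f c -> m <= E f c.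
  by move=> cf Vf; apply: ge_inf => //; exists f, c.
have m0 : 0 <= m.
  apply: lb_le_inf => // _ [f [c [_ Vf ->]]]; have c0 := Vle_ge0 Vf.
  by rewrite /E addr_ge0// mulr_ge0// ltW.
(* Bounds the variation and, since [lam] is positive, the point values of any [f] with
   [E f c <= m + 1]. *)
pose bb := m + 1 + ((m + 1) / lam + \sum_i `|y i|).
have y0 : 0 <= \sum_i `|y i| by apply: sumr_ge0.
have q0 : 0 <= (m + 1) / lam by rewrite divr_ge0 ?addr_ge0// ltW.
have bb0 : 0 <= bb by rewrite /bb !addr_ge0.
have [rho [bnd [Hrho Hn]]] := normalize oD bb0 xD.
pose X n f := cfun D f /\ exists c, [/\ Vle D f c, E f c <= m + scale R n &
  forall q z, D q -> ball q (rho q) z -> `|f z| <= bnd q].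
have sc1 n : scale R n <= 1 by rewrite /scale invf_le1// ler1n.
have Xdec n f : X n.+1 f -> X n f.
  move=> [cf [c [Vf h b]]]; split=> //; exists c; split=> //; apply: (le_trans h).
  by rewrite lerD2l /scale lef_pV2 ?posrE// ler_nat.
have Xne n : exists f, X n f.
  have [_ [f [c [cf Vf ->]]] hf] := inf_adherent (scale_gt0 R n) (conj S0 Sl).
  have hm : E f c <= m + 1 by apply: (le_trans (ltW hf)); rewrite lerD2l.
  have c0 := Vle_ge0 Vf.
  have cb : c <= bb.
    rewrite /E in hm; have : 0 <= lam * \sum_i `|f (x i) - y i| by rewrite mulr_ge0// ltW.
    by rewrite /bb; lra.
  have fb i : `|f (x i)| <= bb.
    have h1 : `|f (x i) - y i| <= (m + 1) / lam.
      rewrite ler_pdivlMr// mulrC; apply: le_trans hm; rewrite /E.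
      apply: (@le_trans _ _ (lam * \sum_i `|f (x i) - y i|)); last by rewrite lerDr.
      rewrite ler_pM2l// (bigD1 i)//= lerDl; exact: sumr_ge0.
    have h2 : `|y i| <= \sum_i `|y i| by rewrite (bigD1 i)//= lerDl; exact: sumr_ge0.
    have h3 := ler_normD (f (x i) - y i) (y i); rewrite subrK in h3.
    by rewrite /bb; lra.
  have [g [cg Vg gx gb]] := Hn f c cf Vf cb fb.
  exists g; split=> //; exists c; split=> //.
  apply: le_trans (ltW hf); rewrite /E lerD2l ler_pM2l//.
  by apply: ler_sum => i _; rewrite gx.
have Xmid n f g : X n f -> X n g -> X n (fun z => (f z + g z) / 2).
  move=> [cf [c [Vf hf bf]]] [cg [c' [Vg hg bg]]]; split.
    by move=> z Dz; apply: cvgM; [apply: cvgD; [exact: cf|exact: cg]|exact: cvg_cst].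
  exists ((c + c') / 2); split.
  - have lf := L1loc_cont oD cf; have lg := L1loc_cont oD cg.
    have lf2 : L1loc D (fun z => 2^-1 * f z).
      by apply: L1loc_cont => // z Dz; apply: cvgM; [exact: cvg_cst|exact: cf].
    have lg2 : L1loc D (fun z => 2^-1 * g z).
      by apply: L1loc_cont => // z Dz; apply: cvgM; [exact: cvg_cst|exact: cg].
    have -> : (c + c') / 2 = `|2^-1| * c + `|2^-1| * c'.
      by rewrite ger0_norm ?invr_ge0//; field.
    have -> : (fun z => (f z + g z) / 2) = fun z => 2^-1 * f z + 2^-1 * g z.
      by apply/funext => z; field.
    exact: (VleD oD lf2 lg2 (VleZ 2^-1 lf Vf) (VleZ 2^-1 lg Vg)).
  - have -> : m + scale R n = ((m + scale R n) + (m + scale R n)) / 2 by field.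
    apply: (@le_trans _ _ ((E f c + E g c') / 2)); last first.
      by rewrite ler_pM2r ?invr_gt0// lerD.
    rewrite /E; have -> : (c + lam * \sum_i `|f (x i) - y i| +
        (c' + lam * \sum_i `|g (x i) - y i|)) / 2 =
        (c + c') / 2 + lam * ((\sum_i `|f (x i) - y i| + \sum_i `|g (x i) - y i|) / 2) by field.
    rewrite lerD2l ler_pM2l// -big_split /= mulr_suml; apply: ler_sum => i _.
    have -> : (f (x i) + g (x i)) / 2 - y i = ((f (x i) - y i) + (g (x i) - y i)) / 2 by field.
    by rewrite normrM (ger0_norm (_ : 0 <= 2^-1)) ?invr_ge0// ler_pM2r ?invr_gt0// ler_normD.
  - move=> q z Dq qz; rewrite normrM (ger0_norm (_ : 0 <= 2^-1)) ?invr_ge0//.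
    have := ler_normD (f z) (g z); have := bf q z Dq qz; have := bg q z Dq qz; lra.
have Xb f : X 0%N f -> measurable_fun D f /\
    forall q z, D q -> ball q (rho q) z -> `|f z| <= bnd q.
  by move=> [cf [c [_ _ b]]]; split=> //; exact: continuous_on_measurable.
have [fn [Xfn cvae]] := ae_cvg_seq oD Hrho Xdec Xne Xmid Xb.
have X0 n f : X n f -> X 0%N f by elim: n f => // n IH f /Xdec /IH.
have bdd K : compact (K : set (R * R)) -> K `<=` D ->
    exists M, forall n z, K z -> `|fn n z| <= M.
  move=> cK KD.
  have [M HM] := locally_bounded_compact (fun q Dq => (Hrho q Dq).1)
    (fun f Xf => (Xb f Xf).2) cK KD.
  by exists M => n z; apply: HM; exact: X0 (Xfn n).
have cfn n : cfun D (fn n) by have [] := Xfn n.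
have [f0 [lf0 cv0]] := ae_limit oD cfn bdd cvae.
have pick n : exists c, Vle D (fn n) c /\ E (fn n) c <= m + scale R n.
  by have [_ [c [? ? _]]] := Xfn n; exists c.
have [cn Hcn] := choice pick.
(* A crude bound, used only to obtain the continuous representative; the sharp one comes from
   [lower_semicontinuity]. *)
have V0 : Vle D f0 (m + 1).
  apply: Vle_weak_limit cv0 => n; have [Vn En] := Hcn n.
  apply: Vle_le Vn; apply: le_trans (lerD (lexx m) (sc1 n)); apply: le_trans En.
  by rewrite /E lerDl mulr_ge0// ltW.
have ae0 := rep_ae oD lf0 V0.
have cf : cfun D (rep f0) by move=> z Dz; exact: rep_continuous V0.
have lr := L1loc_cont oD cf.
have Vr := Vle_ae oD ae0 lf0 lr V0.
have cvr psi : continuous psi -> supported D psi ->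
    L (fn n) psi @[n --> \oo] --> L (rep f0) psi.
  by move=> cpsi supp; rewrite -(L_ae oD ae0 lf0 lr cpsi supp); exact: cv0.
have sc0 : scale R n @[n --> \oo] --> (0 : R).
  apply/cvgrPdist_le => e e0; have [M HM] := scale_small e0.
  exists M => // n /= Mn; rewrite sub0r normrN ger0_norm ?HM//.
  exact/ltW/scale_gt0.
have lamK' : 0 <= lam <= Kc by rewrite lamK ltW.
have := lower_semicontinuity oD xD xinj lamK' cfn (fun n => (Hcn n).1) (fun n => (Hcn n).2)
  sc0 cvr cf Vr.
move=> VV; exists (rep f0), (m - lam * \sum_i `|rep f0 (x i) - y i|); split=> //.
by move=> g c' cg Vg; rewrite subrK; exact: mle.
Qed.

End existence.

(** * Interpolation by cones and the theorem *)

Section final.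
Variable R : realType.
Local Notation plane := (measurableTypeR R * measurableTypeR R)%type.
Local Notation mu := (lebesgue2 R).
Local Notation Kc := (Kc R).
Implicit Types (A B D U K : set plane) (f g h u psi : R * R -> R) (z w p q : R * R)
  (C c e m r s rho : R).

Lemma point_value_cfun D f z : open (D : set (R * R)) -> cfun D f -> D z ->
  point_value D f z = f z.
Proof. by move=> oD cf Dz; apply: point_value_eq => //; exact: aeW. Qed.

Lemma hessian_ge0 D f : open (D : set (R * R)) -> L1loc D f -> (0 <= hessian_schatten1 f D)%E.
Proof.
move=> oD lf; case E : hessian_schatten1 => [c| |] //.
  by rewrite lee_fin; apply: (@Vle_ge0 _ D f); apply/(hessian_leP _ oD lf); rewrite E.
have : Vle D f (-1) by apply/(hessian_leP _ oD lf); rewrite E leNye.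
by move/Vle_ge0; rewrite lerNr oppr0 ler10.
Qed.

Lemma finite_variation D f : open (D : set (R * R)) -> L1loc D f ->
  (hessian_schatten1 f D < +oo)%E ->
  exists c, [/\ hessian_schatten1 f D = c%:E, cfun D (rep f), Vle D (rep f) c &
    forall z, D z -> point_value D f z = rep f z].
Proof.
move=> oD lf fin; have h0 := hessian_ge0 oD lf.
have fE : hessian_schatten1 f D = (fine (hessian_schatten1 f D))%:E.
  by rewrite fineK// ge0_fin_numE.
have Vf : Vle D f (fine (hessian_schatten1 f D)) by apply/(hessian_leP _ oD lf); rewrite -fE.
have ae := rep_ae oD lf Vf.
have cf : cfun D (rep f) by move=> z Dz; exact: rep_continuous Vf.
exists (fine (hessian_schatten1 f D)); split=> //.
  exact: Vle_ae ae lf (L1loc_cont oD cf) Vf.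
by move=> z Dz; exact: point_value_eq.
Qed.

Lemma Vle_sum N D (f : 'I_N -> R * R -> R) (c : 'I_N -> R) : open (D : set (R * R)) ->
  (forall i, cfun D (f i)) -> (forall i, Vle D (f i) (c i)) ->
  cfun D (fun z => \sum_i f i z) /\ Vle D (fun z => \sum_i f i z) (\sum_i c i).
Proof.
move=> oD; elim: N f c => [|N IH] f c cf Vf.
  have -> : (fun z => \sum_(i < 0) f i z) = fun=> 0.
    by apply/funext => z; rewrite big_ord0.
  rewrite big_ord0; split; first by move=> z _; exact: cvg_cst.
  exact: Vle_zero.
have [c1 V1] := IH _ _ (fun i => cf (lift ord0 i)) (fun i => Vf (lift ord0 i)).
have -> : (fun z => \sum_i f i z) = fun z => f ord0 z + \sum_i f (lift ord0 i) z.
  by apply/funext => z; rewrite big_ord_recl.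
rewrite big_ord_recl; split.
  by move=> z Dz; apply: cvgD; [exact: cf|exact: c1].
exact: (VleD oD (L1loc_cont oD (cf ord0)) (L1loc_cont oD c1) (Vf ord0) V1).
Qed.

(* A cone of height [a] costs [Kc * `|a|], so beyond [lam = Kc] it pays off to
   interpolate the data exactly. *)
Lemma interpolate D N (x : 'I_N -> R * R) (y : 'I_N -> R) f c : open (D : set (R * R)) ->
  (forall i, D (x i)) -> injective x -> cfun D f -> Vle D f c ->
  exists g, [/\ cfun D g, Vle D g (c + Kc * \sum_i `|f (x i) - y i|) & forall i, g (x i) = y i].
Proof.
move=> oD xD xinj cf Vf.
have [s0 s00 Hs] := separated oD xD xinj.
have [s s1] : exists s, 0 < s < s0 by exists (s0 / 2); lra.
have [_ sep] := Hs s s1; have /andP[sp _] := s1.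
(* The factor turns the height [coneh] into the defect at [x i]; by separation every other cone
   vanishes there. *)
pose k i z := (y i - f (x i)) / coneh R * cone (x i) s z.
have h0 := @coneh_gt0 R.
have ck i : cfun D (k i).
  by move=> z _; apply: cvgM; [exact: cvg_cst|exact: cone_continuous].
have Vk i : Vle D (k i) (Kc * `|f (x i) - y i|).
  have lc : L1loc D (cone (x i) s) by apply: L1loc_cont => // z _; exact: cone_continuous.
  have := VleZ ((y i - f (x i)) / coneh R) lc (cone_Vle (x i) oD sp).
  apply: Vle_le; rewrite normrM distrC normfV (gtr0_norm h0) le_eqVlt.
  by apply/orP; left; apply/eqP; field; rewrite gt_eqF.
have [cS VS] := Vle_sum oD ck Vk.
exists (fun z => f z + \sum_i k i z); split.
- by move=> z Dz; apply: cvgD; [exact: cf|exact: cS].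
- by rewrite mulr_sumr; apply: VleD => //; exact: L1loc_cont.
- move=> i; rewrite (bigD1 i)//= big1 ?addr0; last first.
    move=> j ji; rewrite /k cone_far ?mulr0//.
    by have := sep i j; rewrite eq_sym ji => /(_ isT); lra.
  by rewrite /k cone_center divfK ?gt_eqF// addrC subrK.
Qed.

Lemma hs_functional_cfun D N (x : 'I_N -> R * R) (y : 'I_N -> R) (lam : \bar R) f c :
  open (D : set (R * R)) -> (forall i, D (x i)) -> cfun D f -> Vle D f c ->
  (hs_functional D x y lam f <= c%:E + lam * (\sum_i `|f (x i) - y i|)%:E)%E.
Proof.
move=> oD xD cf Vf; rewrite /hs_functional.
have -> : \sum_i `|point_value D f (x i) - y i| = \sum_i `|f (x i) - y i|.
  by apply: eq_bigr => i _; rewrite point_value_cfun.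
by apply: leeD => //; apply/(hessian_leP _ oD (L1loc_cont oD cf)).
Qed.

(** Comparison with continuous competitors suffices: infinite variation is trivial, and otherwise
    [rep g] has the same variation bound and the prescribed point values. *)
Lemma hs_functional_ge D N (x : 'I_N -> R * R) (y : 'I_N -> R) (lam : \bar R) g v :
  open (D : set (R * R)) -> (forall i, D (x i)) -> (0 <= lam)%E -> L1loc D g ->
  (forall h c, cfun D h -> Vle D h c -> (v <= c%:E + lam * (\sum_i `|h (x i) - y i|)%:E)%E) ->
  (v <= hs_functional D x y lam g)%E.
Proof.
move=> oD xD lam0 lg H; rewrite /hs_functional.
have s0 : (0 <= lam * (\sum_i `|point_value D g (x i) - y i|)%:E)%E.
  by rewrite mule_ge0// lee_fin sumr_ge0.
have [fin|inf] := ltP (hessian_schatten1 g D) +oo%E; last first.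
  move: inf; rewrite leye_eq => /eqP ->; rewrite addye ?leey//.
  by rewrite -ltNye; apply: lt_le_trans s0; exact: ltNyr.
have [c [-> cf Vf pv]] := finite_variation oD lg fin.
have -> : \sum_i `|point_value D g (x i) - y i| = \sum_i `|rep g (x i) - y i|.
  by apply: eq_bigr => i _; rewrite pv.
exact: H.
Qed.

End final.

Theorem theorem4p2 (R : realType) (Omega : set (R * R)) (N : nat)
    (x : 'I_N -> R * R) (y : 'I_N -> R) (lambda : \bar R)
    (Omega_open : open Omega)
    (x_in : forall i : 'I_N, Omega (x i))
    (x_distinct : injective x)
    (lambda_ge0 : (0 <= lambda)%E) :
  exists f : R * R -> R,
    L1loc Omega f /\
    forall g : R * R -> R, L1loc Omega g ->
      (hs_functional Omega x y lambda f <= hs_functional Omega x y lambda g)%E.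
Proof.
have K0 := Kc_gt0 R.
have sum0 h : 0 <= \sum_i `|h (x i) - y i| by apply: sumr_ge0.
(* Weight 0 is separate, since minimising sequences then have no control on their point values; the
   zero function is optimal. *)
have [l0|lpos] := eqVneq lambda 0%E.
  have cf : cfun Omega (fun=> 0 : R) by move=> z _; exact: cvg_cst.
  have Vf := @Vle_zero R Omega.
  exists (fun=> 0); split; first exact: L1loc_cont.
  move=> g lg; apply: (le_trans (hs_functional_cfun y lambda Omega_open x_in cf Vf)).
  rewrite l0 mul0e adde0; apply: hs_functional_ge => // h c _ Vh.
  by rewrite mul0e adde0 lee_fin; exact: Vle_ge0 Vh.
have l0 : (0 < lambda)%E by rewrite lt_def lpos.
have [lK|Kl] := leP lambda (Kc R)%:E.
  have [l [lE lp]] : exists l : R, lambda = l%:E /\ 0 < l <= Kc R.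
    case: lambda l0 lK {lambda_ge0 lpos} => [l| |] //.
    by rewrite lte_fin lee_fin => lp lK; exists l; rewrite lp lK.
  have [f [c [cf Vf Hf]]] := exists_minimizer y Omega_open x_in x_distinct lp.
  exists f; split; first exact: L1loc_cont.
  move=> g lg; apply: (le_trans (hs_functional_cfun y lambda Omega_open x_in cf Vf)).
  apply: hs_functional_ge => // h c' ch Vh.
  by rewrite lE -!EFinM -!EFinD lee_fin; exact: Hf.
have KK : 0 < Kc R <= Kc R by rewrite K0 lexx.
have [f0 [c [cf0 Vf0 Hf]]] := exists_minimizer y Omega_open x_in x_distinct KK.
have [f [cf Vf fx]] := interpolate y Omega_open x_in x_distinct cf0 Vf0.
(* [f] has no data term, so its cost is at most the minimum for weight [Kc], hence at most the cost
   of any competitor for the larger weight, infinite or not. *)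
exists f; split; first exact: L1loc_cont.
move=> g lg; apply: (le_trans (hs_functional_cfun y lambda Omega_open x_in cf Vf)).
rewrite [X in (lambda * X%:E)%E]big1 ?mule0 ?adde0; last by move=> i _; rewrite fx subrr normr0.
apply: hs_functional_ge => // h c' ch Vh.
apply: (@le_trans _ _ (c'%:E + (Kc R)%:E * (\sum_i `|h (x i) - y i|)%:E)%E).
  by rewrite -EFinM -EFinD lee_fin; exact: Hf.
by apply: leeD => //; apply: lee_wpmul2r; [rewrite lee_fin|exact: ltW].
Qed.
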